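(* Let $K\ge 1$ and $\beta>-1$, and set $$\alpha_K:=\sup_{f=h+\overline{g}\,\in\,\mathcal{S}_H(K)}\left|\frac{h''(0)}{2}\right|.$$ Then $\mathcal{S}_H(K)\subset\mathbf{a}^{p}_{\beta}$ for every $p$ with $0<p<(\beta+2)/\alpha_K$.
   Context: $\mathbb{D}=\{z\in\mathbb{C}:|z|<1\}$. $\mathcal{H}$ denotes the class of complex-valued harmonic functions $f=h+\overline{g}$ on $\mathbb{D}$, with $h,g$ analytic in $\mathbb{D}$, normalized by $h(0)=g(0)=0$ and $h'(0)=1$. Such an $f$ is sense-preserving if its Jacobian $J_f=|h'|^2-|g'|^2$ is positive on $\mathbb{D}$; then its analytic dilatation $\omega=g'/h'$ is an analytic map $\mathbb{D}\to\mathbb{D}$. $\mathcal{S}_H$ is the class of all sense-preserving univalent (injective) $f\in\mathcal{H}$. For $K\ge 1$ put $k=(K-1)/(K+1)\in[0,1)$, i.e. $K=(1+k)/(1-k)$. $\mathcal{S}_H(K)$ is the class of $f\in\mathcal{S}_H$ that are $K$-quasiconformal, i.e. satisfy $|\omega(z)|\le k$ for all $z\in\mathbb{D}$. For $\beta>-1$ and $0<p<\infty$, the weighted harmonic Bergman space $\mathbf{a}^p_\beta$ consists of all $f\in\mathcal{H}$ with $\int_{\mathbb{D}}|f(z)|^p\,dA_\beta(z)<\infty$, where $dA_\beta(z)=(\beta+1)(1-|z|^2)^\beta\,dA(z)$ and $dA(z)=\frac1\pi\,dx\,dy$ is normalized area measure on $\mathbb{D}$. *)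

(* Defs.v *)
From HB Require Import structures.
From mathcomp Require Import all_boot all_order all_algebra.
From mathcomp Require Import complex.
From mathcomp Require Import all_classical all_reals all_analysis.

Set Implicit Arguments.
Unset Strict Implicit.
Unset Printing Implicit Defensive.

Import Order.TTheory GRing.Theory Num.Theory.
Import numFieldNormedType.Exports.
Import ComplexField.Normc.

Local Open Scope classical_set_scope.
Local Open Scope ring_scope.

(* [R[i]^o] is R[i] seen as a normed space over itself, so that [derivable]
   and [derive1] are complex differentiability and the complex derivative;
   [normc] is the modulus with values in R. *)
Notation Cplx R := (R[i]^o)%type.

Definition unit_disk (R : realType) : set (Cplx R) := [set z | normc z < 1].
Arguments unit_disk : clear implicits.

Definition analytic_on_disk (R : realType) (h : Cplx R -> Cplx R) : Prop :=
  forall z, unit_disk R z -> derivable h z 1.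

(* All functions are total on R[i]; only their values on the disk matter.
   Sums h + conj g of this form are automatically harmonic, and f determines
   h and g on the disk. *)
Definition canonical_rep (R : realType) (f h g : Cplx R -> Cplx R) : Prop :=
  [/\ analytic_on_disk h, analytic_on_disk g
    & forall z, unit_disk R z -> f z = h z + ((g z)^*)%C] /\
  [/\ h 0 = 0, g 0 = 0 & derive1 h 0 = 1].

Definition harmonic_class (R : realType) : set (Cplx R -> Cplx R) :=
  [set f | exists h g, canonical_rep f h g].
Arguments harmonic_class : clear implicits.

Definition jac_det (R : realType) (h g : Cplx R -> Cplx R) (z : Cplx R) : R :=
  normc (derive1 h z) ^+ 2 - normc (derive1 g z) ^+ 2.

Definition dilatation (R : realType) (h g : Cplx R -> Cplx R) (z : Cplx R) :
  Cplx R := derive1 g z / derive1 h z.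

Definition SH_rep (R : realType) (f h g : Cplx R -> Cplx R) : Prop :=
  [/\ canonical_rep f h g,
      forall z, unit_disk R z -> 0 < jac_det h g z
    & set_inj (unit_disk R) f].

Definition SHK_rep (R : realType) (K : R) (f h g : Cplx R -> Cplx R) : Prop :=
  SH_rep f h g /\
  forall z, unit_disk R z -> normc (dilatation h g z) <= (K - 1) / (K + 1).

Definition SHK (R : realType) (K : R) : set (Cplx R -> Cplx R) :=
  [set f | exists h g, SHK_rep K f h g].

(* The supremum is taken in the extended reals, so that its finiteness is not
   built into the definition. *)
Definition alphaK (R : realType) (K : R) : \bar R :=
  ereal_sup [set x | exists f h g,
    SHK_rep K f h g /\ x = (normc (derive1n 2 h 0 / 2))%:E].

(* The integral of |f|^p over the disk against
   (beta + 1) (1 - |z|^2)^beta dx dy / pi, with z = x + i y. *)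
Definition bergman_integral (R : realType) (p beta : R)
    (f : Cplx R -> Cplx R) : \bar R :=
  (\int[(@lebesgue_measure R) \x (@lebesgue_measure R)]_(w in
      [set w : R * R | unit_disk R (w.1 +i* w.2)%C])
    (let z := (w.1 +i* w.2)%C in
     normc (f z) `^ p * ((beta + 1) * (1 - normc z ^+ 2) `^ beta / pi))%:E)%E.

Definition bergman (R : realType) (p beta : R) : set (Cplx R -> Cplx R) :=
  [set f | harmonic_class R f /\ (bergman_integral p beta f < +oo)%E].

(* Main.v *)
Require Import Defs.
From mathcomp Require Import all_boot all_order all_algebra.
From mathcomp Require Import all_classical all_reals all_analysis.
From mathcomp Require Import measurable_realfun complex ring lra.

(** Let [f = h + conj g] be in the class, with [|g'| <= k |h'|] on the disc. The
hypothesis on [p] yields a real [al > 0] with [alphaK K <= al] and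
[al * p < beta + 2]: an infinite [alphaK K] would force [p < 0].

Pointwise estimates. The class is stable under the Koebe transforms
[z |-> (f (moebius zeta z) - f zeta) / ((1 - |zeta|^2) h' zeta)]
([koebe_rep]), so the bound [al] on the second coefficient at the origin becomes,
at every point,
[|(1 - |z|^2) h'' z - 2 conj z h' z| <= 2 al |h' z|] ([pre_schwarzian_le]).
Integrated along radii it gives [h' = O((1 - |z|)^(- al - 1))] ([growth]).
Integrated along short segments it says that [h'] is nearly constant at scale
[1 - |c|] around [c]; since the variation of [conj g] is at most [k] times that
of [h], the map [f] is Lipschitz with constant [O(|h' c|)] there
([whitney_f_le]) and expanding on a smaller disc ([whitney_f_ge]). Hence [f]
maps a disc of radius [dl (1 - |c|)] onto a set that contains the disc of radius
[kap * |h' c| (1 - |c|)] around [f c] ([image_disc]); this is a quasiconformal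
form of Koebe's one quarter theorem.

Univalence enters through area. These pointwise estimates alone would only give
[p < (beta + 1) / al]. On the circles [|z| = 1 - 2^-(n+1)] take about [2^n]
points [c] at mutual distances of order [2^-n], and put
[d c = |h' c| (1 - |c|)]. The discs of radius [dl (1 - |c|)] around them are
disjoint, hence so are their images, and comparing areas gives
[sum (d c)^2 = O(r^2)] over the points with [|f c| <= r] ([level_packing]).
Cutting the values [|f c|] into dyadic layers turns this into
[sum |f c|^p (d c / |f c|)^2 = O(max |f c|^p) = O(2^(n al p))]
([dyadic_layers]).

Hardy's inequality. The points are the vertices of binary trees, the circles being
the generations. Passing from a parent [c] to a child replaces [|f c|^p] by at most
[(1 + eta) |f c|^p + C |f c|^p (d c / |f c|)^2] ([powRD_le]). With two children
per parent, [T n = 2^(- n (beta + 2)) * sum |f c|^p] therefore satisfies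
[T (n+1) <= 2^-(beta + 1) (1 + eta) T n + C 2^(- n (beta + 2 - al p))]. Both
ratios are smaller than one, for [eta] small, so [T] is summable
([tree_sum_bounded]). Finally the disc is covered by a square around the origin and
squares of side comparable with [1 - |c|] around the points [c], on which
[|f|] is [O(|f c|)], and the integral is bounded by the sum of [T]
([integral_cover]).

One fact of complex analysis carries all this: the derivative of a function that
is complex differentiable on the disc is differentiable
([derivative_differentiable]). It comes from Goursat's lemma on rectangles
([goursat]) and the integral formula for [h' a] over a square centred at [a]
([cauchy_deriv]). *)

Set Implicit Arguments.
Unset Strict Implicit.
Unset Printing Implicit Defensive.

Import Order.TTheory GRing.Theory Num.Theory.
Import numFieldNormedType.Exports.
Import ComplexField.Normc.

Local Open Scope classical_set_scope.
Local Open Scope ring_scope.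

Local Notation Re := complex.Re.
Local Notation Im := complex.Im.

(** * Complex differentiability and the mean value inequality *)

Section Gen.
Variable K : numFieldType.
(** The passage between [is_derive] and an explicit estimate of the remainder,
    over an arbitrary field of numbers so that it serves both real and complex
    derivatives. *)
Lemma is_derive_eps (f : K -> K) (x d : K) :
  (forall e, 0 < e -> exists2 r, 0 < r & forall w, `|w| < r ->
     `|f (x + w) - f x - d * w| <= e * `|w|) -> is_derive (x : K^o) 1 (f : K^o -> K^o) d.
Proof.
move=> H.
suff L : (fun h : K^o => h^-1 *: ((f : K^o -> K^o) (h *: (1:K^o) + x) - f x)) @ 0^' --> (d : K^o).
  split; first by apply/cvg_ex; exists d.
  exact: cvg_lim L.
apply/cvgrPdist_le => e e0; have [r r0 Hr] := H _ e0.
near=> w.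
have w0 : w != 0 by near: w; exact: nbhs_dnbhs_neq.
have wr : `|w| < r.
  near: w; apply: nbhs_dnbhs; apply/nbhs_ballP; exists r => //= w.
  by rewrite /ball /= sub0r normrN.
have := Hr _ wr.
rewrite [_ *: 1]mulr1 [w + x]addrC => H1.
have -> : d - w^-1 *: (f (x + w) - f x) = - (w^-1 * (f (x + w) - f x - d * w)).
  by rewrite /GRing.scale/=; field.
by rewrite normrN normrM normfV mulrC ler_pdivrMr ?normr_gt0.
Unshelve. all: by end_near. Qed.

Lemma eps_is_derive (f : K -> K) (x d : K) :
   is_derive (x : K^o) 1 (f : K^o -> K^o) d ->
  (forall e, 0 < e -> exists2 r, 0 < r & forall w, `|w| < r ->
     `|f (x + w) - f x - d * w| <= e * `|w|).
Proof.
move=> [Hd Hv] e e0.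
have L : (fun h : K^o => h^-1 *: ((f : K^o -> K^o) (h *: (1:K^o) + x) - f x)) @ 0^' --> (d : K^o).
  by rewrite -Hv.
move/cvgrPdist_le: L => /(_ _ e0).
rewrite near_withinE => /nbhs_ballP[r /= r0 Hr].
exists r => // w wr.
have [->|w0] := eqVneq w 0; first by rewrite addr0 subrr mulr0 subr0 normr0 mulr0.
have := Hr w; rewrite /ball /= sub0r normrN => /(_ wr w0).
rewrite [_ *: 1]mulr1 [w + x]addrC.
have -> : d - w^-1 *: (f (x + w) - f x) = - (w^-1 * (f (x + w) - f x - d * w)).
  by rewrite /GRing.scale/=; field.
by rewrite normrN normrM normfV mulrC ler_pdivrMr ?normr_gt0.
Qed.
End Gen.

Section Cplx.
Variable R : realType.
Local Notation C := R[i].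
Implicit Types (z w d : C) (h g : C -> C).

(** Complex differentiability with derivative [d], in the real-valued modulus:
    all estimates of the file are between reals, and this form avoids the norm
    of [R[i]], whose values are complex. *)
Definition cdiff h z d := forall e : R, 0 < e -> exists2 r : R, 0 < r &
  forall w, normc w < r -> normc (h (z + w) - h z - d * w) <= e * normc w.

Lemma normCE z : `|z| = (normc z)%:C%C.
Proof. by []. Qed.

Lemma gt0C (e : C) : 0 < e -> exists2 r : R, 0 < r & e = r%:C%C.
Proof. by case: e => a b; rewrite ltcE /= => /andP[/eqP -> a0]; exists a. Qed.

Lemma ltcRR (a b : R) : (a%:C%C < b%:C%C) = (a < b).
Proof. by rewrite ltcE /= eqxx. Qed.

Lemma lecRR (a b : R) : (a%:C%C <= b%:C%C) = (a <= b).
Proof. by rewrite lecE /= eqxx. Qed.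

Lemma cdiff_is_derive h z d : cdiff h z d <-> is_derive (z : C^o) 1 (h : C^o -> C^o) d.
Proof.
split=> [H|H].
  apply: is_derive_eps => e /gt0C[r r0 ->]; have [s s0 Hs] := H _ r0.
  exists s%:C%C; first by rewrite ltcRR.
  by move=> w; rewrite !normCE ltcRR => /Hs; rewrite -rmorphM lecRR.
move=> e e0; have e0' : 0 < e%:C%C by rewrite ltcRR.
have [_/gt0C[r r0 ->] Hr] := eps_is_derive H e0'.
exists r => // w wr; have := Hr w; rewrite !normCE ltcRR => /(_ wr).
by rewrite -rmorphM lecRR.
Qed.

Lemma normc_ge0 z : 0 <= normc z.
Proof. by case: z => a b; exact: sqrtr_ge0. Qed.

Lemma normcD z w : normc (z + w) <= normc z + normc w.
Proof. by rewrite -lecRR rmorphD; exact: (ler_normD z w). Qed.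

Lemma normcN z : normc (- z) = normc z.
Proof. by case: z => a b /=; rewrite !sqrrN. Qed.

Lemma normcB z w : normc (z - w) = normc (w - z).
Proof. by rewrite -normcN opprB. Qed.

Lemma normc_real (r : R) : normc r%:C%C = `|r|.
Proof. by rewrite /= expr0n /= addr0 sqrtr_sqr. Qed.

Lemma normc_eq0 z : (normc z == 0) = (z == 0).
Proof. by apply/eqP/eqP => [/eq0_normc//|->]; exact: normc0. Qed.

Lemma normc_gt0 z : (0 < normc z) = (z != 0).
Proof. by rewrite lt_def normc_ge0 normc_eq0 andbT. Qed.

Lemma normc_sub_le z w : normc z - normc w <= normc (z - w).
Proof. by rewrite lerBlDr -{1}(subrK w z) normcD. Qed.

Lemma normc_sqr z : normc z ^+ 2 = Re z ^+ 2 + Im z ^+ 2.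
Proof. by case: z => a b /=; rewrite sqr_sqrtr// addr_ge0 ?sqr_ge0. Qed.

Lemma normc_conj z : normc (z^*)%C = normc z.
Proof. by case: z => a b /=; rewrite sqrrN. Qed.

Lemma Re_le_normc z : `|Re z| <= normc z.
Proof.
by rewrite -(@ler_pXn2r _ 2) ?nnegrE ?normc_ge0// normc_sqr real_normK ?num_real// lerDl sqr_ge0.
Qed.

Lemma Im_le_normc z : `|Im z| <= normc z.
Proof.
by rewrite -(@ler_pXn2r _ 2) ?nnegrE ?normc_ge0// normc_sqr real_normK ?num_real// lerDr sqr_ge0.
Qed.

Lemma normc_le_ReIm z : normc z <= `|Re z| + `|Im z|.
Proof.
rewrite -(@ler_pXn2r _ 2) ?nnegrE ?normc_ge0 ?addr_ge0// normc_sqr sqrrD.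
by rewrite !real_normK ?num_real// lerD2r lerDl mulrn_wge0// mulr_ge0.
Qed.

Lemma conj_mul z : ((z^*)%C * z) = (normc z ^+ 2)%:C%C.
Proof. by rewrite normc_sqr; case: z => a b; simpc; congr (_ +i* _)%C; ring. Qed.

Lemma ReD z w : Re (z + w) = Re z + Re w. Proof. by case: z w => [a b] [c d]. Qed.

Lemma ReB z w : Re (z - w) = Re z - Re w. Proof. by case: z w => [a b] [c d]. Qed.

Lemma ImD z w : Im (z + w) = Im z + Im w. Proof. by case: z w => [a b] [c d]. Qed.

Lemma ImB z w : Im (z - w) = Im z - Im w. Proof. by case: z w => [a b] [c d]. Qed.

Lemma Re_realM (r : R) z : Re (r%:C%C * z) = r * Re z.
Proof. by case: z => a b /=; rewrite mul0r subr0. Qed.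

Lemma conjcM z w : ((z * w)^*)%C = ((z^*)%C * (w^*)%C) :> C.
Proof. by case: z w => [a b] [c d]; simpc; congr (_ +i* _)%C; ring. Qed.

Lemma conjcKK z : ((z^*)^*)%C = z.
Proof. by case: z => a b; rewrite /= opprK. Qed.

Lemma conjcB z w : ((z - w)^*)%C = (z^*)%C - (w^*)%C.
Proof. by case: z w => [a b] [c d]; simpc; congr (_ +i* _)%C; ring. Qed.

Lemma conjc_re (r : R) : ((r%:C)^*)%C = r%:C%C :> C.
Proof. by rewrite /= oppr0. Qed.

Lemma normc2 : normc (2 : C) = 2.
Proof. by rewrite -[2](rmorph_nat (real_complex R)) normc_real ger0_norm. Qed.

Lemma cdiff_derivable h z : derivable (h : C^o -> C^o) z 1 ->
  cdiff h z (derive1 (h : C^o -> C^o) z).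
Proof. by move=> H; apply/cdiff_is_derive; rewrite derive1E; exact: derivableP. Qed.

Lemma cdiff_derive1 h z d : cdiff h z d -> derivable (h : C^o -> C^o) z 1.
Proof. by move=> /cdiff_is_derive[]. Qed.

Lemma cdiff_val h z d : cdiff h z d -> derive1 (h : C^o -> C^o) z = d.
Proof. by move=> /cdiff_is_derive[_]; rewrite derive1E. Qed.

Lemma cdiff_cst c z : cdiff (fun=> c) z 0.
Proof. by apply/cdiff_is_derive; exact: is_derive_cst. Qed.

Lemma cdiff_id z : cdiff id z 1.
Proof. by apply/cdiff_is_derive; exact: is_derive_id. Qed.

Lemma cdiffD h g z a b : cdiff h z a -> cdiff g z b -> cdiff (fun w => h w + g w) z (a + b).
Proof. by move=> /cdiff_is_derive H /cdiff_is_derive G; apply/cdiff_is_derive; exact: is_deriveD. Qed.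

Lemma cdiffB h g z a b : cdiff h z a -> cdiff g z b -> cdiff (fun w => h w - g w) z (a - b).
Proof. by move=> /cdiff_is_derive H /cdiff_is_derive G; apply/cdiff_is_derive; exact: is_deriveB. Qed.

Lemma cdiffM h g z a b : cdiff h z a -> cdiff g z b ->
  cdiff (fun w => h w * g w) z (a * g z + h z * b).
Proof.
move=> /cdiff_is_derive H /cdiff_is_derive G; apply/cdiff_is_derive.
have -> : a * g z + h z * b = h z *: (b : C^o) + g z *: (a : C^o).
  by rewrite /GRing.scale /=; ring.
exact: (@is_deriveM C C^o h g z 1 a b).
Qed.

Lemma cdiffZ h z a c : cdiff h z a -> cdiff (fun w => c * h w) z (c * a).
Proof. by move=> H; have := cdiffM (cdiff_cst c z) H; rewrite mul0r add0r. Qed.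

Lemma cdiffV h z a : h z != 0 -> cdiff h z a -> cdiff (fun w => (h w)^-1) z (- a / h z ^+ 2).
Proof.
move=> h0 /cdiff_is_derive H; apply/cdiff_is_derive.
have Hd := @ex_derive _ _ _ _ _ _ _ H.
apply: DeriveDef; first exact: (@derivableV C C^o h z 1 h0 Hd).
rewrite (@deriveV C C^o h z 1 h0 Hd) derive_val /GRing.scale /=; field.
exact: h0.
Qed.

Lemma cdiff_ext h g z a : (exists2 r : R, 0 < r & forall w, normc (w - z) < r -> h w = g w) ->
  cdiff h z a -> cdiff g z a.
Proof.
move=> [r r0 E] H e /H[s s0 Hs]; exists (Num.min r s); first by rewrite lt_min r0.
move=> w; rewrite lt_min => /andP[wr ws].
rewrite -!E; first exact: Hs.
  by rewrite subrr normc0.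
by rewrite addrC addKr.
Qed.

Lemma cdiff_lip h z a : cdiff h z a -> exists2 r : R, 0 < r &
  forall w, normc w < r -> normc (h (z + w) - h z) <= (normc a + 1) * normc w.
Proof.
move=> /(_ 1 ltr01)[r r0 H]; exists r => // w /H Hw.
rewrite -(subrK (a * w) (h _ - _)) (le_trans (normcD _ _))// normcM.
by rewrite mul1r in Hw; rewrite mulrDl mul1r addrC lerD2l.
Qed.

Lemma cdiff_cont h z a : cdiff h z a -> forall e : R, 0 < e -> exists2 r : R, 0 < r &
  forall w, normc w < r -> normc (h (z + w) - h z) < e.
Proof.
move=> /cdiff_lip[r r0 H] e e0.
have A0 : 0 < normc a + 1 by rewrite ltr_wpDl ?normc_ge0.
exists (Num.min r (e / (normc a + 1))); first by rewrite lt_min r0 divr_gt0.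
move=> w; rewrite lt_min => /andP[/H Hw we]; apply: le_lt_trans Hw _.
by rewrite mulrC -ltr_pdivlMr.
Qed.

Lemma cdiff_comp h g z a b : cdiff g z a -> cdiff h (g z) b ->
  cdiff (fun w => h (g w)) z (b * a).
Proof.
move=> G H e e0; have e20 : 0 < e / 2 by rewrite divr_gt0.
have [r1 r10 L] := cdiff_lip G.
have A0 : 0 < normc a + 1 by rewrite ltr_wpDl ?normc_ge0.
have B0 : 0 < normc b + 1 by rewrite ltr_wpDl ?normc_ge0.
have [s s0 Hs] := H (e / 2 / (normc a + 1)) (divr_gt0 e20 A0).
have [r2 r20 Gr] := G (e / 2 / (normc b + 1)) (divr_gt0 e20 B0).
exists (Num.min r1 (Num.min r2 (s / (normc a + 1)))).
  by rewrite !lt_min r10 r20 divr_gt0.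
move=> w; rewrite !lt_min => /and3P[/L Lw /Gr Gw ws].
set v := g (z + w) - g z.
have -> : g (z + w) = g z + v by rewrite /v; ring.
have vs : normc v < s by apply: le_lt_trans Lw _; rewrite mulrC -ltr_pdivlMr.
have := Hs _ vs => Hv.
have -> : h (g z + v) - h (g z) - b * a * w =
  (h (g z + v) - h (g z) - b * v) + b * (v - a * w) by ring.
apply: le_trans (normcD _ _) _; rewrite normcM.
have h1 : e / 2 / (normc a + 1) * normc v <= e / 2 * normc w.
  rewrite mulrAC ler_pdivrMr// -[leRHS]mulrA ler_pM2l ?divr_gt0//.
  by rewrite [leRHS]mulrC.
have h2 : normc b * normc (v - a * w) <= e / 2 * normc w.
  apply: (@le_trans _ _ ((normc b + 1) * normc (v - a * w))).
    by rewrite ler_wpM2r ?normc_ge0// lerDl.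
  rewrite mulrC -ler_pdivlMr//; apply: le_trans Gw _.
  by rewrite [leRHS]mulrAC.
apply: le_trans (lerD (le_trans Hv h1) h2) _.
by rewrite -mulrDl -splitr.
Qed.

Lemma is_derive_line h (a b c d : C) (t : R) : cdiff h (a + t%:C%C * b) d ->
  is_derive t 1 (fun t : R => Re (c * h (a + t%:C%C * b))) (Re (c * (d * b))).
Proof.
move=> H; apply: is_derive_eps => e e0.
have A0 : 0 < normc b + 1 by rewrite ltr_wpDl ?normc_ge0.
have B0 : 0 < normc c + 1 by rewrite ltr_wpDl ?normc_ge0.
have [s s0 Hs] := H (e / ((normc c + 1) * (normc b + 1))) (divr_gt0 e0 (mulr_gt0 B0 A0)).
exists (s / (normc b + 1)); first by rewrite divr_gt0.
move=> w ws.
have nw : normc (w%:C%C * b) <= `|w| * (normc b + 1).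
  by rewrite normcM normc_real ler_wpM2l// lerDl.
have := Hs (w%:C%C * b); rewrite (le_lt_trans nw) -?ltr_pdivlMr// => /(_ isT) Hw.
have -> : Re (c * h (a + (t + w)%:C%C * b)) - Re (c * h (a + t%:C%C * b)) - Re (c * (d * b)) * w
 = Re (c * (h (a + t%:C%C * b + w%:C%C * b) - h (a + t%:C%C * b) - d * (w%:C%C * b))).
  rewrite [_ * w]mulrC -Re_realM -!ReB rmorphD /= ; congr Re.
  rewrite [(t%:C%C + w%:C%C) * b]mulrDl addrA; ring.
apply: le_trans (Re_le_normc _) _; rewrite normcM.
apply: (@le_trans _ _ ((normc c + 1) * (e / ((normc c + 1) * (normc b + 1)) * (`|w| * (normc b + 1))))).
  apply: ler_pM; rewrite ?normc_ge0 ?lerDl//; apply: le_trans Hw _.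
  by rewrite ler_wpM2l// ltW// divr_gt0// mulr_gt0.
rewrite le_eqVlt; apply/orP; left; apply/eqP; field.
by rewrite !gt_eqF.
Qed.

(** A complex function has no intermediate derivative, but the real function
    [t |-> Re (conj v * h (a + t b))], with [v = h (a + b) - h a], increases by
    [|v|^2] on [0, 1] and has slope at most [|v| M |b|]. *)
Lemma mean_value h (dh : C -> C) (a b : C) (M : R) :
  (forall t : R, 0 <= t <= 1 -> cdiff h (a + t%:C%C * b) (dh (a + t%:C%C * b))) ->
  (forall t : R, 0 <= t <= 1 -> normc (dh (a + t%:C%C * b)) <= M) ->
  normc (h (a + b) - h a) <= M * normc b.
Proof.
move=> D B; set v := h (a + b) - h a.
have [v0|v0] := eqVneq v 0.
  rewrite v0 normc0 mulr_ge0 ?normc_ge0//; apply: le_trans (normc_ge0 _) (B 0 _).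
  by rewrite lexx ler01.
pose phi (t : R) := Re ((v^*)%C * h (a + t%:C%C * b)).
pose dphi (t : R) := Re ((v^*)%C * (dh (a + t%:C%C * b) * b)).
have Dphi (t : R) : 0 <= t <= 1 -> is_derive t 1 phi (dphi t).
  by move=> t01; exact: is_derive_line (D _ t01).
have [||c c01] := @MVT R phi dphi 0 1 ltr01.
- by move=> x; rewrite in_itv/= => /andP[x0 x1]; apply: Dphi; rewrite !ltW.
- apply: derivable_within_continuous => x; rewrite in_itv/= => x01.
  by have [] := Dphi _ x01.
rewrite /phi /= mul1r mul0r addr0 subr0 mulr1 -ReB -mulrBr -/v conj_mul /= => E.
have c01' : 0 <= c <= 1 by move: c01; rewrite in_itv/= => /andP[? ?]; rewrite !ltW.
have : normc v ^+ 2 <= normc v * (M * normc b).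
  rewrite E; apply: le_trans (ler_norm _) _; apply: le_trans (Re_le_normc _) _.
  rewrite !normcM normc_conj ler_wpM2l ?normc_ge0// ler_wpM2r ?normc_ge0//.
  exact: B.
by rewrite expr2 ler_pM2l ?normc_gt0.
Qed.

Lemma seg_dist (c z : C) (t : R) : 0 <= t <= 1 ->
  normc (c + t%:C%C * (z - c) - c) <= normc (z - c).
Proof.
move=> /andP[t0 t1]; have -> : c + t%:C%C * (z - c) - c = t%:C%C * (z - c) by ring.
by rewrite normcM normc_real ger0_norm// -[leRHS]mul1r ler_wpM2r ?normc_ge0.
Qed.

Lemma mean_value_disc h (dh : C -> C) (M : R) c z :
  (forall w, normc (w - c) <= normc (z - c) -> cdiff h w (dh w)) ->
  (forall w, normc (w - c) <= normc (z - c) -> normc (dh w) <= M) ->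
  normc (h z - h c) <= M * normc (z - c).
Proof.
move=> D HM; have := @mean_value h dh c (z - c) M.
have -> : c + (z - c) = z by ring.
by apply=> t t01; [apply: D|apply: HM]; exact: seg_dist.
Qed.
End Cplx.

(** * Integrals of continuous functions along rectangles *)

Section PathInt.
Variable R : realType.
Local Notation C := R[i].
Local Notation mu := (@lebesgue_measure R).
Implicit Types (phi psi : R -> C) (F G : C -> C).

(** Two-sided continuity at [x], also at the endpoints of an interval of
    integration: every integrand below is the restriction of a function that is
    continuous on a neighbourhood of the rectangle. *)
Definition ccont phi (x : R) := forall e : R, 0 < e -> exists2 r : R, 0 < r &
  forall w : R, `|w| < r -> normc (phi (x + w) - phi x) <= e.

Definition ccont_on (a b : R) phi := forall x, a <= x <= b -> ccont phi x.

Lemma ccontD phi psi x : ccont phi x -> ccont psi x -> ccont (fun t => phi t + psi t) x.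
Proof.
move=> H G e e0; have e20 : 0 < e / 2 by rewrite divr_gt0.
have [r r0 Hr] := H _ e20; have [s s0 Hs] := G _ e20.
exists (Num.min r s); first by rewrite lt_min r0.
move=> w; rewrite lt_min => /andP[/Hr h1 /Hs h2].
rewrite opprD addrACA (le_trans (normcD _ _))// [leRHS]splitr.
by rewrite lerD.
Qed.

Lemma ccontZ (c : C) phi x : ccont phi x -> ccont (fun t => c * phi t) x.
Proof.
move=> H e e0; have c0 : 0 < normc c + 1 by rewrite ltr_wpDl ?normc_ge0.
have [r r0 Hr] := H _ (divr_gt0 e0 c0); exists r => // w /Hr.
rewrite ler_pdivlMr// -mulrBr normcM => h; apply: le_trans h.
by rewrite mulrC ler_wpM2l ?normc_ge0// lerDl.
Qed.

Lemma ccontB phi psi x : ccont phi x -> ccont psi x -> ccont (fun t => phi t - psi t) x.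
Proof.
move=> H G; have -> : (fun t => phi t - psi t) = (fun t => phi t + (-1) * psi t).
  by apply/funext => t; rewrite mulN1r.
exact/ccontD/ccontZ.
Qed.

Lemma ccont_Re phi x : ccont phi x -> {for x, continuous (fun t => Re (phi t))}.
Proof.
move=> H; apply/cvgrPdist_le => e e0; have [r r0 Hr] := H _ e0.
apply/nbhs_ballP; exists r => //= y; rewrite /ball /= => xy.
have := Hr (y - x); rewrite distrC => /(_ xy).
have -> : x + (y - x) = y by ring.
rewrite distrC -ReB; apply: le_trans; exact: Re_le_normc.
Qed.

Lemma ccont_Im phi x : ccont phi x -> {for x, continuous (fun t => Im (phi t))}.
Proof.
move=> H; apply/cvgrPdist_le => e e0; have [r r0 Hr] := H _ e0.
apply/nbhs_ballP; exists r => //= y; rewrite /ball /= => xy.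
have := Hr (y - x); rewrite distrC => /(_ xy).
have -> : x + (y - x) = y by ring.
rewrite distrC -ImB; apply: le_trans; exact: Im_le_normc.
Qed.

Lemma cont_integrable (a b : R) (f : R -> R) :
  (forall x, a <= x <= b -> {for x, continuous f}) ->
  mu.-integrable `[a, b] (EFin \o f).
Proof.
move=> H; apply: continuous_compact_integrable; first exact: segment_compact.
apply: continuous_in_subspaceT => x; rewrite inE /= in_itv /=; exact: H.
Qed.

Lemma Rint_cst (a b c : R) : a <= b -> \int[mu]_(x in `[a, b]) c = c * (b - a).
Proof.
move=> ab; rewrite Rintegral_cst//; congr (_ * _).
transitivity (fine (lebesgue_measure (`[a, b]%classic : set R))) => //.
rewrite lebesgue_measure_itv/= lte_fin.
have [//|ba] := ltP a b.
by have -> : a = b by [apply/eqP; rewrite eq_le ab]; rewrite subrr.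
Qed.

Definition cint (a b : R) phi : C :=
  ((\int[mu]_(x in `[a, b]) Re (phi x)) +i* (\int[mu]_(x in `[a, b]) Im (phi x)))%C.

Lemma ccont_on_int a b phi : ccont_on a b phi ->
  mu.-integrable `[a, b] (EFin \o (fun x => Re (phi x))) /\
  mu.-integrable `[a, b] (EFin \o (fun x => Im (phi x))).
Proof.
by move=> H; split; apply: cont_integrable => x /H; [exact: ccont_Re|exact: ccont_Im].
Qed.

Lemma eq_cint a b phi psi : (forall x, a <= x <= b -> phi x = psi x) ->
  cint a b phi = cint a b psi.
Proof.
move=> E; congr (_ +i* _)%C; apply: eq_Rintegral => x; rewrite inE/= in_itv/= => /E -> //.
Qed.

Lemma cintD a b phi psi : ccont_on a b phi -> ccont_on a b psi ->
  cint a b (fun x => phi x + psi x) = cint a b phi + cint a b psi.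
Proof.
move=> /ccont_on_int[h1 h2] /ccont_on_int[h3 h4]; rewrite /cint; simpc.
congr (_ +i* _)%C; rewrite -RintegralD//; apply: eq_Rintegral => x _.
  by rewrite ReD.
by rewrite ImD.
Qed.

Lemma cintZ a b (c : C) phi : ccont_on a b phi ->
  cint a b (fun x => c * phi x) = c * cint a b phi.
Proof.
move=> H; have [h1 h2] := ccont_on_int H; case: c => c1 c2; rewrite /cint; simpc.
have I1 (k : R) f : mu.-integrable `[a, b] (EFin \o f) ->
  mu.-integrable `[a, b] (EFin \o (fun x => k * f x)).
  by move=> hf; exact: (@integrableZl _ _ R mu _ (measurable_itv `[a, b]) k _ hf).
congr (_ +i* _)%C; rewrite -!RintegralZl//.
  rewrite -RintegralB//; [|exact: I1|exact: I1].
  by apply: eq_Rintegral => x _; case: (phi x).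
rewrite -RintegralD//; [|exact: I1|exact: I1].
by apply: eq_Rintegral => x _; case: (phi x).
Qed.

Lemma cintB a b phi psi : ccont_on a b phi -> ccont_on a b psi ->
  cint a b (fun x => phi x - psi x) = cint a b phi - cint a b psi.
Proof.
move=> H G; rewrite -[in RHS]mulN1r -cintZ// -cintD//; last by move=> x /G; exact: ccontZ.
by apply: eq_cint => x _; rewrite mulN1r.
Qed.

Lemma cint_cst a b (c : C) : a <= b -> cint a b (fun=> c) = (b - a)%:C%C * c.
Proof.
move=> ab; case: c => p q; rewrite /cint /= !Rint_cst//; simpc.
by rewrite ![_ * (b - a)]mulrC.
Qed.

Lemma cint_split a m b phi : a <= m -> m <= b -> ccont_on a b phi ->
  cint a b phi = cint a m phi + cint m b phi.
Proof.
move=> am mb H; have [h1 h2] := ccont_on_int H; rewrite /cint; simpc.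
have I1 f : mu.-integrable `[a, b] (EFin \o f) ->
  \int[mu]_(x in `[a, b]) f x = \int[mu]_(x in `[a, m]) f x + \int[mu]_(x in `[m, b]) f x.
  move=> hf; apply/eqP; rewrite addrC -subr_eq; apply/eqP.
  rewrite Rintegral_itvB ?bnd_simp// Rintegral_itv_obnd_cbnd//.
  apply: integrableS hf => //; apply: subset_itvr; by rewrite bnd_simp.
by congr (_ +i* _)%C; exact: I1.
Qed.

Lemma Rint_le a b (f : R -> R) M : a <= b -> mu.-integrable `[a, b] (EFin \o f) ->
  (forall x, a <= x <= b -> `|f x| <= M) -> `|\int[mu]_(x in `[a, b]) f x| <= M * (b - a).
Proof.
move=> ab hf H; apply: le_trans (le_normr_Rintegral _ hf) _ => //.
have -> : M * (b - a) = \int[mu]_(x in `[a, b]) M.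
  by rewrite Rint_cst.
apply: le_Rintegral => //; first exact: (integrable_abse hf).
by apply: cont_integrable => x _; exact: cst_continuous.
Qed.

(** The factor 2 comes from bounding the real and imaginary parts separately. *)
Lemma cint_le a b phi M : a <= b -> ccont_on a b phi ->
  (forall x, a <= x <= b -> normc (phi x) <= M) -> normc (cint a b phi) <= 2 * M * (b - a).
Proof.
move=> ab H B; have [h1 h2] := ccont_on_int H.
apply: le_trans (normc_le_ReIm _) _; rewrite -mulrA mulr2n mulrDl mul1r.
apply: lerD; apply: Rint_le => // x /B; apply: le_trans; [exact: Re_le_normc|exact: Im_le_normc].
Qed.

Lemma Rint_ge a b (f : R -> R) (m : R) : a <= b ->
  (forall x, a <= x <= b -> {for x, continuous f}) -> (forall x, a <= x <= b -> m <= f x) ->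
  m * (b - a) <= \int[mu]_(x in `[a, b]) f x.
Proof.
move=> ab hf H.
have -> : m * (b - a) = \int[mu]_(x in `[a, b]) m.
  by rewrite Rint_cst.
apply: le_Rintegral => //; last exact: cont_integrable.
by apply: cont_integrable => x _; exact: cst_continuous.
Qed.

Definition fcont F z := forall e : R, 0 < e -> exists2 r : R, 0 < r &
  forall w, normc w < r -> normc (F (z + w) - F z) <= e.

Lemma cdiff_fcont F z d : cdiff F z d -> fcont F z.
Proof.
by move=> /cdiff_cont H e /H[r r0 Hr]; exists r => // w /Hr/ltW.
Qed.

Lemma fcontB F G z : fcont F z -> fcont G z -> fcont (fun w => F w - G w) z.
Proof.
move=> H K e e0; have e20 : 0 < e / 2 by rewrite divr_gt0.
have [r r0 Hr] := H _ e20; have [s s0 Hs] := K _ e20.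
exists (Num.min r s); first by rewrite lt_min r0.
move=> w; rewrite lt_min => /andP[/Hr h1 /Hs h2].
have -> : F (z + w) - G (z + w) - (F z - G z) = (F (z + w) - F z) - (G (z + w) - G z) by ring.
rewrite (le_trans (normcD _ _))// normcN [leRHS]splitr.
by rewrite lerD.
Qed.

Lemma fcontM F G z : fcont F z -> fcont G z -> fcont (fun w => F w * G w) z.
Proof.
move=> H K e e0.
have A0 : 0 < normc (F z) + 1 by rewrite ltr_wpDl ?normc_ge0.
have B0 : 0 < normc (G z) + 1 by rewrite ltr_wpDl ?normc_ge0.
have A1 : normc (F z) + 1 != 0 by rewrite gt_eqF.
have B1 : normc (G z) + 1 != 0 by rewrite gt_eqF.
have e20 : 0 < e / 2 by rewrite divr_gt0.
have [r r0 Hr] := H _ (divr_gt0 e20 B0).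
have [s s0 Hs] := K _ (divr_gt0 e20 A0).
have [t t0 Ht] := K _ ltr01.
exists (Num.min r (Num.min s t)); first by rewrite !lt_min r0 s0.
move=> w; rewrite !lt_min => /and3P[/Hr h1 /Hs h2 /Ht h3].
have -> : F (z + w) * G (z + w) - F z * G z =
  (F (z + w) - F z) * G (z + w) + F z * (G (z + w) - G z) by ring.
rewrite (le_trans (normcD _ _))// [leRHS]splitr !normcM; apply: lerD.
  rewrite -[leRHS](divfK B1).
  apply: ler_pM; rewrite ?normc_ge0//.
  rewrite -lerBlDl (le_trans _ h3)//; exact: normc_sub_le.
rewrite -[leRHS](divfK A1) mulrC.
by apply: ler_pM; rewrite ?normc_ge0// lerDl.
Qed.

Lemma fcont_x F (x y : R) : fcont F (x +i* y)%C -> ccont (fun x => F (x +i* y)%C) x.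
Proof.
move=> H e /H[r r0 Hr]; exists r => // w wr.
have := Hr w%:C%C; rewrite normc_real => /(_ wr).
by rewrite /=; simpc.
Qed.

Lemma fcont_y F (x y : R) : fcont F (x +i* y)%C -> ccont (fun y => F (x +i* y)%C) y.
Proof.
move=> H e /H[r r0 Hr]; exists r => // w wr.
have := Hr (0 +i* w)%C; rewrite /normc expr0n/= add0r sqrtr_sqr => /(_ wr).
by rewrite /=; simpc.
Qed.

(** The integral of [F dz] around the rectangle, counterclockwise, with opposite
    sides grouped: the grouping makes the integrands of affine functions constant. *)
Definition contour F (x0 x1 y0 y1 : R) : C :=
  cint x0 x1 (fun x => F (x +i* y0)%C - F (x +i* y1)%C) +
  'i%C * cint y0 y1 (fun y => F (x1 +i* y)%C - F (x0 +i* y)%C).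

Definition fcont_on F (x0 x1 y0 y1 : R) :=
  forall x y, x0 <= x <= x1 -> y0 <= y <= y1 -> fcont F (x +i* y)%C.

Lemma ccont_onB a b phi psi : ccont_on a b phi -> ccont_on a b psi ->
  ccont_on a b (fun t => phi t - psi t).
Proof. by move=> H G x hx; apply: ccontB; [exact: H|exact: G]. Qed.

(** The contour integral sees only the four sides, and a singularity inside is
    allowed. *)
Definition on_bdry (P : C -> Prop) (x0 x1 y0 y1 : R) :=
  (forall x, x0 <= x <= x1 -> P (x +i* y0)%C /\ P (x +i* y1)%C) /\
  (forall y, y0 <= y <= y1 -> P (x0 +i* y)%C /\ P (x1 +i* y)%C).

Lemma on_bdry_all (P : C -> Prop) (x0 x1 y0 y1 : R) : x0 <= x1 -> y0 <= y1 ->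
  (forall x y, x0 <= x <= x1 -> y0 <= y <= y1 -> P (x +i* y)%C) -> on_bdry P x0 x1 y0 y1.
Proof. by move=> h1 h2 H; split=> [x|y] h; split; apply: H; rewrite ?lexx ?h1 ?h2. Qed.

Lemma on_bdryI (P Q T : C -> Prop) (x0 x1 y0 y1 : R) : (forall z, P z -> Q z -> T z) ->
  on_bdry P x0 x1 y0 y1 -> on_bdry Q x0 x1 y0 y1 -> on_bdry T x0 x1 y0 y1.
Proof.
by move=> H [p1 p2] [q1 q2]; split=> t ht; [have [? ?] := p1 _ ht; have [? ?] := q1 _ ht|
  have [? ?] := p2 _ ht; have [? ?] := q2 _ ht]; split; exact: H.
Qed.

Lemma bdry_fx F x0 x1 y0 y1 : on_bdry (fcont F) x0 x1 y0 y1 ->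
  ccont_on x0 x1 (fun x => F (x +i* y0)%C) /\ ccont_on x0 x1 (fun x => F (x +i* y1)%C).
Proof. by move=> [H _]; split=> x /H[h1 h2]; exact: fcont_x. Qed.

Lemma bdry_fy F x0 x1 y0 y1 : on_bdry (fcont F) x0 x1 y0 y1 ->
  ccont_on y0 y1 (fun y => F (x0 +i* y)%C) /\ ccont_on y0 y1 (fun y => F (x1 +i* y)%C).
Proof. by move=> [_ H]; split=> x /H[h1 h2]; exact: fcont_y. Qed.

Lemma contour_splitx F x0 m x1 y0 y1 : x0 <= m -> m <= x1 -> on_bdry (fcont F) x0 x1 y0 y1 ->
  (forall y, y0 <= y <= y1 -> fcont F (m +i* y)%C) ->
  contour F x0 x1 y0 y1 = contour F x0 m y0 y1 + contour F m x1 y0 y1.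
Proof.
move=> h1 h2 H Hm; have [f1 f2] := bdry_fx H; have [f3 f4] := bdry_fy H.
have fm : ccont_on y0 y1 (fun y => F (m +i* y)%C) by move=> y /Hm; exact: fcont_y.
rewrite /contour (@cint_split x0 m x1)//; last exact: ccont_onB.
rewrite (@eq_cint y0 y1 _ (fun y => (F (x1 +i* y)%C - F (m +i* y)%C) + (F (m +i* y)%C - F (x0 +i* y)%C)));
  last by move=> y _; rewrite addrA subrK.
rewrite [X in _ + 'i%C * X = _]cintD; do ?exact: ccont_onB.
rewrite mulrDr; ring.
Qed.

Lemma contour_splity F x0 x1 y0 m y1 : y0 <= m -> m <= y1 -> on_bdry (fcont F) x0 x1 y0 y1 ->
  (forall x, x0 <= x <= x1 -> fcont F (x +i* m)%C) ->
  contour F x0 x1 y0 y1 = contour F x0 x1 y0 m + contour F x0 x1 m y1.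
Proof.
move=> h1 h2 H Hm; have [f1 f2] := bdry_fx H; have [f3 f4] := bdry_fy H.
have fm : ccont_on x0 x1 (fun x => F (x +i* m)%C) by move=> x /Hm; exact: fcont_x.
rewrite /contour (@cint_split y0 m y1)//; last exact: ccont_onB.
rewrite (@eq_cint x0 x1 _ (fun x => (F (x +i* y0)%C - F (x +i* m)%C) + (F (x +i* m)%C - F (x +i* y1)%C)));
  last by move=> y _; rewrite addrA subrK.
rewrite [X in X + _ = _]cintD; do ?exact: ccont_onB.
rewrite mulrDr; ring.
Qed.

Lemma contour_ext F G x0 x1 y0 y1 : on_bdry (fun z => F z = G z) x0 x1 y0 y1 ->
  contour F x0 x1 y0 y1 = contour G x0 x1 y0 y1.
Proof.
move=> [H K]; rewrite /contour.
rewrite (@eq_cint x0 x1 _ (fun x => G (x +i* y0)%C - G (x +i* y1)%C)); last by move=> t /H[-> ->].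
by rewrite (@eq_cint y0 y1 _ (fun y => G (x1 +i* y)%C - G (x0 +i* y)%C)) // => t /K[-> ->].
Qed.

Lemma contourB F G x0 x1 y0 y1 : on_bdry (fcont F) x0 x1 y0 y1 -> on_bdry (fcont G) x0 x1 y0 y1 ->
  contour (fun z => F z - G z) x0 x1 y0 y1 = contour F x0 x1 y0 y1 - contour G x0 x1 y0 y1.
Proof.
move=> HF HG; have [f1 f2] := bdry_fx HF; have [f3 f4] := bdry_fy HF.
have [g1 g2] := bdry_fx HG; have [g3 g4] := bdry_fy HG.
rewrite /contour opprD addrACA -mulrBr -!cintB//; do ?exact: ccont_onB.
rewrite (@eq_cint x0 x1 _ (fun x => F (x +i* y0)%C - F (x +i* y1)%C - (G (x +i* y0)%C - G (x +i* y1)%C)));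
  last by move=> t _; ring.
by rewrite (@eq_cint y0 y1 _ (fun y => F (x1 +i* y)%C - F (x0 +i* y)%C - (G (x1 +i* y)%C - G (x0 +i* y)%C)))
  // => t _; ring.
Qed.

Lemma contourZ (c : C) F x0 x1 y0 y1 : on_bdry (fcont F) x0 x1 y0 y1 ->
  contour (fun z => c * F z) x0 x1 y0 y1 = c * contour F x0 x1 y0 y1.
Proof.
move=> HF; have [f1 f2] := bdry_fx HF; have [f3 f4] := bdry_fy HF.
rewrite /contour mulrDr [c * ('i%C * _)]mulrCA -[c * cint x0 x1 _]cintZ// -?[c * cint y0 y1 _]cintZ//; do ?exact: ccont_onB.
rewrite (@eq_cint x0 x1 _ (fun x => c * (F (x +i* y0)%C - F (x +i* y1)%C)));
  last by move=> t _; ring.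
by rewrite (@eq_cint y0 y1 _ (fun y => c * (F (x1 +i* y)%C - F (x0 +i* y)%C))) // => t _; ring.
Qed.

Lemma contour_le F x0 x1 y0 y1 M : x0 <= x1 -> y0 <= y1 ->
  on_bdry (fcont F) x0 x1 y0 y1 -> on_bdry (fun z => normc (F z) <= M) x0 x1 y0 y1 ->
  normc (contour F x0 x1 y0 y1) <= 4 * M * ((x1 - x0) + (y1 - y0)).
Proof.
move=> h1 h2 HF [B1 B2]; have [f1 f2] := bdry_fx HF; have [f3 f4] := bdry_fy HF.
apply: le_trans (normcD _ _) _; rewrite mulrDr normcM.
have -> : normc 'i%C = 1 :> R by rewrite /= expr0n/= add0r expr1n sqrtr1.
rewrite mul1r; have -> : 4 * M = 2 * (2 * M) by ring.
apply: lerD; apply: cint_le => //; do ?exact: ccont_onB.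
  move=> x /B1[b1 b2]; rewrite (le_trans (normcD _ _))// normcN.
  by rewrite mulr2n mulrDl mul1r lerD.
move=> x /B2[b1 b2]; rewrite (le_trans (normcD _ _))// normcN.
by rewrite mulr2n mulrDl mul1r lerD.
Qed.

Lemma contour_affine (A B : C) x0 x1 y0 y1 : x0 <= x1 -> y0 <= y1 ->
  contour (fun z => A + B * z) x0 x1 y0 y1 = 0.
Proof.
move=> h1 h2; rewrite /contour.
rewrite (@eq_cint x0 x1 _ (fun=> B * (0 +i* (y0 - y1))%C)); last first.
  move=> x _; have <- : (x +i* y0)%C - (x +i* y1)%C = (0 +i* (y0 - y1))%C :> C.
    by apply/eqP; rewrite eq_complex /= subrr !eqxx.
  ring.
rewrite (@eq_cint y0 y1 _ (fun=> B * (x1 - x0)%:C%C)); last first.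
  move=> y _; have <- : (x1 +i* y)%C - (x0 +i* y)%C = (x1 - x0)%:C%C :> C.
    by apply/eqP; rewrite eq_complex /= subrr !eqxx.
  ring.
rewrite !cint_cst//; case: B => p q; simpc.
by apply/eqP; rewrite eq_complex /=; apply/andP; split; apply/eqP; ring.
Qed.
End PathInt.

(** * Vanishing of contour integrals *)

Section Goursat.
Variable R : realType.
Local Notation C := R[i].
Implicit Types (F : C -> C).

Lemma contour_quarter F (a b w v : R) : 0 <= w -> 0 <= v ->
  fcont_on F a (a + (w + w)) b (b + (v + v)) ->
  exists q : R * R, [/\ a <= q.1 <= a + w, b <= q.2 <= b + v &
   normc (contour F a (a + (w + w)) b (b + (v + v))) <=
   4 * normc (contour F q.1 (q.1 + w) q.2 (q.2 + v))].
Proof.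
move=> w0 v0; rewrite (addrA a) (addrA b) => H.
have wa : a <= a + w by rewrite lerDl.
have wb : a + w <= a + w + w by rewrite lerDl.
have va : b <= b + v by rewrite lerDl.
have vb : b + v <= b + v + v by rewrite lerDl.
have E : contour F a (a + w + w) b (b + v + v) =
  (contour F a (a + w) b (b + v) + contour F a (a + w) (b + v) (b + v + v)) +
  (contour F (a + w) (a + w + w) b (b + v) + contour F (a + w) (a + w + w) (b + v) (b + v + v)).
  have [vb2 wb2] := (le_trans va vb, le_trans wa wb).
  have Hw x y : a <= x <= a + w -> b <= y <= b + v + v -> fcont F (x +i* y)%C.
    by move=> /andP[x1 x2] hy; apply: H => //; rewrite x1 (le_trans x2).
  have Hw' x y : a + w <= x <= a + w + w -> b <= y <= b + v + v -> fcont F (x +i* y)%C.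
    by move=> /andP[x1 x2] hy; apply: H => //; rewrite x2 (le_trans _ x1).
  rewrite (@contour_splitx _ F a (a + w))//; last 2 first.
  - exact: on_bdry_all.
  - by move=> y hy; apply: H; rewrite ?wa ?wb.
  rewrite (@contour_splity _ F a (a + w) b (b + v))//; last 2 first.
  - exact: on_bdry_all.
  - by move=> x hx; apply: Hw; rewrite ?va ?vb.
  rewrite (@contour_splity _ F (a + w) (a + w + w) b (b + v))//.
    exact: on_bdry_all.
  by move=> x hx; apply: Hw'; rewrite ?va ?vb.
set N := normc (contour F a _ b _); move: E; rewrite -/N.
set r1 := contour F a (a + w) b _; set r2 := contour F a (a + w) (b + v) _.
set r3 := contour F (a + w) _ b _; set r4 := contour F (a + w) _ (b + v) _ => E.
have NE : N <= (normc r1 + normc r2) + (normc r3 + normc r4).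
  by rewrite /N E; apply: le_trans (normcD _ _) _; apply: lerD; exact: normcD.
have [h1|h1] := leP N (4 * normc r1).
  by exists (a, b); rewrite /= !lexx !lerDl w0 v0.
have [h2|h2] := leP N (4 * normc r2).
  by exists (a, b + v); rewrite /= !lexx !lerDl w0 v0.
have [h3|h3] := leP N (4 * normc r3).
  by exists (a + w, b); rewrite /= !lexx !lerDl w0 v0.
have [h4|h4] := leP N (4 * normc r4).
  by exists (a + w, b + v); rewrite /= !lexx !lerDl w0 v0.
by exfalso; move: NE h1 h2 h3 h4; clearbody N r1 r2 r3 r4; move: (normc r1) (normc r2) (normc r3) (normc r4) => *; lra.
Qed.

Lemma nested_point (u : nat -> R) (L : R) : 0 <= L ->
  (forall n, u n <= u n.+1 <= u n + L * 2^-1 ^+ n.+1) ->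
  exists x, forall n, u n <= x <= u n + L * 2^-1 ^+ n.
Proof.
move=> L0 H.
have hS n : L * 2^-1 ^+ n = L * 2^-1 ^+ n.+1 + L * 2^-1 ^+ n.+1.
  by rewrite exprS; field.
have up n m : u n <= u (n + m)%N.
  elim: m => [|m IH]; first by rewrite addn0.
  by rewrite addnS (le_trans IH)//; have /andP[] := H (n + m)%N.
have dn n m : u (n + m)%N + L * 2^-1 ^+ (n + m) <= u n + L * 2^-1 ^+ n.
  elim: m => [|m IH]; first by rewrite addn0.
  rewrite addnS; apply: le_trans IH; have /andP[_ h] := H (n + m)%N.
  by rewrite [in leRHS]hS addrA lerD2r.
have L20 n : 0 <= L * 2^-1 ^+ n by rewrite mulr_ge0// exprn_ge0.
have bd n m : u m <= u n + L * 2^-1 ^+ n.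
  have [nm|mn] := leqP n m.
    rewrite -(subnKC nm); apply: le_trans (dn n (m - n)%N).
    by rewrite lerDl.
  apply: (@le_trans _ _ (u n)); last by rewrite lerDl.
  by rewrite -(subnKC (ltnW mn)).
exists (sup (range u)) => n; apply/andP; split.
  apply: ub_le_sup; last by exists n.
  by exists (u 0%N + L * 2^-1 ^+ 0) => _ [m _ <-].
apply: ge_sup; first by exists (u 0%N), 0%N.
by move=> _ [m _ <-].
Qed.

Lemma in_box_abs (a w x X : R) : a <= x <= a + w -> a <= X <= a + w -> `|x - X| <= w.
Proof.
by move=> /andP[? ?] /andP[? ?]; rewrite ler_norml; apply/andP; split; lra.
Qed.

Lemma geometric_small (L r : R) : 0 < r -> exists n, L * 2^-1 ^+ n < r.
Proof.
move=> r0.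
have [n Hn] : exists n : nat, `|L| / r < n%:R.
  by exists (Num.truncn (`|L| / r)).+1; rewrite truncnS_gt.
exists n; apply: le_lt_trans (ler_norm _) _.
rewrite normrM (@ger0_norm _ (2^-1 ^+ n)) ?exprn_ge0// exprVn ltr_pdivrMr ?exprn_gt0//.
rewrite ltr_pdivrMr// in Hn; apply: lt_le_trans Hn _.
rewrite mulrC ler_wpM2l ?(ltW r0)// -natrX ler_nat ltnW// ltn_expl//.
Qed.

(** Bisection. The quarters that carry a quarter of the integral shrink to a
    point [Z]; near [Z] the function differs from an affine one, whose integral
    vanishes, by [e |z - Z|], so the integral over the [n]-th quarter is
    [O(e 4^-n)], while it is at least [4^-n] times the original one. *)
Lemma goursat F x0 x1 y0 y1 : x0 <= x1 -> y0 <= y1 ->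
  (forall x y, x0 <= x <= x1 -> y0 <= y <= y1 -> exists d, cdiff F (x +i* y)%C d) ->
  contour F x0 x1 y0 y1 = 0.
Proof.
move=> hx hy D.
set W := x1 - x0; set H := y1 - y0.
have W0 : 0 <= W by rewrite subr_ge0.
have H0 : 0 <= H by rewrite subr_ge0.
pose h n : R := 2^-1 ^+ n.
have h0 n : 0 <= h n by rewrite /h exprn_ge0.
have hS (L : R) n : L * h n = L * h n.+1 + L * h n.+1 by rewrite /h exprS; field.
have Fc : fcont_on F x0 x1 y0 y1.
  by move=> x y hx' hy'; have [d] := D _ _ hx' hy'; exact: cdiff_fcont.
pose rc n (p : R * R) := contour F p.1 (p.1 + W * h n) p.2 (p.2 + H * h n).
pose ok n (p : R * R) := [/\ x0 <= p.1, p.1 + W * h n <= x1, y0 <= p.2 & p.2 + H * h n <= y1].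
have step (np : nat * (R * R)) : exists q : R * R, ok np.1 np.2 ->
   [/\ ok np.1.+1 q, np.2.1 <= q.1 <= np.2.1 + W * h np.1.+1,
     np.2.2 <= q.2 <= np.2.2 + H * h np.1.+1 &
     normc (rc np.1 np.2) <= 4 * normc (rc np.1.+1 q)].
  case: np => n [a b] /=.
  have [okn|] := pselect (ok n (a, b)); last by exists (0, 0).
  case: okn => /= k1 k2 k3 k4.
  have [||| q [q1 q2 q3]] := @contour_quarter F a b (W * h n.+1) (H * h n.+1).
  - by rewrite mulr_ge0.
  - by rewrite mulr_ge0.
  - move=> x y /andP[a1 a2] /andP[b1 b2]; apply: Fc.
      by rewrite (le_trans k1 a1)/= (le_trans a2)// -hS.
    by rewrite (le_trans k3 b1)/= (le_trans b2)// -hS.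
  exists q => _; split => //; last by rewrite /rc /= ![_ * h n]hS.
  case/andP: q1 => q11 q12; case/andP: q2 => q21 q22.
  split; [exact: le_trans q11| |exact: le_trans q21|].
    by apply: le_trans k2; rewrite [in leRHS]hS addrA lerD2r.
  by apply: le_trans k4; rewrite [in leRHS]hS addrA lerD2r.
have [nx Hnx] := choice step.
pose s := fix s n := if n is m.+1 then nx (m, s m) else (x0, y0).
have oks n : ok n (s n).
  elim: n => [|n IH]; last by have [] := Hnx (n, s n) IH.
  by rewrite /ok /= /h expr0 !mulr1 /W /H ![_ + (_ - _)]addrC !subrK !lexx.
have sP n := Hnx (n, s n) (oks n).
have [X HX] : exists x, forall n, (s n).1 <= x <= (s n).1 + W * 2^-1 ^+ n.
  by apply: (@nested_point (fun n => (s n).1)) => // n; have [] := sP n.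
have [Y HY] : exists x, forall n, (s n).2 <= x <= (s n).2 + H * 2^-1 ^+ n.
  by apply: (@nested_point (fun n => (s n).2)) => // n; have [] := sP n.
have E4 n : normc (rc 0%N (s 0%N)) <= 4 ^+ n * normc (rc n (s n)).
  elim: n => [|n IH]; first by rewrite expr0 mul1r.
  apply: le_trans IH _; rewrite exprSr -mulrA ler_wpM2l ?exprn_ge0//.
  by have [] := sP n.
have rc0 : rc 0%N (s 0%N) = contour F x0 x1 y0 y1.
  by rewrite /rc /= /h expr0 !mulr1 /W /H ![_ + (_ - _)]addrC !subrK.
rewrite rc0 in E4.
have [d Dd] : exists d, cdiff F (X +i* Y)%C d.
  apply: D.
    by have := HX 0%N; rewrite expr0 mulr1 /= /W [x0 + _]addrC subrK.
  by have := HY 0%N; rewrite expr0 mulr1 /= /H [y0 + _]addrC subrK.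
set N := contour F x0 x1 y0 y1 in E4 *.
apply/eqP; rewrite -normc_eq0 eq_le normc_ge0 andbT leNgt; apply/negP => N0.
set L := W + H; have L0 : 0 <= L by rewrite addr_ge0.
pose e := normc N / (4 * L ^+ 2 + 1) / 2.
have den0 : 0 < 4 * L ^+ 2 + 1 by rewrite ltr_wpDl// mulr_ge0// sqr_ge0.
have e0 : 0 < e by rewrite /e !divr_gt0.
have [r r0 Hr] := Dd e e0.
have [n Hn] := geometric_small L r0.
have [ oo1 oo2 oo3 oo4] := oks n.
have := E4 n; rewrite leNgt => /negP; apply.
set a := (s n).1; set b := (s n).2.
have aw : a <= a + W * h n by rewrite lerDl mulr_ge0.
have bw : b <= b + H * h n by rewrite lerDl mulr_ge0.
have HX' := HX n; have HY' := HY n.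
set Z := (X +i* Y)%C.
pose A z := (F Z - d * Z) + d * z.
have nearp x y : a <= x <= a + W * h n -> b <= y <= b + H * h n ->
   normc ((x +i* y)%C - Z) <= L * h n.
  move=> /andP[k1 k2] /andP[k3 k4]; case/andP: HX' => k5 k6; case/andP: HY' => k7 k8.
  apply: le_trans (normc_le_ReIm _) _; rewrite /L mulrDl /=.
  apply: lerD.
    by apply: (@in_box_abs a); apply/andP; split.
  by apply: (@in_box_abs b); apply/andP; split.
have FcI x y : a <= x <= a + W * h n -> b <= y <= b + H * h n -> fcont F (x +i* y)%C.
  move=> /andP[? ?] /andP[? ?]; apply: Fc.
    by apply/andP; split; [exact: le_trans oo1 _|exact: le_trans oo2].
  by apply/andP; split; [exact: le_trans oo3 _|exact: le_trans oo4].
have FcF : on_bdry (fcont F) a (a + W * h n) b (b + H * h n) by exact: on_bdry_all.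
have Ac z : fcont A z.
  apply: (@cdiff_fcont _ _ _ (0 + d * 1)); apply: cdiffD; first exact: cdiff_cst.
  by apply: cdiffZ; exact: cdiff_id.
have FcA : on_bdry (fcont A) a (a + W * h n) b (b + H * h n).
  by apply: on_bdry_all => // x y _ _; exact: Ac.
have EA : rc n (s n) = contour (fun z => F z - A z) a (a + W * h n) b (b + H * h n).
  by rewrite contourB// contour_affine// subr0.
have bd : normc (rc n (s n)) <= 4 * (e * (L * h n)) * (L * h n).
  rewrite EA [X in _ <= _ * X](_ : _ = (a + W * h n - a) + (b + H * h n - b)); last first.
    by rewrite /L; ring.
  apply: contour_le => //.
    by apply: on_bdry_all => // x y kx ky; apply: fcontB; [exact: FcI|exact: Ac].
  apply: on_bdry_all => // x y kx ky.
  have kn := nearp _ _ kx ky.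
  have := Hr ((x +i* y)%C - Z); rewrite (le_lt_trans kn)// => /(_ isT).
  have -> : Z + ((x +i* y)%C - Z) = (x +i* y)%C by ring.
  have -> : F (x +i* y)%C - F Z - d * ((x +i* y)%C - Z) = F (x +i* y)%C - A (x +i* y)%C.
    by rewrite /A; ring.
  by move=> k; apply: le_trans k _; rewrite ler_wpM2l// ltW.
apply: le_lt_trans (ler_wpM2l _ bd) _; first by rewrite exprn_ge0.
have -> : 4 ^+ n * (4 * (e * (L * h n)) * (L * h n)) = 4 * L ^+ 2 * e * (4 ^+ n * (h n * h n)).
  ring.
have -> : 4 ^+ n * (h n * h n) = 1 :> R.
  by rewrite /h -exprMn -exprMn; have -> : 4 * (2^-1 * 2^-1) = 1 :> R by [field]; rewrite expr1n.
have -> : 4 * L ^+ 2 * e * 1 = normc N * (4 * L ^+ 2 / (4 * L ^+ 2 + 1) / 2).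
  by rewrite /e; ring.
rewrite gtr_pMr// ltr_pdivrMr// ltr_pdivrMr//.
by have := sqr_ge0 L; move: (L ^+ 2) => l2 hl; lra.
Qed.
End Goursat.

(** * Cauchy formula for the derivative over squares *)

Section Cauchy.
Variable R : realType.
Local Notation C := R[i].
Implicit Types (F G h dh : C -> C) (S : R).

Definition square_contour S F : C := contour F (- S) S (- S) S.

Lemma on_bdry_square (P : C -> Prop) S : 0 < S -> (forall z, S <= normc z <= S *+ 2 -> P z) ->
  on_bdry P (- S) S (- S) S.
Proof.
move=> S0 H.
have k x y : `|x| <= S -> `|y| <= S -> `|x| = S \/ `|y| = S -> P (x +i* y)%C.
  move=> xS yS E; apply: H; apply/andP; split.
    by case: E => <-; [exact: (Re_le_normc (x +i* y)%C)|exact: (Im_le_normc (x +i* y)%C)].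
  by apply: le_trans (normc_le_ReIm _) _; rewrite mulr2n lerD.
by split=> x; rewrite -ler_norml => hx; split; apply: k; rewrite ?normrN ?(gtr0_norm S0)//; auto.
Qed.

Lemma square_contour_le S F (M : R) : 0 < S ->
  (forall z, S <= normc z <= S *+ 2 -> fcont F z /\ normc (F z) <= M) ->
  normc (square_contour S F) <= 16 * S * M.
Proof.
move=> S0 H; apply: le_trans (@contour_le _ F (- S) S (- S) S M _ _ _ _) _.
- by rewrite ge0_cp ?ltW.
- by rewrite ge0_cp ?ltW.
- by apply: on_bdry_square => // z /H[].
- by apply: on_bdry_square => // z /H[].
by rewrite le_eqVlt; apply/orP; left; apply/eqP; ring.
Qed.

(** The frame between two squares centred at the origin splits into four
    rectangles that avoid the origin, and Goursat applies to each. *)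
Lemma square_contour_frame F S s : 0 < s -> s <= S ->
  (forall x y, - S <= x <= S -> - S <= y <= S -> (s <= `|x| \/ s <= `|y|) ->
      exists d, cdiff F (x +i* y)%C d) ->
  square_contour S F = square_contour s F.
Proof.
move=> s0 sS D.
have S0 : 0 < S by exact: lt_le_trans sS.
have Fc x y : - S <= x <= S -> - S <= y <= S -> (s <= `|x| \/ s <= `|y|) -> fcont F (x +i* y)%C.
  by move=> hx hy hs; have [d] := D _ _ hx hy hs; exact: cdiff_fcont.
have n1 (x : R) : x <= - s -> s <= `|x| by move=> h; rewrite ler_normr; apply/orP; right; lra.
have n2 (x : R) : s <= x -> s <= `|x| by move=> h; rewrite ler_normr h.
have i1 x : - s <= x <= s -> - S <= x <= S by move=> /andP[? ?]; apply/andP; split; lra.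
have [j1 j2 j3 j4] : [/\ - S <= S, - s <= s, - S <= - s & - S <= s] by split; lra.
rewrite /square_contour (@contour_splity _ F (- S) S (- S) (- s) S)//; last 3 first.
- by rewrite (le_trans _ sS).
- by split=> x hx; split; apply: Fc; rewrite ?lexx ?j1 //; [right; exact: n1|right; exact: n2|left; exact: n1|left; exact: n2].
- by move=> x hx; apply: Fc; rewrite ?j3 ?(le_trans j2 sS)//; right; exact: n1.
rewrite (@goursat _ F (- S) S (- S) (- s))//; last first.
  move=> x y hx /andP[y1 y2]; apply: D => //; last by right; exact: n1.
  by rewrite y1 (le_trans y2)// (le_trans j2).
rewrite add0r (@contour_splity _ F (- S) S (- s) s S)//; last 2 first.
- split=> x hx; split; apply: Fc; rewrite ?lexx ?j1 ?j3 ?(le_trans j2 sS) //.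
  + by right; exact: n1.
  + by right; exact: n2.
  + by case/andP: hx => x1 ->; rewrite (le_trans j3).
  + by left; exact: n1.
  + by case/andP: hx => x1 ->; rewrite (le_trans j3).
  + by left; exact: n2.
- by move=> x hx; apply: Fc; rewrite ?j4 ?sS//; right; exact: n2.
rewrite [X in _ + X](@goursat _ F (- S) S s S)//; last first.
  move=> x y hx /andP[y1 y2]; apply: D => //; last by right; exact: n2.
  by rewrite y2 (le_trans j4).
have [b1 b2 b3 b4] : [/\ - S <= - S <= S, - S <= S <= S, - S <= - s <= S & - S <= s <= S].
  by split; apply/andP; split; lra.
rewrite addr0 (@contour_splitx _ F (- S) (- s) S)//; last 3 first.
- by rewrite (le_trans _ sS).
- split=> x hx; split; (apply: Fc; try exact: i1) => //.
  + by right; exact: n1.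
  + by right; exact: n2.
  + by left; exact: n1.
  + by left; exact: n2.
- by move=> y hy; (apply: Fc; try exact: i1) => //; left; exact: n1.
rewrite (@goursat _ F (- S) (- s) (- s) s)//; last first.
  move=> x y /andP[x1 x2] hy; (apply: D; try exact: i1); last by left; exact: n1.
  by rewrite x1 (le_trans x2)// (le_trans j2).
rewrite add0r (@contour_splitx _ F (- s) s S)//; last 2 first.
- have i2 x : - s <= x <= S -> - S <= x <= S by move=> /andP[? ->]; rewrite andbT; lra.
  split=> x hx; split; (apply: Fc; try exact: i1; try exact: i2) => //.
  + by right; exact: n1.
  + by right; exact: n2.
  + by left; exact: n1.
  + by left; exact: n2.
- by move=> y hy; (apply: Fc; try exact: i1) => //; left; exact: n2.
rewrite [X in _ + X](@goursat _ F s S (- s) s) ?addr0//.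
move=> x y /andP[x1 x2] hy; (apply: D; try exact: i1); last by left; exact: n2.
by rewrite x2 (le_trans j4).
Qed.

Lemma cdiff_shift h (a z d : C) : cdiff h (a + z) d -> cdiff (fun z => h (a + z)) z d.
Proof. by move=> H e /H[r r0 Hr]; exists r => // w /Hr; rewrite addrA. Qed.

Lemma cdiff_inv (z : C) : z != 0 -> cdiff (fun w => w^-1) z (- 1 / z ^+ 2).
Proof. by move=> z0; apply: (@cdiffV _ id) => //; exact: cdiff_id. Qed.

Lemma cdiff_inv2 (z : C) : z != 0 -> exists d, cdiff (fun w => (w ^+ 2)^-1) z d.
Proof.
move=> z0; eexists; apply: (@cdiffV _ (fun w => w ^+ 2)); first by rewrite expf_neq0.
by apply: cdiffM; exact: cdiff_id.
Qed.

(** Equal to [2 i pi]; the lower bound on its imaginary part, from the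
    explicit integrand [2 S / (x^2 + S^2)], makes it possible to divide by it. *)
Definition contour_inv S : C := square_contour S (fun z => z^-1).

Lemma Im_contour_inv_ge S : 0 < S -> 4 <= Im (contour_inv S).
Proof.
move=> S0; rewrite /contour_inv /square_contour /contour.
have SS : - S <= S by rewrite ge0_cp ?ltW.
have ne (x : R) : (x +i* S)%C != 0 /\ (x +i* - S)%C != 0 /\ (S +i* x)%C != 0 /\ (- S +i* x)%C != 0.
  by rewrite !eq_complex /= !oppr_eq0 !(gt_eqF S0) /= !andbF.
have c1 : ccont_on (- S) S (fun x => (x +i* - S)%C^-1 - (x +i* S)%C^-1).
  have [g1 g2] : ccont_on (- S) S (fun x => (x +i* - S)%C^-1) /\ ccont_on (- S) S (fun x => (x +i* S)%C^-1).
    split=> x _; apply: (@fcont_x _ (fun z => z^-1)); apply: cdiff_fcont; apply: cdiff_inv;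
      by have [? [? [? ?]]] := ne x.
  exact: ccont_onB.
have c2 : ccont_on (- S) S (fun y => (S +i* y)%C^-1 - (- S +i* y)%C^-1).
  have [g1 g2] : ccont_on (- S) S (fun y => (S +i* y)%C^-1) /\ ccont_on (- S) S (fun y => (- S +i* y)%C^-1).
    split=> x _; apply: (@fcont_y _ (fun z => z^-1)); apply: cdiff_fcont; apply: cdiff_inv;
      by have [? [? [? ?]]] := ne x.
  exact: ccont_onB.
have sb (x : R) : - S <= x <= S -> S^-1 <= S / (x ^+ 2 + S ^+ 2) + S / (x ^+ 2 + S ^+ 2).
  move=> /andP[x1 x2]; have p0 : 0 < x ^+ 2 + S ^+ 2 by rewrite ltr_wpDl ?sqr_ge0 ?exprn_gt0.
  rewrite -mulrDl ler_pdivlMr// mulrC ler_pdivrMr//.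
  have : 0 <= (S - x) * (S + x) by rewrite mulr_ge0//; lra.
  by nra.
have k1 : 2 <= Im (cint (- S) S (fun x => (x +i* - S)%C^-1 - (x +i* S)%C^-1)).
  have -> : 2 = S^-1 * (S - - S) by field; rewrite gt_eqF.
  apply: Rint_ge => // x hx; first by apply: ccont_Im; exact: c1.
  have := sb _ hx; rewrite /= sqrrN !mulNr !opprK; exact.
have k2 : 2 <= Re (cint (- S) S (fun y => (S +i* y)%C^-1 - (- S +i* y)%C^-1)).
  have -> : 2 = S^-1 * (S - - S) by field; rewrite gt_eqF.
  apply: Rint_ge => // x hx; first by apply: ccont_Re; exact: c2.
  have := sb _ hx; rewrite /= sqrrN !mulNr !opprK [S ^+ 2 + _]addrC; exact.
rewrite ImD; move: (cint _ _ _) (cint _ _ _) k1 k2 => [p q] [r t] /=; rewrite mul0r mul1r add0r.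
lra.
Qed.

Lemma square_bdry_inv2 S z : 0 < S -> S <= normc z <= S *+ 2 -> z != 0 /\ normc ((z ^+ 2)^-1) <= (S ^+ 2)^-1.
Proof.
move=> S0 /andP[z1 _]; have z0 : 0 < normc z by exact: lt_le_trans z1.
split; first by rewrite -normc_gt0.
rewrite normcV expr2 normcM -expr2 lef_pV2 ?posrE ?exprn_gt0//.
by rewrite ler_pXn2r ?nnegrE ?normc_ge0// ltW.
Qed.

Lemma ReIm_le2 (x y S : R) : - S <= x <= S -> - S <= y <= S -> normc (x +i* y)%C <= S *+ 2.
Proof.
rewrite -!ler_norml => hx hy; apply: le_trans (normc_le_ReIm _) _.
by rewrite mulr2n lerD.
Qed.

Lemma normc_contour_inv_ge S : 0 < S -> 4 <= normc (contour_inv S).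
Proof.
move=> S0; apply: le_trans (Im_le_normc _); apply: le_trans (ler_norm _); exact: Im_contour_inv_ge.
Qed.

Lemma normc_le_contour_inv S (d : C) (M : R) : 0 < S -> normc (d * contour_inv S) <= 16 * S * M -> normc d <= 4 * S * M.
Proof.
move=> S0; rewrite normcM => H; rewrite -(@ler_pM2r _ 4)//.
apply: (@le_trans _ _ (normc d * normc (contour_inv S))).
  by rewrite ler_wpM2l ?normc_ge0 ?normc_contour_inv_ge.
by apply: le_trans H _; rewrite le_eqVlt; apply/orP; left; apply/eqP; ring.
Qed.

Lemma fcont_inv2 (z : C) : z != 0 -> fcont (fun z => (z ^+ 2)^-1) z.
Proof. by move=> /cdiff_inv2[d]; exact: cdiff_fcont. Qed.

Lemma square_contour_inv2_le S F (M : R) : 0 < S ->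
  (forall z, S <= normc z <= S *+ 2 -> fcont F z /\ normc (F z) <= M) ->
  normc (square_contour S (fun z => F z * (z ^+ 2)^-1)) <= 16 * S * (M / S ^+ 2).
Proof.
move=> S0 H; apply: square_contour_le => // z zS; have [Fc FM] := H _ zS.
have [z0 z2] := square_bdry_inv2 S0 zS; split; first by apply: fcontM => //; exact: fcont_inv2.
by rewrite normcM; apply: ler_pM; rewrite ?normc_ge0.
Qed.

(** [((h (a + z) - h a) / z - h' a) / z] has the same integral over all small
    squares, and on the square of half side [s] it is [o(1 / s)]. *)
Lemma cauchy_deriv h dh a S : 0 < S -> (forall z, normc z <= S *+ 2 -> cdiff h (a + z) (dh (a + z))) ->
  square_contour S (fun z => (h (a + z) - h a) * (z ^+ 2)^-1) = dh a * contour_inv S.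
Proof.
move=> S0 D.
have Fd z : normc z <= S *+ 2 -> z != 0 -> exists d,
    cdiff (fun z => (h (a + z) - h a) * (z ^+ 2)^-1) z d.
  move=> zS z0; have [d2 Hd2] := cdiff_inv2 z0; eexists; apply: cdiffM Hd2.
  by apply: cdiffB; [exact: cdiff_shift (D _ zS)|exact: cdiff_cst].
have Gd z : z != 0 -> cdiff (fun z => dh a * z^-1) z (dh a * (- 1 / z ^+ 2)).
  by move=> z0; apply: cdiffZ; exact: cdiff_inv.
have F0 s : 0 < s -> s <= S -> square_contour s (fun z => (h (a + z) - h a) * (z ^+ 2)^-1 - dh a * z^-1)
  = square_contour s (fun z => (h (a + z) - h a) * (z ^+ 2)^-1) - dh a * contour_inv s.
  move=> s0 sS; have sz z : s <= normc z <= s *+ 2 -> z != 0 /\ normc z <= S *+ 2.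
    move=> /andP[z1 z2]; split; first by rewrite -normc_gt0 (lt_le_trans s0).
    by apply: le_trans z2 _; rewrite lerMn2r.
  rewrite /contour_inv /square_contour contourB -?contourZ//.
  - by apply: (on_bdry_square s0) => z /sz[z0 _]; apply: cdiff_fcont (cdiff_inv z0).
  - by apply: (on_bdry_square s0) => z /sz[z0 zS]; have [d] := Fd _ zS z0; exact: cdiff_fcont.
  - by apply: (on_bdry_square s0) => z /sz[z0 _]; exact: cdiff_fcont (Gd _ z0).
apply/eqP; rewrite -subr_eq0 -F0// -normc_eq0 eq_le normc_ge0 andbT.
apply/ler_addgt0Pl => e e0; rewrite addr0.
have e160 : 0 < e / 16 by rewrite divr_gt0.
have Da : cdiff h a (dh a) by have := D 0; rewrite normc0 addr0; apply; rewrite mulrn_wge0// ltW.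
have [r r0 Hr] := Da _ e160.
pose s := Num.min S (r / 4).
have s0 : 0 < s by rewrite lt_min S0 divr_gt0.
have sS : s <= S by rewrite ge_min lexx.
rewrite (square_contour_frame s0 sS); last first.
  move=> x y hx hy hs; have z0 : (x +i* y)%C != 0.
    rewrite eq_complex /=; apply/negP => /andP[/eqP x0 /eqP y0].
    by case: hs; rewrite ?x0 ?y0 normr0 leNgt s0.
  have [d Hd] := Fd _ (ReIm_le2 hx hy) z0.
  by eexists; apply: cdiffB Hd (Gd _ z0).
have -> : e = 16 * s * (e / 16 / s) by field; rewrite gt_eqF.
apply: square_contour_le => // z /andP[z1 z2].
have z0 : z != 0 by rewrite -normc_gt0 (lt_le_trans s0).
have zS : normc z <= S *+ 2 by rewrite (le_trans z2)// lerMn2r.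
have zr : normc z < r.
  apply: le_lt_trans z2 _; apply: (@le_lt_trans _ _ (r / 4 *+ 2)).
    by rewrite lerMn2r ge_min lexx orbT.
  by rewrite mulr2n; lra.
split.
  have [d Hd] := Fd _ zS z0.
  by apply: fcontB; [exact: cdiff_fcont Hd|exact: cdiff_fcont (Gd _ z0)].
have -> : (h (a + z) - h a) * (z ^+ 2)^-1 - dh a * z^-1 = (h (a + z) - h a - dh a * z) / (z * z).
  by field.
rewrite normcM normcV normcM ler_pdivrMr ?mulr_gt0 ?normc_gt0//.
apply: le_trans (Hr _ zr) _.
have -> : e / 16 * normc z = e / 16 / s * (s * normc z) by field; rewrite gt_eqF.
rewrite ler_wpM2l ?ler_wpM2r ?normc_ge0//.
by rewrite ltW// divr_gt0.
Qed.

(** In Cauchy's formula [h' a] is an integral of [h (a + z) - h a] over a square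
    that does not depend on [a]. Applied three times on smaller and smaller
    discs, it shows that [h'] is bounded, then Lipschitz because [h] is, then
    differentiable because [h (b + z) - h (a + z)] is
    [(b - a) h' (a + z)] up to [O(|b - a|^2)]. *)
Lemma derivative_differentiable h dh (a0 : C) (rho0 : R) : 0 < rho0 ->
  (forall z, normc (z - a0) < rho0 -> cdiff h z (dh z)) -> exists d, cdiff dh a0 d.
Proof.
move=> rho00 D0.
have [rho [rhop D hb]] : exists rho : R, [/\ 0 < rho, forall z, normc (z - a0) < rho -> cdiff h z (dh z) &
    forall z, normc (z - a0) < rho -> normc (h z - h a0) <= 1].
  have Da : cdiff h a0 (dh a0) by apply: D0; rewrite subrr normc0.
  have [r r0 Hr] := cdiff_fcont Da ltr01.
  exists (Num.min r rho0); split; first by rewrite lt_min r0.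
    by move=> z; rewrite lt_min => /andP[_ /D0].
  move=> z; rewrite lt_min => /andP[/Hr + _].
  by have -> : a0 + (z - a0) = z by ring.
pose S := rho / 8; have S0 : 0 < S by rewrite divr_gt0.
have tri (x y z : C) : normc (x - z) <= normc (x - y) + normc (y - z).
  by have -> : x - z = (x - y) + (y - z) by [ring]; exact: normcD.
have trz (a z : C) : normc (a + z - a0) <= normc (a - a0) + normc z.
  by have -> : a + z - a0 = (a - a0) + z by [ring]; exact: normcD.
have S2 z : normc z <= S *+ 2 -> normc z <= rho / 4 by rewrite /S mulr2n => h1; lra.
(* The formula on squares of half side [rho / 8] bounds [dh] on the disc of radius [rho / 2], since [h] is bounded there. *)
pose M1 := 8 / S; have M10 : 0 < M1 by rewrite divr_gt0.
have dh_bd a : normc (a - a0) < rho / 2 -> normc (dh a) <= M1.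
  move=> ha.
  have Dz z : normc z <= S *+ 2 -> normc (a + z - a0) < rho.
    by move=> /S2 zS; apply: le_lt_trans (trz _ _) _; lra.
  have E := @cauchy_deriv h dh a S S0 (fun z zS => D _ (Dz _ zS)).
  have -> : M1 = 4 * S * (2 / S ^+ 2) by rewrite /M1; field; rewrite gt_eqF.
  apply: normc_le_contour_inv => //; rewrite -E; apply: square_contour_inv2_le => // z /andP[_ zS].
  split.
    by apply: cdiff_fcont; apply: cdiffB (cdiff_cst _ _); exact: cdiff_shift (D _ (Dz _ zS)).
  apply: le_trans (tri _ (h a0) _) _; rewrite (normcB (h a0)).
  have := hb _ (Dz _ zS); have : normc (h a - h a0) <= 1 by apply: hb; lra.
  by lra.
(* Discs are convex, so the mean value inequality applies between their points. *)
have seg (a b z : C) (t r : R) : 0 <= t <= 1 -> normc (a - a0) < r -> normc (b - a0) < r ->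
   normc (a + t%:C%C * (b - a) - a0) < r.
  move=> /andP[t0 t1] ha hb'.
  have -> : a + t%:C%C * (b - a) - a0 = (1 - t)%:C%C * (a - a0) + t%:C%C * (b - a0).
    by rewrite rmorphB /=; ring.
  apply: le_lt_trans (normcD _ _) _; rewrite !normcM !normc_real.
  rewrite (ger0_norm t0) ger0_norm ?subr_ge0//.
  have [->|tn] := eqVneq t 0; first by rewrite subr0 mul1r mul0r addr0.
  have t0' : 0 < t by rewrite lt_def tn.
  apply: (@lt_le_trans _ _ ((1 - t) * r + t * r)); last by rewrite -mulrDl subrK mul1r.
  by apply: ler_ltD; [rewrite ler_wpM2l ?subr_ge0// ltW|rewrite ltr_pM2l].
(* The formula at [a] and [b], subtracted: the integrands differ by at most [2 * M1 * |b - a|] before division by [z ^+ 2]. *)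
pose M2 := 4 * S * ((M1 + M1) / S ^+ 2); have M20 : 0 < M2.
  by rewrite /M2 !mulr_gt0 ?addr_gt0 ?invr_gt0 ?exprn_gt0.
have dh_lip a b : normc (a - a0) < rho / 8 -> normc (b - a0) < rho / 8 ->
   normc (dh b - dh a) <= M2 * normc (b - a).
  move=> ha hb'.
  have Dz c z : normc (c - a0) < rho / 8 -> normc z <= S *+ 2 -> normc (c + z - a0) < rho / 2.
    by move=> hc /S2 zS; apply: le_lt_trans (trz _ _) _; lra.
  have Dz' c z : normc (c - a0) < rho / 8 -> normc z <= S *+ 2 -> cdiff h (c + z) (dh (c + z)).
    by move=> hc zS; apply: D; apply: lt_le_trans (Dz _ _ hc zS) _; lra.
  have Ea := @cauchy_deriv h dh a S S0 (fun z => Dz' a z ha).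
  have Eb := @cauchy_deriv h dh b S S0 (fun z => Dz' b z hb').
  have fc c z : normc (c - a0) < rho / 8 -> normc z <= S *+ 2 ->
     fcont (fun z => h (c + z) - h c) z.
    move=> hc zS; apply: cdiff_fcont; apply: cdiffB (cdiff_cst _ _).
    exact: cdiff_shift (Dz' _ _ hc zS).
  have E : square_contour S (fun z => ((h (b + z) - h b) - (h (a + z) - h a)) * (z ^+ 2)^-1) = (dh b - dh a) * contour_inv S.
    rewrite mulrBl -Ea -Eb -contourB.
    - by apply: contour_ext; apply: on_bdry_square => // z _; rewrite mulrBl.
    - apply: on_bdry_square => // z zS; have [z0 _] := square_bdry_inv2 S0 zS; case/andP: zS => _ zS.
      by apply: fcontM (fcont_inv2 z0); exact: fc.
    - apply: on_bdry_square => // z zS; have [z0 _] := square_bdry_inv2 S0 zS; case/andP: zS => _ zS.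
      by apply: fcontM (fcont_inv2 z0); exact: fc.
  have -> : M2 * normc (b - a) = 4 * S * ((M1 * normc (b - a) + M1 * normc (b - a)) / S ^+ 2).
    by rewrite /M2; ring.
  apply: normc_le_contour_inv => //; rewrite -E; apply: square_contour_inv2_le => // z /andP[_ zS]; split.
    by apply: fcontB; exact: fc.
  have -> : h (b + z) - h b - (h (a + z) - h a) = (h (b + z) - h (a + z)) - (h b - h a) by ring.
  apply: le_trans (normcD _ _) _; rewrite normcN; apply: lerD.
    have := @mean_value R h dh (a + z) (b - a) M1.
    have -> : a + z + (b - a) = b + z by ring.
    have e t : a + z + t%:C%C * (b - a) = a + z + t%:C%C * ((b + z) - (a + z)) by ring.
    apply=> t t01; rewrite e.
      by apply: D; apply: lt_le_trans (seg _ _ 0 _ (rho / 2) t01 _ _) _; rewrite ?Dz//; lra.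
    by apply: dh_bd; apply: seg; rewrite ?Dz.
  have := @mean_value R h dh a (b - a) M1.
  have -> : a + (b - a) = b by ring.
  have h1 : rho / 8 < rho / 2 by lra.
  apply=> t t01.
    by apply: D; apply: lt_le_trans (seg _ _ 0 _ (rho / 8) t01 _ _) _ => //; lra.
  by apply: dh_bd; apply: lt_trans (seg _ _ 0 _ (rho / 8) t01 _ _) _.
(* The squares are smaller now, so that all points stay in the disc where [dh] is Lipschitz. *)
pose T := rho / 64; have T0 : 0 < T by rewrite divr_gt0.
have T2 z : normc z <= T *+ 2 -> normc z <= rho / 32 by rewrite /T mulr2n => h1; lra.
have kn0 : contour_inv T != 0 by rewrite -normc_gt0 (lt_le_trans _ (normc_contour_inv_ge T0)).
have dh_fc z : normc z <= T *+ 2 -> fcont (fun z => dh (a0 + z)) z.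
  move=> /T2 zT e e0; exists (Num.min (rho / 32) (e / M2)); first by rewrite lt_min; apply/andP; split; exact: divr_gt0.
  move=> w; rewrite lt_min => /andP[w1 w2].
  apply: le_trans (dh_lip _ _ _ _) _.
  - by have -> : a0 + z - a0 = z by [ring]; lra.
  - have -> : a0 + (z + w) - a0 = z + w by ring.
    by apply: le_lt_trans (normcD _ _) _; lra.
  - have -> : a0 + (z + w) - (a0 + z) = w by ring.
    by rewrite mulrC -ler_pdivlMr// ltW.
pose d := (contour_inv T)^-1 * square_contour T (fun z => (dh (a0 + z) - dh a0) * (z ^+ 2)^-1).
exists d => e e0.
pose M3 := 8 * M2 / T; have M30 : 0 < M3 by rewrite divr_gt0// mulr_gt0.
exists (Num.min (rho / 32) (e / M3)); first by rewrite lt_min; apply/andP; split; exact: divr_gt0.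
move=> w; rewrite lt_min => /andP[w1 w2].
suff H : normc (dh (a0 + w) - dh a0 - d * w) <= M3 * normc w * normc w.
  by apply: le_trans H _; rewrite ler_wpM2r ?normc_ge0// mulrC -ler_pdivlMr// ltW.
set b := a0 + w.
have Dz' c z : normc (c - a0) <= rho / 32 -> normc z <= T *+ 2 -> cdiff h (c + z) (dh (c + z)).
  by move=> hc /T2 zT; apply: D; apply: le_lt_trans (trz _ _) _; lra.
have hb' : normc (b - a0) <= rho / 32 by rewrite /b; have -> : a0 + w - a0 = w by [ring]; rewrite ltW.
have ha' : normc (a0 - a0) <= rho / 32 by rewrite subrr normc0; lra.
have Ea := @cauchy_deriv h dh a0 T T0 (fun z => Dz' a0 z ha').
have Eb := @cauchy_deriv h dh b T T0 (fun z => Dz' b z hb').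
have fc c z : normc (c - a0) <= rho / 32 -> normc z <= T *+ 2 ->
     fcont (fun z => h (c + z) - h c) z.
  move=> hc zS; apply: cdiff_fcont; apply: cdiffB (cdiff_cst _ _).
  exact: cdiff_shift (Dz' _ _ hc zS).
have fd z : normc z <= T *+ 2 -> fcont (fun z => dh (a0 + z) - dh a0) z.
  move=> zT; apply: fcontB; first exact: dh_fc.
  by apply: cdiff_fcont; exact: cdiff_cst.
have fdw z : normc z <= T *+ 2 -> fcont (fun z => w * (dh (a0 + z) - dh a0)) z.
  move=> zT; apply: fcontM (fd _ zT); by apply: cdiff_fcont; exact: cdiff_cst.
have fI (F : C -> C) : (forall z, normc z <= T *+ 2 -> fcont F z) ->
   on_bdry (fcont (fun z => F z * (z ^+ 2)^-1)) (- T) T (- T) T.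
  move=> HF; apply: on_bdry_square => // z zS; have [z0 _] := square_bdry_inv2 T0 zS; case/andP: zS => _ zS.
  by apply: fcontM (fcont_inv2 z0); exact: HF.
pose Q z := ((h (b + z) - h b) - (h (a0 + z) - h a0)) - w * (dh (a0 + z) - dh a0).
have E : square_contour T (fun z => Q z * (z ^+ 2)^-1) = (dh b - dh a0 - d * w) * contour_inv T.
  have -> : (dh b - dh a0 - d * w) * contour_inv T = (dh b * contour_inv T - dh a0 * contour_inv T)
     - w * square_contour T (fun z => (dh (a0 + z) - dh a0) * (z ^+ 2)^-1).
    by rewrite /d; field.
  rewrite -Ea -Eb -contourZ; last exact: (fI _ fd).
  have fb := fI _ (fun z => fc b z hb'); have fa := fI _ (fun z => fc a0 z ha').
  rewrite -(contourB fb fa) -contourB; last 2 first.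
  - by apply: on_bdryI fb fa => z; exact: fcontB.
  - apply: on_bdryI (fI _ fd) (fI _ fd) => z Hz _; apply: fcontM Hz.
    by apply: cdiff_fcont; exact: cdiff_cst.
  by apply: contour_ext; apply: on_bdry_square => // z _; rewrite /Q; ring.
have -> : M3 * normc w * normc w = 4 * T * ((M2 * normc w * normc w + M2 * normc w * normc w) / T ^+ 2).
  by rewrite /M3; field; rewrite gt_eqF.
apply: normc_le_contour_inv => //; rewrite -E; apply: square_contour_inv2_le => // z /andP[_ zT]; split.
  by apply: fcontB; [apply: fcontB; exact: fc|exact: fdw].
pose L c := (h (c + w) - h c - w * dh c).
have Lb c : normc (c - a0) <= rho / 32 -> normc (L c) <= M2 * normc w * normc w.
  move=> hc; have := @mean_value R (fun z => h z - dh c * z) (fun z => dh z - dh c) c w (M2 * normc w).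
  have -> : h (c + w) - dh c * (c + w) - (h c - dh c * c) = L c by rewrite /L; ring.
  have ct (t : R) : 0 <= t <= 1 -> normc (c + t%:C%C * w - a0) < rho / 8.
    move=> /andP[t0 t1].
    apply: le_lt_trans (trz _ _) _; rewrite normcM normc_real ger0_norm//.
    have : t * normc w <= 1 * normc w by rewrite ler_wpM2r ?normc_ge0.
    by rewrite mul1r; lra.
  apply=> t t01.
    have -> : dh (c + t%:C%C * w) - dh c = dh (c + t%:C%C * w) - dh c * 1 by rewrite mulr1.
    apply: cdiffB; first by apply: D; apply: lt_le_trans (ct _ t01) _; lra.
    by apply: cdiffZ; exact: cdiff_id.
  apply: le_trans (dh_lip _ _ _ (ct _ t01)) _; first by lra.
  have -> : c + t%:C%C * w - c = t%:C%C * w by ring.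
  case/andP: t01 => t0 t1.
  rewrite ler_wpM2l ?(ltW M20)// normcM normc_real ger0_norm//.
  by rewrite -[leRHS]mul1r ler_wpM2r ?normc_ge0.
have -> : Q z = L (a0 + z) - L a0.
  rewrite /Q /L /b; have -> : a0 + w + z = a0 + z + w by ring.
  ring.
apply: le_trans (normcD _ _) _; rewrite normcN; apply: lerD; apply: Lb => //.
by have -> : a0 + z - a0 = z by [ring]; exact: T2.
Qed.
End Cauchy.

(** * Linear invariance of the class *)

Section LinInv.
Variable R : realType.
Local Notation C := R[i].
Implicit Types (f h g : C -> C) (z w zeta : C).
Notation D1 h := (derive1 (h : Cplx R -> Cplx R) : C -> C).

Lemma analytic_cdiff h z : analytic_on_disk h -> normc z < 1 -> cdiff h z (D1 h z).
Proof. by move=> H z1; apply: cdiff_derivable; exact: H. Qed.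

Lemma analytic_cdiff2 h z : analytic_on_disk h -> normc z < 1 -> cdiff (D1 h) z (D1 (D1 h) z).
Proof.
move=> H z1; have [||d Hd] := @derivative_differentiable R h (D1 h) z (1 - normc z); first by rewrite subr_gt0.
  move=> w wz; apply: analytic_cdiff H _; have -> : w = (w - z) + z by ring.
  by apply: le_lt_trans (normcD _ _) _; rewrite -ltrBrDr.
by rewrite (cdiff_val Hd).
Qed.

(** The automorphism of the disc that sends 0 to [zeta]. *)
Definition moebius zeta z := (z + zeta) / (1 + (zeta^*)%C * z).
Definition dmoebius zeta z := (1 - normc zeta ^+ 2)%:C%C / (1 + (zeta^*)%C * z) ^+ 2.

Lemma moebius_den zeta z : normc zeta < 1 -> normc z < 1 -> 1 + (zeta^*)%C * z != 0.
Proof.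
move=> h1 h2; rewrite -normc_gt0; have := normc_sub_le (1 : C) (- ((zeta^*)%C * z)).
rewrite opprK; apply: lt_le_trans.
rewrite normcN normc1 subr_gt0 normcM normc_conj.
by rewrite mulr_ilt1 ?normc_ge0.
Qed.

(** [1 - |moebius zeta z|^2 = (1 - |zeta|^2) (1 - |z|^2) / |1 + conj zeta z|^2]. *)
Lemma moebius_norm zeta z : normc zeta < 1 -> normc z < 1 -> normc (moebius zeta z) < 1.
Proof.
move=> h1 h2; have d0 := moebius_den h1 h2; rewrite /moebius normcM normcV ltr_pdivrMr ?normc_gt0// mul1r.
rewrite -(@ltr_pXn2r _ 2) ?nnegrE ?normc_ge0// -subr_gt0.
have -> : normc (1 + (zeta^*)%C * z) ^+ 2 - normc (z + zeta) ^+ 2 = (1 - normc zeta ^+ 2) * (1 - normc z ^+ 2).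
  by rewrite !normc_sqr; case: zeta {h1 d0} => a b; case: z {h2} => x y /=; ring.
by rewrite mulr_gt0// subr_gt0 expr_lt1 ?normc_ge0.
Qed.

Lemma cdiff_moebius zeta z : normc zeta < 1 -> normc z < 1 -> cdiff (moebius zeta) z (dmoebius zeta z).
Proof.
move=> h1 h2; have d0 := moebius_den h1 h2.
have D1' : cdiff (fun z => z + zeta) z (1 + 0) by apply: cdiffD (cdiff_id _) (cdiff_cst _ _).
have D2 : cdiff (fun z => 1 + (zeta^*)%C * z) z (0 + (zeta^*)%C * 1).
  by apply: cdiffD (cdiff_cst _ _) _; apply: cdiffZ; exact: cdiff_id.
have := cdiffM D1' (@cdiffV _ (fun z => 1 + (zeta^*)%C * z) _ _ d0 D2).
set e := (X in cdiff _ _ X); have -> // : e = dmoebius zeta z.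
rewrite /e /dmoebius rmorphB /= -conj_mul; field.
exact: d0.
Qed.

Lemma moebius0 zeta : moebius zeta 0 = zeta.
Proof. by rewrite /moebius add0r mulr0 addr0 divr1. Qed.

Lemma moebius_inj zeta z w : normc zeta < 1 -> normc z < 1 -> normc w < 1 ->
  moebius zeta z = moebius zeta w -> z = w.
Proof.
move=> h1 hz hw; have dz := moebius_den h1 hz; have dw := moebius_den h1 hw.
have k0 : 1 - (zeta^*)%C * zeta != 0.
  by rewrite conj_mul -[1](rmorph1 (real_complex R)) -rmorphB -normc_eq0 normc_real normr_eq0 gt_eqF// subr_gt0 expr_lt1 ?normc_ge0.
move=> /(congr1 (fun t => t * ((1 + (zeta^*)%C * z) * (1 + (zeta^*)%C * w)))).
rewrite /moebius => E.
have E2 : (z + zeta) * (1 + (zeta^*)%C * w) = (w + zeta) * (1 + (zeta^*)%C * z).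
  transitivity ((z + zeta) / (1 + (zeta^*)%C * z) * ((1 + (zeta^*)%C * z) * (1 + (zeta^*)%C * w))).
    by field.
  by rewrite E; field.
apply/eqP; rewrite -subr_eq0; apply/eqP; apply: (mulIf k0); rewrite mul0r.
transitivity ((z + zeta) * (1 + (zeta^*)%C * w) - (w + zeta) * (1 + (zeta^*)%C * z)); first by ring.
by rewrite E2 subrr.
Qed.

Lemma norm3 (a b c : C) : normc (a * b / c) = normc a * normc b / normc c.
Proof. by rewrite !normcM normcV. Qed.

Lemma jac_alg (H1 G1 M1 C1 : R) : 0 < H1 ^+ 2 - G1 ^+ 2 -> 0 < M1 -> 0 < C1 ->
  0 < (H1 * M1 / C1) ^+ 2 - (G1 * M1 / C1) ^+ 2.
Proof.
move=> p1 p2 p3.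
have -> : (H1 * M1 / C1) ^+ 2 - (G1 * M1 / C1) ^+ 2 = (H1 ^+ 2 - G1 ^+ 2) * (M1 / C1) ^+ 2 by ring.
by rewrite mulr_gt0// exprn_gt0// divr_gt0.
Qed.

Lemma ratio_alg (H1 G1 M1 C1 : R) : M1 != 0 -> C1 != 0 -> G1 * M1 / C1 / (H1 * M1 / C1) = G1 / H1.
Proof.
move=> p1 p2; have [->|p3] := eqVneq H1 0; first by rewrite !mul0r !invr0 !mulr0.
by field; rewrite ?p1 ?p2 ?p3.
Qed.

Lemma second_alg (a b q s t : C) : b != 0 -> q != 0 ->
  (a * q * q + b * (q * - (2 * s))) * (q * b)^-1 + t * 0 = (q * a - 2 * s * b) / b.
Proof. by move=> p1 p2; field; rewrite ?p1 ?p2. Qed.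

Section Rep.
Variables (K : R) (f h g : C -> C).
Hypothesis hK : 1 <= K.
Hypothesis rep : SHK_rep K f h g.
Let k := (K - 1) / (K + 1).

Lemma rep_h : analytic_on_disk h. Proof. by case: rep => -[[[? ? ?] ?] ? ?] ?. Qed.

Lemma rep_g : analytic_on_disk g. Proof. by case: rep => -[[[? ? ?] ?] ? ?] ?. Qed.

Lemma rep_f z : normc z < 1 -> f z = h z + (g z)^*%C.
Proof. by case: rep => -[[[? ? H] ?] ? ?] ? /H. Qed.

Lemma rep_inj z w : normc z < 1 -> normc w < 1 -> f z = f w -> z = w.
Proof. by case: rep => -[_ _ H] _ hz hw; apply: H; rewrite inE. Qed.

Lemma rep_dh0 z : normc z < 1 -> 0 < normc (D1 h z).
Proof.
case: rep => -[_ H _] _ /H; rewrite /jac_det subr_gt0 => hj.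
apply: (@le_lt_trans _ _ (normc (D1 g z))); first exact: normc_ge0.
by rewrite -(@ltr_pXn2r _ 2) ?nnegrE ?normc_ge0.
Qed.

Lemma rep_k : 0 <= k < 1.
Proof.
have K10 : 0 < K + 1 by apply: ltr_wpDl => //; exact: le_trans hK.
apply/andP; split; first by rewrite /k divr_ge0 ?subr_ge0// ltW.
by rewrite /k ltr_pdivrMr// mul1r ltrD2l gt0_cp.
Qed.

Lemma rep_dg z : normc z < 1 -> normc (D1 g z) <= k * normc (D1 h z).
Proof.
move=> z1; have h0 := rep_dh0 z1; case: rep => _ /(_ _ z1).
by rewrite /dilatation normcM normcV ler_pdivrMr.
Qed.

Lemma rep_00 : [/\ h 0 = 0, g 0 = 0 & D1 h 0 = 1].
Proof. by case: rep => -[[_ ?] _ _] _. Qed.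

Section Renorm.
Variable zeta : C.
Hypothesis z1 : normc zeta < 1.
Let c := (1 - normc zeta ^+ 2)%:C%C * D1 h zeta.
(** The Koebe transform of [f] at [zeta]; the antianalytic part is divided by
    the conjugate constant, since [f] is divided by [c]. *)
Definition koebe_f z := (f (moebius zeta z) - f zeta) / c.
Definition koebe_h z := (h (moebius zeta z) - h zeta) / c.
Definition koebe_g z := (g (moebius zeta z) - g zeta) / (c^*)%C.

Let q0 : 0 < 1 - normc zeta ^+ 2.
Proof. by rewrite subr_gt0 expr_lt1 ?normc_ge0. Qed.

Let c0 : c != 0.
Proof.
by rewrite mulf_neq0 -?normc_eq0 ?normc_real ?normr_eq0 ?gt_eqF// rep_dh0.
Qed.
Let cc0 : (c^*)%C != 0.
Proof. by rewrite -normc_eq0 normc_conj normc_eq0 c0. Qed.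

Lemma cdiff_koebe (u : C -> C) (e : C) z : analytic_on_disk u -> normc z < 1 ->
  cdiff (fun z => (u (moebius zeta z) - u zeta) / e) z (D1 u (moebius zeta z) * dmoebius zeta z / e).
Proof.
move=> U hz; have := cdiffZ e^-1 (cdiffB (cdiff_comp (cdiff_moebius z1 hz) (analytic_cdiff U (moebius_norm z1 hz))) (cdiff_cst (u zeta) z)).
rewrite subr0 mulrC.
by have -> : (fun w => e^-1 * (u (moebius zeta w) - u zeta)) = (fun z => (u (moebius zeta z) - u zeta) / e) by
  apply/funext => w; rewrite mulrC.
Qed.

Lemma dmoebius_gt0 z : normc z < 1 -> 0 < normc (dmoebius zeta z).
Proof.
move=> hz; rewrite /dmoebius normcM normcV normc_real mulr_gt0 ?normr_gt0 ?gt_eqF//.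
by rewrite invr_gt0 normc_gt0 expf_neq0// moebius_den.
Qed.

(** Composing with an automorphism multiplies [h'] and [g'] by the same factor,
    and the division by [c] and [conj c] divides both moduli by [|c|]: neither
    the sign of the Jacobian nor the modulus of the dilatation changes. *)
Lemma koebe_rep : SHK_rep K koebe_f koebe_h koebe_g.
Proof.
have Hh z (hz : normc z < 1) := cdiff_koebe c rep_h hz.
have Hg z (hz : normc z < 1) := cdiff_koebe (c^*)%C rep_g hz.
have vh z (hz : normc z < 1) : D1 koebe_h z = D1 h (moebius zeta z) * dmoebius zeta z / c by exact: cdiff_val (Hh _ hz).
have vg z (hz : normc z < 1) : D1 koebe_g z = D1 g (moebius zeta z) * dmoebius zeta z / (c^*)%C by exact: cdiff_val (Hg _ hz).
split; [split|].
- split; first split.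
  + by move=> z hz; exact: cdiff_derive1 (Hh _ hz).
  + by move=> z hz; exact: cdiff_derive1 (Hg _ hz).
  + move=> z hz; rewrite /koebe_f /koebe_h /koebe_g !rep_f ?moebius_norm//.
    have -> : (((g (moebius zeta z) - g zeta) / (c^*)%C)^*)%C = (((g (moebius zeta z))^*)%C - ((g zeta)^*)%C) / c.
      rewrite conjcM; congr (_ * _).
        by case: (g _) (g zeta) => [a b] [a' b']; simpc; congr (_ +i* _)%C; ring.
      apply: (mulIf c0); rewrite mulVf//.
      rewrite -{2}(conjcKK c).
      by rewrite -conjcM mulVf//; apply/eqP; rewrite eq_complex/= oppr0 !eqxx.
    by ring.
  + split; first by rewrite /koebe_h moebius0 subrr mul0r.
      by rewrite /koebe_g moebius0 subrr mul0r.
    rewrite vh ?normc0// moebius0 /dmoebius mulr0 addr0 expr1n divr1 [_ * _%:C%C]mulrC -/c divff//.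
- move=> z hz; rewrite /jac_det vh// vg// !norm3 normc_conj.
  apply: jac_alg; rewrite ?normc_gt0 ?c0//; last by have := dmoebius_gt0 hz; rewrite normc_gt0.
  by case: rep => -[_ H _] _; apply: (H (moebius zeta z)); exact: moebius_norm.
- move=> z w; rewrite !inE => hz hw; rewrite /koebe_f => /(mulIf (invr_neq0 c0)) /addIr E.
  by apply: (moebius_inj z1 hz hw); apply: rep_inj; rewrite ?moebius_norm.
move=> z hz; rewrite /dilatation vh// vg// normcM normcV !norm3 normc_conj.
rewrite ratio_alg ?normc_eq0 ?c0//.
- by rewrite ler_pdivrMr ?rep_dg ?rep_dh0// moebius_norm.
- by rewrite -normc_gt0 dmoebius_gt0.
Qed.

Lemma koebe_second : derive1n 2 (koebe_h : Cplx R -> Cplx R) 0 =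
  ((1 - normc zeta ^+ 2)%:C%C * D1 (D1 h) zeta - 2 * (zeta^*)%C * D1 h zeta) / D1 h zeta.
Proof.
have Hh z (hz : normc z < 1) := cdiff_koebe c rep_h hz.
have vh z (hz : normc z < 1) : D1 koebe_h z = D1 h (moebius zeta z) * dmoebius zeta z / c by exact: cdiff_val (Hh _ hz).
have n0 : normc (0 : C) < 1 by rewrite normc0.
have hm : D1 h zeta != 0 by rewrite -normc_gt0 rep_dh0.
have qc0 : (1 - normc zeta ^+ 2)%:C%C != 0 :> C by rewrite -normc_eq0 normc_real normr_eq0 gt_eqF.
apply: cdiff_val; apply: (@cdiff_ext _ (fun z => D1 h (moebius zeta z) * dmoebius zeta z * c^-1)).
  by exists 1 => // w; rewrite subr0 => hw; rewrite vh.
have A2 : cdiff (D1 h) (moebius zeta 0) (D1 (D1 h) (moebius zeta 0)) by apply: analytic_cdiff2 rep_h _; rewrite moebius0.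
have A := cdiff_comp (cdiff_moebius z1 n0) A2.
have d0 : (1 + (zeta^*)%C * 0) ^+ 2 != 0 by rewrite mulr0 addr0 expr1n oner_neq0.
have B : cdiff (dmoebius zeta) 0 ((1 - normc zeta ^+ 2)%:C%C * (- (2 * (zeta^*)%C))).
  have b1 : cdiff (fun z => 1 + (zeta^*)%C * z) 0 (0 + (zeta^*)%C * 1).
    by apply: cdiffD (cdiff_cst _ _) _; apply: cdiffZ; exact: cdiff_id.
  have := cdiffZ (1 - normc zeta ^+ 2)%:C%C (cdiffV (h := fun z => (1 + (zeta^*)%C * z) ^+ 2) d0 (cdiffM b1 b1)).
  set e := (X in cdiff _ _ X); set e' := (X in _ -> cdiff _ _ X); have -> // : e = e'.
  by rewrite /e /e' mulr0 addr0 !add0r !mulr1 !mul1r !expr1n divr1; ring.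
have dm0 : dmoebius zeta 0 = (1 - normc zeta ^+ 2)%:C%C by rewrite /dmoebius mulr0 addr0 expr1n divr1.
have := cdiffM (cdiffM A B) (cdiff_cst c^-1 0).
by rewrite moebius0 dm0 (second_alg _ _ _ hm qc0).
Qed.

Lemma pre_schwarzian_le (al : R) : (alphaK K <= al%:E)%E ->
  normc ((1 - normc zeta ^+ 2)%:C%C * D1 (D1 h) zeta - 2 * (zeta^*)%C * D1 h zeta) <= 2 * al * normc (D1 h zeta).
Proof.
move=> H.
have : ((normc (derive1n 2 (koebe_h : Cplx R -> Cplx R) 0 / 2))%:E <= al%:E)%E.
  by apply: le_trans H; apply: ereal_sup_ubound; exists koebe_f, koebe_h, koebe_g; split; [exact: koebe_rep|exact: erefl].
rewrite lee_fin koebe_second !normcM !normcV.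
have -> : normc (2 : C) = 2.
  by rewrite -[2](rmorph_nat (real_complex R)) normc_real ger0_norm.
rewrite ler_pdivrMr// ler_pdivrMr ?rep_dh0// => h1; apply: le_trans h1 _.
by rewrite le_eqVlt; apply/orP; left; apply/eqP; ring.
Qed.
End Renorm.
End Rep.
End LinInv.

(** * Open discs in the image, packing, and integrals over countable covers *)

Section Covering.
Variable R : realType.
Local Notation C := R[i].

Lemma compact_box (a b a' b' : R) : compact ((`[a, b] `*` `[a', b'])%classic : set (R * R)).
Proof. by apply: compact_setX; exact: segment_compact. Qed.

Lemma fcont_norm_cont (F : C -> C) (w : C) (p : R * R) : fcont F (p.1 +i* p.2)%C ->
  {for p, continuous (fun q : R * R => normc (F (q.1 +i* q.2)%C - w))}.
Proof.
move=> H; apply/cvgrPdist_le => e e0; have [r r0 Hr] := H _ e0.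
have r20 : 0 < r / 2 by rewrite divr_gt0.
exists (ball p.1 (r / 2), ball p.2 (r / 2)); first by split; exact: nbhsx_ballx.
move=> [x y] [] /=; rewrite /ball /= => h1 h2.
have := Hr ((x - p.1) +i* (y - p.2))%C.
have -> : (p.1 +i* p.2)%C + ((x - p.1) +i* (y - p.2))%C = (x +i* y)%C :> C.
  by apply/eqP; rewrite eq_complex /=; apply/andP; split; apply/eqP; ring.
move=> k; have {}k : normc (F (x +i* y)%C - F (p.1 +i* p.2)%C) <= e.
  apply: k; apply: le_lt_trans (normc_le_ReIm _) _; rewrite /= (splitr r).
  by rewrite distrC [`|y - _|]distrC ltrD.
apply: le_trans k; rewrite ler_norml; apply/andP; split.
  have := normc_sub_le (F (x +i* y)%C - w) (F (p.1 +i* p.2)%C - w).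
  have -> : F (x +i* y)%C - w - (F (p.1 +i* p.2)%C - w) = F (x +i* y)%C - F (p.1 +i* p.2)%C by ring.
  lra.
have := normc_sub_le (F (p.1 +i* p.2)%C - w) (F (x +i* y)%C - w).
have -> : F (p.1 +i* p.2)%C - w - (F (x +i* y)%C - w) = F (p.1 +i* p.2)%C - F (x +i* y)%C by ring.
by rewrite [X in _ <= X -> _]normcB.
Qed.

(** The differential of [f = h + conj g] is [v |-> p v + conj (q v)], which is
    onto as [|q| < |p|]. A short step in the direction [v] whose image points
    from [f z] to [w] brings the value closer to [w]. *)
Lemma move_closer (h g f : C -> C) (z p q w : C) (r : R) : cdiff h z p -> cdiff g z q ->
  (exists2 r : R, 0 < r & forall u, normc u < r -> f (z + u) = h (z + u) + ((g (z + u))^*)%C) ->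
  normc q < normc p -> f z != w -> 0 < r ->
  exists2 u, normc u < r & normc (f (z + u) - w) < normc (f z - w).
Proof.
move=> Dh Dg [r1 r10 fE] pq fw r0.
pose a := w - f z; have a0 : 0 < normc a by rewrite normc_gt0 /a subr_eq0 eq_sym.
pose D : R := normc p ^+ 2 - normc q ^+ 2.
have D0 : 0 < D by rewrite subr_gt0 ltr_pXn2r ?nnegrE ?normc_ge0.
have Dc0 : D%:C%C != 0 :> C by rewrite -normc_eq0 normc_real normr_eq0 gt_eqF.
pose v := ((p^*)%C * a - (q^*)%C * (a^*)%C) / D%:C%C.
have vL : p * v + ((q * v)^*)%C = a.
  have -> : p * v + ((q * v)^*)%C = (p * ((p^*)%C * a - (q^*)%C * (a^*)%C) + (q^*)%C * (p * (a^*)%C - q * a)) / D%:C%C.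
    rewrite conjcM /v.
    have -> : ((((p^*)%C * a - (q^*)%C * (a^*)%C) / D%:C%C)^*)%C = (p * (a^*)%C - q * a) / D%:C%C.
      rewrite conjcM; congr (_ * _); last first.
        by apply: (mulIf Dc0); rewrite mulVf//; have {2}-> : D%:C%C = (D%:C%C^*)%C :> C;
          [rewrite /= oppr0|rewrite -conjcM mulVf// /= oppr0].
      by rewrite conjcB !conjcM !conjcKK.
    ring.
  have E : ((p^*)%C * p - (q^*)%C * q) = D%:C%C by rewrite !conj_mul -rmorphB.
  rewrite -E; field; by rewrite E.
pose e := normc a / (2 * (normc v + 1)) / 2.
have V0 : 0 < normc v + 1 by rewrite ltr_wpDl ?normc_ge0.
have e0 : 0 < e by rewrite /e !divr_gt0// mulr_gt0.
have [s1 s10 H1] := Dh _ e0; have [s2 s20 H2] := Dg _ e0.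
pose m := Num.min (Num.min r r1) (Num.min s1 s2).
have m0 : 0 < m by rewrite !lt_min r0 r10 s10 s20.
pose t := Num.min 1 (m / (2 * (normc v + 1))).
have t0 : 0 < t by rewrite lt_min ltr01 divr_gt0// mulr_gt0.
have t1 : t <= 1 by rewrite ge_min lexx.
have ntv : normc (t%:C%C * v) = t * normc v by rewrite normcM normc_real gtr0_norm.
have tm : t * normc v < m.
  apply: (@le_lt_trans _ _ (m / (2 * (normc v + 1)) * normc v)).
    by rewrite ler_wpM2r ?normc_ge0// ge_min lexx orbT.
  rewrite mulrAC ltr_pdivrMr ?mulr_gt0// ltr_pM2l//; have := normc_ge0 v; lra.
have := tm; rewrite !lt_min => /andP[/andP[k1 k2] /andP[k3 k4]].
exists (t%:C%C * v); rewrite ?ntv//.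
rewrite fE ?ntv//; have fz : f z = h z + ((g z)^*)%C.
  by have := fE 0; rewrite normc0 addr0 => ->.
set u := t%:C%C * v.
have -> : h (z + u) + ((g (z + u))^*)%C - w = 
   - ((1 - t)%:C%C * a) + ((h (z + u) - h z - p * u) + ((g (z + u) - g z - q * u)^*)%C).
  have -> : (1 - t)%:C%C * a = a - (p * u + ((q * u)^*)%C).
    rewrite -[in LHS]vL rmorphB /= mulrBl mul1r vL /u; congr (_ - _).
    rewrite -vL mulrDr; congr (_ + _); first by ring.
    by rewrite !conjcM conjc_re; ring.
  by rewrite /a fz !conjcB !conjcM; ring.
rewrite (normcB (f z)) -/a.
apply: le_lt_trans (normcD _ _) _; rewrite normcN normcM normc_real ger0_norm ?subr_ge0//.
apply: (@le_lt_trans _ _ ((1 - t) * normc a + (e * (t * normc v) + e * (t * normc v)))).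
  rewrite lerD2l; apply: le_trans (normcD _ _) _; rewrite normc_conj -ntv -/u.
  by apply: lerD; [apply: H1|apply: H2]; rewrite /u ntv.
have : e * (t * normc v) + e * (t * normc v) < t * normc a.
  have -> : e * (t * normc v) + e * (t * normc v) = t * (normc a * (normc v / (2 * (normc v + 1)))).
    by rewrite /e; field; rewrite gt_eqF.
  rewrite ltr_pM2l// gtr_pMr// ltr_pdivrMr ?mulr_gt0//; have := normc_ge0 v; lra.
lra.
Qed.

(** If [f] expands distances from [c] by the factor [m], it takes values far
    from [w] on the boundary of the square of half side [rho / 2]. So [|f - w|]
    has its minimum over the square at an interior point, and by [move_closer]
    the minimum can only be 0. *)
Lemma covering (h g dh dg f : C -> C) (c w : C) (rho m : R) : 0 < rho -> 0 <= m ->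
  (forall z, normc (z - c) <= rho -> normc z < 1) ->
  (forall z, normc z < 1 -> cdiff h z (dh z)) ->
  (forall z, normc z < 1 -> cdiff g z (dg z)) ->
  (forall z, normc z < 1 -> normc (dg z) < normc (dh z)) ->
  (forall z, normc z < 1 -> f z = h z + ((g z)^*)%C) ->
  (forall z, normc (z - c) <= rho -> m * normc (z - c) <= normc (f z - f c)) ->
  normc (w - f c) < m * rho / 4 -> exists2 z, normc (z - c) <= rho & f z = w.
Proof.
move=> rho0 m0 disc Dh Dg dlt fE low hw.
pose s := rho / 2; have s0 : 0 < s by rewrite divr_gt0.
pose Q : set (R * R) := (`[Re c - s, Re c + s] `*` `[Im c - s, Im c + s])%classic.
have Qd x y : (Q (x, y)) -> normc ((x +i* y)%C - c) <= rho.
  move=> [] /=; rewrite !in_itv /= => h1 h2.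
  apply: le_trans (normc_le_ReIm _) _; rewrite ReB ImB /= (splitr rho) -/s.
  by rewrite lerD// ler_distl.
have fcf z : normc z < 1 -> fcont f z.
  move=> z1 e e0; have e20 : 0 < e / 2 by rewrite divr_gt0.
  have [r1 r10 H1] := cdiff_fcont (Dh _ z1) e20.
  have [r2 r20 H2] := cdiff_fcont (Dg _ z1) e20.
  exists (Num.min (1 - normc z) (Num.min r1 r2)); first by rewrite !lt_min r10 r20 subr_gt0 z1.
  move=> u; rewrite !lt_min => /and3P[u1 u2 u3].
  rewrite !fE//; last by apply: le_lt_trans (normcD _ _) _; rewrite addrC -ltrBrDr.
  have -> : h (z + u) + ((g (z + u))^*)%C - (h z + ((g z)^*)%C) = (h (z + u) - h z) + ((g (z + u) - g z)^*)%C.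
    by rewrite conjcB; ring.
  by apply: le_trans (normcD _ _) _; rewrite normc_conj (splitr e) lerD ?H1 ?H2.
pose phi (p : R * R) := normc (f (p.1 +i* p.2)%C - w).
have cphi : {within Q, continuous phi}.
  apply: continuous_in_subspaceT => -[x y]; rewrite inE => Qp.
  by apply: fcont_norm_cont; apply: fcf; apply: disc; exact: Qd.
have Qc : Q (Re c, Im c) by split; rewrite /= in_itv /= ?lerBlDr ?lerDl ltW.
have [[x y]] := @compact_EVT_min _ R phi Q (ex_intro _ _ Qc) (@compact_box _ _ _ _) cphi.
rewrite inE => Qxy Hmin; pose z := (x +i* y)%C.
have zc := Qd _ _ Qxy; have z1 := disc _ zc.
exists z => //; apply/eqP; apply: contraT => fw.
have Ec : (Re c +i* Im c)%C = c by case: (c).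
have lt1 : normc (f z - w) < m * rho / 4.
  have := Hmin (Re c, Im c); rewrite inE => /(_ Qc); rewrite /phi /= Ec -/z => k.
  by apply: le_lt_trans k _; rewrite normcB.
(* A minimiser at distance at least [s] from [c] would be moved too far from [f c]; the square contains all points at distance less than [s]. *)
have inner : normc (z - c) < s.
  have lowz := low _ zc; rewrite ltNge; apply/negP => sz.
  have k1 : m * s <= normc (f z - f c) by apply: le_trans lowz; rewrite ler_wpM2l.
  have k2 : normc (f z - f c) <= normc (f z - w) + normc (w - f c).
    by have -> : f z - f c = (f z - w) + (w - f c) by [ring]; exact: normcD.
  by rewrite /s in k1; lra.
have fEz : exists2 r : R, 0 < r & forall u, normc u < r -> f (z + u) = h (z + u) + ((g (z + u))^*)%C.
  exists (1 - normc z); first by rewrite subr_gt0.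
  by move=> u hu; apply: fE; apply: le_lt_trans (normcD _ _) _; rewrite addrC -ltrBrDr.
have sz0 : 0 < s - normc (z - c) by rewrite subr_gt0.
have [u u1 u2] := move_closer (Dh _ z1) (Dg _ z1) fEz (dlt _ z1) fw sz0.
have zu : normc (z + u - c) <= s.
  have -> : z + u - c = (z - c) + u by ring.
  by apply: le_trans (normcD _ _) _; lra.
have Qu : Q (Re (z + u), Im (z + u)).
  split; rewrite /= in_itv /= -ler_distl.
    by apply: le_trans zu; rewrite -ReB; exact: Re_le_normc.
  by apply: le_trans zu; rewrite -ImB; exact: Im_le_normc.
have := Hmin (Re (z + u), Im (z + u)); rewrite inE => /(_ Qu); rewrite /phi /= -/z.
have -> : (Re (z + u) +i* Im (z + u))%C = z + u by case: (z + u).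
by rewrite leNgt u2.
Qed.

Local Notation mu2 := ((@lebesgue_measure R) \x (@lebesgue_measure R))%E.

Definition open_square (w : C) (s : R) : set (R * R) :=
  (`](Re w - s), (Re w + s)[ `*` `](Im w - s), (Im w + s)[)%classic.

Lemma open_squareP w s (p : R * R) : open_square w s p <-> `|p.1 - Re w| < s /\ `|p.2 - Im w| < s.
Proof.
rewrite /open_square /= !in_itv /= -!ltr_distl; split => -[]; split => //.
Qed.

Lemma measurable_open_square w s : measurable (open_square w s).
Proof. by apply: measurableX; exact: measurable_itv. Qed.

Lemma mu_open_square w s : 0 <= s -> mu2 (open_square w s) = (4 * s ^+ 2)%:E.
Proof.
move=> s0; rewrite product_measure1E; [|exact: measurable_itv..].
have L (a : R) : lebesgue_measure (`](a - s), (a + s)[%classic : set R) = (2 * s)%:E.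
  rewrite lebesgue_measure_itv/= lte_fin; case: ltP => [_|h].
    by rewrite -EFinD; congr EFin; ring.
  by congr EFin; lra.
by transitivity ((2 * s)%:E * (2 * s)%:E)%E; [congr (_ * _)%E; exact: L|rewrite -EFinM; congr EFin; ring].
Qed.

(** Area: the squares of side [r j] centred in the discs are disjoint and lie in
    one square of side [4 M]. *)
Lemma packing n (P : pred 'I_n) (w : 'I_n -> C) (r : 'I_n -> R) (M : R) : 0 < M ->
  (forall j, P j -> [/\ 0 <= r j, r j <= M & normc (w j) <= M]) ->
  (forall i j z, P i -> P j -> normc (z - w i) < r i -> normc (z - w j) < r j -> i = j) ->
  \sum_(j < n | P j) r j ^+ 2 <= 16 * M ^+ 2.
Proof.
move=> M0 HP disj.
pose S j := open_square (w j) (r j / 2).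
have half j : P j -> 0 <= r j / 2 by move=> /HP[h _ _]; rewrite divr_ge0.
have inS j p : S j p -> normc ((p.1 +i* p.2)%C - w j) < r j.
  move=> /open_squareP[h1 h2]; apply: le_lt_trans (normc_le_ReIm _) _; rewrite ReB ImB /=.
  by rewrite (splitr (r j)) ltrD.
have mS j : measurable (S j) by exact: measurable_open_square.
have H : (mu2 (\big[setU/set0]_(j < n | P j) S j) <= mu2 (open_square (0 : C)%R (2 * M)%R))%E.
  apply: le_measure.
  - by apply/mem_set; apply: bigsetU_measurable => j _; exact: mS.
  - by apply/mem_set; exact: measurable_open_square.
  move=> p; rewrite -bigcup_seq_cond => -[j /= /andP[_ Pj] /open_squareP[h1 h2]].
  have [q1 q2 q3] := HP _ Pj; apply/open_squareP => /=; rewrite !subr0.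
  have := Re_le_normc (w j); have := Im_le_normc (w j) => g1 g2.
  have k1 : `|p.1| <= `|p.1 - Re (w j)| + `|Re (w j)| by rewrite -{1}(subrK (Re (w j)) p.1) ler_normD.
  have k2 : `|p.2| <= `|p.2 - Im (w j)| + `|Im (w j)| by rewrite -{1}(subrK (Im (w j)) p.2) ler_normD.
  by split; lra.
have tS : trivIset P S.
  move=> i j Pi Pj [p [Si Sj]]; exact: (disj _ _ (p.1 +i* p.2)%C Pi Pj (inS _ _ Si) (inS _ _ Sj)).
have mS' (j : 'I_n) : P j -> measurable (S j) by move=> _; exact: mS.
have E0 : mu2 (\big[setU/set0]_(j < n | P j) S j) = (\sum_(j < n | P j) mu2 (S j))%E.
  exact: measure_bigsetU_ord_cond.
rewrite E0 in H.
have M2 : 0 <= 2 * M by rewrite mulr_ge0// ltW.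
rewrite (mu_open_square 0 M2) in H.
have E : (\sum_(i < n | P i) mu2 (S i))%E = (\sum_(j < n | P j) r j ^+ 2)%:E.
  rewrite -sumEFin; apply: eq_bigr => j Pj; rewrite /S mu_open_square ?half//.
  by congr EFin; field.
rewrite E lee_fin in H; apply: le_trans H _.
by rewrite le_eqVlt; apply/orP; left; apply/eqP; ring.
Qed.

(** Holds without measurability because the integral of a nonnegative function is
    the supremum of the integrals of the simple functions below it. *)
Lemma ge0_le_integral_nonmeasurable d (T : measurableType d) (mu : {measure set T -> \bar R})
  (D : set T) (F G : T -> \bar R) :
  (forall x, D x -> (0 <= F x)%E) -> (forall x, (0 <= G x)%E) -> (forall x, D x -> (F x <= G x)%E) ->
  (\int[mu]_(x in D) F x <= \int[mu]_x G x)%E.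
Proof.
move=> F0 G0 FG; rewrite ge0_integralE// ge0_integralTE//.
apply: le_ereal_sup => _ [s /= hs <-]; exists s => //= x.
apply: le_trans (hs x) _; rewrite /patch; case: ifPn => //; rewrite inE; exact: FG.
Qed.

(** A countable cover with a finite set of pieces per generation, and one
    extra piece [A0] for the centre of the disc. *)
Lemma integral_cover d (T : measurableType d) (mu : {measure set T -> \bar R}) (D : set T)
  (F : T -> \bar R) (A0 : set T) (a0 m0 : R) (I : nat -> finType)
  (A : forall n, I n -> set T) (a m : forall n, I n -> R) (M : R) :
  (forall x, D x -> (0 <= F x)%E) ->
  measurable A0 -> 0 <= a0 -> mu A0 = m0%:E ->
  (forall n i, measurable (A n i)) -> (forall n i, 0 <= a n i) -> (forall n i, mu (A n i) = (m n i)%:E) ->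
  (forall x, D x -> (A0 x /\ (F x <= a0%:E)%E) \/ exists n i, A n i x /\ (F x <= (a n i)%:E)%E) ->
  (forall N, \sum_(n < N) \sum_i a n i * m n i <= M) ->
  (\int[mu]_(x in D) F x <= (a0 * m0 + M)%:E)%E.
Proof.
move=> F0 mA0 a00 mu0 mA aP muA cov bd.
pose t (B : set T) (c : R) (x : T) : \bar R := (c%:E * (\1_B x)%:E)%E.
have t0 B c x : 0 <= c -> (0 <= t B c x)%E by move=> c0; rewrite mule_ge0 ?lee_fin.
have tB (B : set T) c x : B x -> t B c x = c%:E by move=> Bx; rewrite /t indicE mem_set// mule1.
have mt B c : measurable B -> measurable_fun [set: T] (t B c).
  by move=> mB; apply: measurable_funeM; apply/measurable_EFinP; exact: measurable_indic.
have it B c : measurable B -> 0 <= c -> (\int[mu]_x t B c x = c%:E * mu B)%E.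
  move=> mB c0; rewrite ge0_integralZl_EFin//; last by apply/measurable_EFinP; exact: measurable_indic.
  by rewrite integral_indic// setIT.
pose g n x := (\sum_i t (A n i) (a n i) x)%E.
have g0 n x : (0 <= g n x)%E by apply: sume_ge0 => i _; exact: t0.
have mg n : measurable_fun [set: T] (g n) by apply: emeasurable_sum => i; exact: mt.
have ig n : (\int[mu]_x g n x = (\sum_i a n i * m n i)%:E)%E.
  rewrite /g ge0_integral_sum//; [|by move=> i; exact: mt|by move=> i x _; exact: t0].
  by rewrite -sumEFin; apply: eq_bigr => i _; rewrite it// muA EFinM.
pose G x := (t A0 a0 x + \sum_(0 <= n <oo) g n x)%E.
have s0 x : (0 <= \sum_(0 <= n <oo) g n x)%E by apply: nneseries_ge0 => n _ _; exact: g0.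
apply: (@le_trans _ _ (\int[mu]_x G x)%E).
  apply: ge0_le_integral_nonmeasurable => // x; first by rewrite /G adde_ge0// t0.
  move=> /cov[[A0x /le_trans]|[n [i [Ax /le_trans]]]]; apply; rewrite /G.
    by rewrite (tB A0)// leeDl.
  apply: (@le_trans _ _ (\sum_(0 <= n <oo) g n x)%E); last by rewrite leeDr// t0.
  apply: le_trans (nneseries_lim_ge n.+1 _); last by move=> k _ _; exact: g0.
  rewrite big_nat_recr//=; apply: (@le_trans _ _ (g n x)); last first.
    by rewrite leeDr// sume_ge0.
  rewrite /g (bigD1 i)//= (tB (A n i))// leeDl// sume_ge0// => k _; exact: t0.
rewrite /G ge0_integralD//; last 3 first.
- by move=> x _; exact: t0.
- exact: mt.
- by apply: ge0_emeasurable_sum => // k x _ _; exact: g0.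
rewrite it// mu0 integral_nneseries// EFinD EFinM leeD2l//.
apply: lime_le; first by apply: is_cvg_nneseries => n _ _; apply: integral_ge0 => x _; exact: g0.
near=> N; rewrite big_mkord; under eq_bigr do rewrite ig.
by rewrite sumEFin lee_fin.
Unshelve. all: by end_near. Qed.
End Covering.

(** * Sums over binary trees *)

Section Comb.
Variable R : realType.

(** For [y <= T x] the ratio [(1 + y / x)^p] is at most [1 + E y / x], and
    [E t <= eta + E^2 t^2 / (4 eta)]. The term linear in [y] is thus traded
    for an arbitrarily small multiple of [x^p] and a quadratic term, the one that
    area controls. *)
Lemma powRD_le (p eta T : R) : 0 < p -> 0 < eta -> 0 <= T ->
  exists2 D, 0 <= D & forall x y, 0 < x -> 0 <= y -> y <= T * x ->
    (x + y) `^ p <= (1 + eta) * x `^ p + D * (x `^ p * (y / x) ^+ 2).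
Proof.
move=> p0 eta0 T0.
have [m pm] : exists m : nat, p <= m%:R.
  by exists (Num.truncn p).+1; rewrite ltW// truncnS_gt.
have [E E0 HE] : exists2 E, 0 <= E & forall t, 0 <= t <= T -> (1 + t) ^+ m <= 1 + E * t.
  elim: (m) => [|i [E E0 HE]]; first by exists 0 => // t _; rewrite expr0 mul0r addr0.
  exists (E * (1 + T) + 1); first by rewrite addr_ge0// mulr_ge0// addr_ge0.
  move=> t /andP[t0 tT]; rewrite exprSr.
  apply: (@le_trans _ _ ((1 + E * t) * (1 + t))).
    by rewrite ler_wpM2r ?addr_ge0//; apply: HE; rewrite t0.
  have -> : (1 + E * t) * (1 + t) = 1 + (E * (1 + t) + 1) * t by ring.
  by rewrite lerD2l ler_wpM2r// lerD2r ler_wpM2l// lerD2l.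
exists (E ^+ 2 / (4 * eta)); first by rewrite divr_ge0 ?sqr_ge0// mulr_ge0// ltW.
move=> x y x0 y0 yT; set t := y / x.
have t0 : 0 <= t by rewrite divr_ge0// ltW.
have tT : t <= T by rewrite ler_pdivrMr.
have -> : x + y = x * (1 + t) by rewrite /t; field; rewrite gt_eqF.
rewrite powRM ?(ltW x0) ?addr_ge0//.
have -> : (1 + eta) * x `^ p + E ^+ 2 / (4 * eta) * (x `^ p * t ^+ 2) =
  x `^ p * (1 + eta + E ^+ 2 / (4 * eta) * t ^+ 2) by ring.
rewrite ler_wpM2l ?powR_ge0//.
apply: (@le_trans _ _ ((1 + t) ^+ m)).
  rewrite -powR_mulrn ?addr_ge0//; apply: ler_powR => //.
  by rewrite lerDl.
apply: le_trans (HE _ _) _; first by rewrite t0.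
rewrite -subr_ge0.
have -> : 1 + eta + E ^+ 2 / (4 * eta) * t ^+ 2 - (1 + E * t) = (2 * eta - E * t) ^+ 2 / (4 * eta).
  by field; rewrite gt_eqF.
by rewrite divr_ge0 ?sqr_ge0// mulr_ge0// ltW.
Qed.

Lemma powR_inv_half (p : R) : (2^-1) `^ p = 2 `^ (- p).
Proof. by rewrite -powR_inv1// -powRrM mulN1r. Qed.

Lemma pow2D (r s : R) : 2 `^ (r + s) = 2 `^ r * 2 `^ s.
Proof. by apply: powRD; apply/implyP => _; rewrite pnatr_eq0. Qed.

Lemma pow2_lt1 (u : R) : u < 0 -> 2 `^ u < 1.
Proof.
move=> u0; rewrite /powR gt_eqF// expR_lt1 pmulr_llt0//.
by apply: ln_gt0; rewrite ltr1n.
Qed.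

(** The exponent [beta] may be negative, hence the two-sided hypothesis and the
    absolute value. *)
Lemma weight_le (v l beta : R) : 0 < l -> l / 2 <= v <= 2 * l -> v `^ beta <= 2 `^ `|beta| * l `^ beta.
Proof.
move=> l0 /andP[v1 v2]; have l20 : 0 < l / 2 by rewrite divr_gt0.
have v0 : 0 < v by exact: lt_le_trans v1.
have [b0|b0] := leP 0 beta.
  rewrite (ger0_norm b0) -powRM ?(ltW l0)//.
  by apply: ge0_ler_powR => //; rewrite nnegrE ?mulr_ge0// ltW.
rewrite (ltr0_norm b0).
have -> : 2 `^ (- beta) * l `^ beta = ((l / 2) `^ (- beta))^-1.
  rewrite powRM ?(ltW l0)// invfM powR_inv_half -!powRN !opprK mulrC.
  by [].
rewrite -[v `^ beta]invrK -powRN lef_pV2 ?posrE ?powR_gt0//.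
by apply: ge0_ler_powR; rewrite ?nnegrE ?oppr_ge0 ?(ltW b0) ?(ltW l20) ?(ltW v0).
Qed.

(** On the layer [r / 2 < x <= r] the summand is at most [4 r^(p - 2) d^2], so
    the layer contributes [4 P r^p]; the layers [M, M / 2, M / 4, ...] form a
    geometric series, also for [p < 2]. *)
Lemma dyadic_layers n (x d : 'I_n -> R) (p P M : R) : 0 < p -> 0 <= P -> 0 < M ->
  (forall j, 0 < x j <= M) ->
  (forall r, 0 < r -> \sum_(j < n | x j <= r) d j ^+ 2 <= P * r ^+ 2) ->
  \sum_(j < n) x j `^ p * (d j / x j) ^+ 2 <= 4 * P / (1 - 2 `^ (- p)) * M `^ p.
Proof.
move=> p0 P0 M0 hx Hd.
set s := 2 `^ (- p); have s0 : 0 <= s by exact: powR_ge0.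
have s1 : s < 1 by apply: pow2_lt1; rewrite oppr_lt0.
set K := 4 * P / (1 - s).
have K0 : 0 <= K by rewrite divr_ge0 ?mulr_ge0// subr_ge0 ltW.
pose w j := x j `^ p * (d j / x j) ^+ 2.
have w0 j : 0 <= w j by rewrite mulr_ge0 ?powR_ge0 ?sqr_ge0.
have step I : forall r, 0 < r -> \sum_(j < n | (r * 2^-1 ^+ I < x j) && (x j <= r)) w j <= K * r `^ p.
  elim: I => [|I IH] r r0.
    rewrite big_pred0; first by rewrite mulr_ge0 ?powR_ge0.
    by move=> j; rewrite expr0 mulr1; apply/negbTE/negP => /andP[/lt_le_trans h /h]; rewrite ltxx.
  have r20 : 0 < r / 2 by rewrite divr_gt0.
  rewrite (bigID (fun j => x j <= r / 2)) /=.
  have cc : 0 <= 4 * r `^ p / r ^+ 2 by rewrite divr_ge0 ?sqr_ge0// mulr_ge0// powR_ge0.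
  have -> : K * r `^ p = K * (r / 2) `^ p + 4 * P * r `^ p.
    rewrite powRM ?(ltW r0)// powR_inv_half -/s.
    rewrite /K; field; by rewrite subr_eq0 gt_eqF.
  apply: lerD.
    apply: le_trans (IH _ r20); rewrite [leLHS]big_mkcond [leRHS]big_mkcond /=.
    apply: ler_sum => j _; rewrite exprS mulrA.
    case: ifPn => [/andP[/andP[h1 _] h2]|_]; first by rewrite h1 h2.
    by case: ifP.
  apply: (@le_trans _ _ (\sum_(j < n | x j <= r) 4 * r `^ p / r ^+ 2 * d j ^+ 2)).
    rewrite [leLHS]big_mkcond [leRHS]big_mkcond /=.
    apply: ler_sum => j _; case: ifPn => [/andP[/andP[_ h1]]|_]; last first.
      by case: ifP => // _; rewrite mulr_ge0// sqr_ge0.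
    rewrite -ltNge h1 => h2; have xj0 : 0 < x j by case/andP: (hx j).
    have -> : 4 * r `^ p / r ^+ 2 * d j ^+ 2 = r `^ p * (d j / (r / 2)) ^+ 2.
      by field; rewrite gt_eqF.
    apply: ler_pM; rewrite ?powR_ge0 ?sqr_ge0//.
      by apply: ge0_ler_powR; rewrite ?nnegrE ?(ltW p0) ?(ltW xj0) ?(ltW r0).
    rewrite ![(d j / _) ^+ 2]exprMn ler_wpM2l ?sqr_ge0//.
    rewrite ler_pXn2r ?nnegrE ?invr_ge0 ?(ltW xj0) ?(ltW r20)//.
    by rewrite lef_pV2 ?posrE// ltW.
  rewrite -mulr_sumr.
  apply: (@le_trans _ _ (4 * r `^ p / r ^+ 2 * (P * r ^+ 2))).
    by rewrite ler_wpM2l ?Hd.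
  by rewrite le_eqVlt; apply/orP; left; apply/eqP; field; rewrite gt_eqF.
have [I HI] : exists I : nat, forall j, M * 2^-1 ^+ I < x j.
  have ex (j : 'I_n) : exists i : nat, M * 2^-1 ^+ i < x j by apply: geometric_small; case/andP: (hx j).
  have [f Hf] := choice ex.
  exists (\max_j f j)%N => j; apply: le_lt_trans (Hf j).
  rewrite ler_wpM2l ?(ltW M0)//; apply: ler_wiXn2l; rewrite ?invr_ge0 ?invf_le1 ?ler1n//.
  exact: leq_bigmax.
apply: le_trans (step I _ M0); rewrite [leRHS]big_mkcond /=.
by apply: ler_sum => j _; rewrite HI; case/andP: (hx j) => _ ->.
Qed.

(** Every vertex of a generation is the parent of exactly two vertices. *)
Lemma sum_halves (phi : nat -> R) m : \sum_(j < (2 * m)%N) phi (j./2) = 2 * \sum_(j < m) phi j.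
Proof.
elim: m => [|m IH]; first by rewrite muln0 !big_ord0 mulr0.
rewrite mulnS addSn add1n !big_ord_recr /= IH mul2n doubleK uphalf_double mulrDr.
by rewrite -addrA; congr (_ + _); ring.
Qed.

(** The discrete Hardy inequality. Generation [n] has [J n] vertices, [j./2] is the
    parent of [j], and [F] varies by at most [Lam * d] along an edge. The
    condition [2 * b < 1] makes the homogeneous recursion contract, and
    [b * a `^ p < 1] makes its source, controlled by the packing hypothesis
    and the growth of [F], summable. *)
Lemma tree_sum_bounded (F d : nat -> nat -> R) (J : nat -> nat) (kap Lam P G F0 a b p : R) :
  0 < kap -> 0 <= Lam -> 0 <= P -> 0 <= G -> 1 < a -> 0 < b -> 2 * b < 1 -> 0 < p -> b * a `^ p < 1 ->
  (forall n, J n.+1 = (2 * J n)%N) ->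
  (forall n j, (j < J n)%N -> 0 < d n j /\ kap * d n j <= F n j) ->
  (forall n j, (j < J n.+1)%N -> F n.+1 j <= F n j./2 + Lam * d n j./2) ->
  (forall n r, 0 < r -> \sum_(j < J n | F n j <= r) d n j ^+ 2 <= P * r ^+ 2) ->
  (forall n j, (j < J n)%N -> d n j <= G * a ^+ n) ->
  (forall j, (j < J 0)%N -> F 0%N j <= F0) ->
  exists M, forall N, \sum_(n < N) b ^+ n * \sum_(j < J n) F n j `^ p <= M.
Proof.
move=> kap0 Lam0 P0 G0 a1 b0 b1 p0 ab1 HJ Hd Hchild Hpack HG HF0.
have a0 : 0 < a by exact: lt_trans a1.
have Fpos n j : (j < J n)%N -> 0 < F n j.
  by move=> /Hd[d0 dF]; apply: lt_le_trans dF; rewrite mulr_gt0.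
have halfJ n j : (j < J n.+1)%N -> (j./2 < J n)%N.
  by rewrite HJ mul2n ltn_half_double.
(* [F n j <= M0 * a ^+ n]: the growth of [d] is geometric with ratio [a > 1], so the sum of [Lam * d] along a branch is of the order of its last term. *)
pose M0 := Num.max 1 (Num.max F0 (Lam * G / (a - 1))).
have M01 : 1 <= M0 by rewrite le_max lexx.
have M00 : 0 < M0 by exact: lt_le_trans M01.
have HF n : forall j, (j < J n)%N -> F n j <= M0 * a ^+ n.
  elim: n => [|n IH] j hj.
    by rewrite expr0 mulr1 (le_trans (HF0 _ hj))// !le_max lexx orbT.
  apply: le_trans (Hchild _ _ hj) _; have hj2 := halfJ _ _ hj.
  apply: le_trans (lerD (IH _ hj2) (ler_wpM2l Lam0 (HG _ _ hj2))) _.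
  have -> : M0 * a ^+ n.+1 = M0 * a ^+ n + M0 * (a - 1) * a ^+ n by rewrite exprS; ring.
  rewrite lerD2l mulrA ler_wpM2r ?exprn_ge0 ?(ltW a0)//.
  by rewrite -ler_pdivrMr ?subr_gt0// !le_max lexx !orbT.
(* This choice makes [2 * b * (1 + eta)] the midpoint of [2 * b] and 1. *)
pose eta := (1 - 2 * b) / 2 / (2 * b).
have b20 : 0 < 2 * b by rewrite mulr_gt0.
have eta0 : 0 < eta by rewrite !divr_gt0// subr_gt0.
pose th := 2 * b * (1 + eta).
have th1 : th < 1.
  have -> : th = 2 * b + (1 - 2 * b) / 2 by rewrite /th /eta; field; rewrite gt_eqF.
  lra.
have th0 : 0 <= th by rewrite mulr_ge0 ?(ltW b20)// addr_ge0// ltW.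
have T0 : 0 <= Lam / kap by rewrite divr_ge0// ltW.
have [D D0 HD] := powRD_le p0 eta0 T0.
pose Sm n := \sum_(j < J n) F n j `^ p.
pose E n := \sum_(j < J n) F n j `^ p * (d n j / F n j) ^+ 2.
have HE n : E n <= 4 * P / (1 - 2 `^ (- p)) * (M0 * a ^+ n) `^ p.
  apply: (@dyadic_layers (J n) (fun j => F n j) (fun j => d n j)) => //.
    by rewrite mulr_gt0// exprn_gt0.
    by move=> j; rewrite Fpos// HF.
  exact: Hpack.
have HSm n : Sm n.+1 <= 2 * ((1 + eta) * Sm n + D * Lam ^+ 2 * E n).
  rewrite /Sm /E !mulr_sumr -big_split /= mulr_sumr.
  pose phi j := 2 * ((1 + eta) * F n j `^ p + D * Lam ^+ 2 * (F n j `^ p * (d n j / F n j) ^+ 2)).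
  apply: (@le_trans _ _ (\sum_(j < J n.+1) (phi j./2 / 2))).
    apply: ler_sum => j _; have hj := ltn_ord j; have hj2 := halfJ _ _ hj.
    have Fx := Fpos _ _ hj2; have [dx kdx] := Hd _ _ hj2.
    have -> : phi j./2 / 2 = (1 + eta) * F n j./2 `^ p + D * (F n j./2 `^ p * (Lam * d n j./2 / F n j./2) ^+ 2).
      by rewrite /phi; field; rewrite gt_eqF.
    apply: le_trans (HD _ (Lam * d n j./2) Fx _ _).
    + apply: ge0_ler_powR; rewrite ?nnegrE ?(ltW p0) ?(ltW (Fpos _ _ hj))//; last exact: Hchild.
      by rewrite addr_ge0 ?mulr_ge0// ltW.
    + by rewrite mulr_ge0// ltW.
    + by rewrite mulrAC -mulrA ler_wpM2l// ler_pdivlMr// mulrC.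
  rewrite HJ (sum_halves (fun j => phi j / 2)) mulr_sumr.
  by apply: ler_sum => j _; rewrite [2 * _]mulrC divfK// lexx.
pose rho := b * a `^ p.
have rho0 : 0 <= rho by rewrite mulr_ge0 ?powR_ge0// ltW.
pose K := 2 * b * (D * Lam ^+ 2 * (4 * P / (1 - 2 `^ (- p)) * M0 `^ p)).
have q0 : 0 < 1 - 2 `^ (- p) by rewrite subr_gt0 pow2_lt1// oppr_lt0.
have K0 : 0 <= K.
  by rewrite /K !mulr_ge0 ?powR_ge0 ?sqr_ge0 ?invr_ge0 ?(ltW b0) ?(ltW q0).
have HT n : b ^+ n.+1 * Sm n.+1 <= th * (b ^+ n * Sm n) + K * rho ^+ n.
  apply: (@le_trans _ _ (b ^+ n.+1 * (2 * ((1 + eta) * Sm n + D * Lam ^+ 2 * (4 * P / (1 - 2 `^ (- p)) * (M0 * a ^+ n) `^ p))))).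
    rewrite ler_wpM2l ?exprn_ge0 ?(ltW b0)//; apply: le_trans (HSm n) _.
    by rewrite ler_wpM2l// lerD2l ler_wpM2l ?HE// mulr_ge0 ?sqr_ge0.
  have -> : (M0 * a ^+ n) `^ p = M0 `^ p * (a `^ p) ^+ n.
    rewrite powRM ?(ltW M00) ?exprn_ge0 ?(ltW a0)//; congr (_ * _).
    by rewrite -(powR_mulrn n (ltW a0)) -(powR_mulrn n (powR_ge0 a p)) -!powRrM mulrC.
  rewrite /th /K /rho exprMn exprS le_eqVlt; apply/orP; left; apply/eqP; ring.
have Sm0 n : 0 <= Sm n by apply: sumr_ge0 => j _; exact: powR_ge0.
exists ((Sm 0%N + K / (1 - rho)) / (1 - th)) => N.
have geo m : \sum_(n < m) rho ^+ n <= (1 - rho)^-1.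
  rewrite -[leRHS]mul1r ler_pdivlMr ?subr_gt0//.
  have -> : (\sum_(n < m) rho ^+ n) * (1 - rho) = 1 - rho ^+ m.
    elim: m => [|m IH]; first by rewrite big_ord0 expr0 mul0r subrr.
    by rewrite big_ord_recr /= mulrDl IH exprS; ring.
  by rewrite lerBlDr lerDl exprn_ge0.
have rec m : \sum_(n < m.+1) b ^+ n * Sm n <= Sm 0%N + th * (\sum_(n < m) b ^+ n * Sm n) + K * \sum_(n < m) rho ^+ n.
  rewrite big_ord_recl expr0 mul1r -addrA lerD2l !mulr_sumr -big_split /=.
  by apply: ler_sum => i _; exact: HT.
rewrite ler_pdivlMr ?subr_gt0// mulrC mulrBl mul1r lerBlDr.
apply: (@le_trans _ _ (\sum_(n < N.+1) b ^+ n * Sm n)).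
  by rewrite big_ord_recr /= lerDl mulr_ge0// exprn_ge0// ltW.
apply: le_trans (rec N) _; rewrite addrAC lerD2r lerD2l.
by rewrite ler_wpM2l.
Qed.
End Comb.

(** * A tree of Whitney points in the disc *)

Section Points.
Variable R : realType.
Local Notation C := R[i].
Implicit Types (e z : C) (t s : R) (n j : nat).

(** The distance from generation [n] to the unit circle. *)
Definition ell n : R := 2^-1 ^+ n.+1.
(** The parameters run over [-1, 3], while [-1, 1] already parametrises a half
    circle: the margin makes the last cell of [-1, 1] unexceptional. *)
Definition circ_param n j : R := - 1 + j%:R * ell n / 8.
(** The rational parametrisation of the circle; [-1, 1] gives the right half. *)
Definition ucirc t : C := (1 +i* t)%C / (1 +i* - t)%C.
(** [e] is 1 or -1: the right half of the circle and its opposite. *)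
Definition whitney_pt e n j : C := e * ((1 - ell n)%:C%C * ucirc (circ_param n j)).
Definition nb_whitney n : nat := (64 * 2 ^ n)%N.

Lemma ell_gt0 n : 0 < ell n. Proof. by rewrite exprn_gt0. Qed.

Lemma ellS n : ell n = 2 * ell n.+1. Proof. by rewrite /ell [in RHS]exprS; field. Qed.

Lemma ell_le n : ell n <= 1 / 2.
Proof.
rewrite /ell exprS mul1r -[leRHS]mulr1 ler_wpM2l// exprn_ile1//.
by rewrite invf_le1// ler1n.
Qed.

Lemma ell_weight n (beta : R) :
  ell n `^ beta * ell n ^+ 2 = (2 `^ (- (beta + 2))) ^+ n.+1.
Proof.
have E : ell n = 2 `^ (- n.+1%:R) by rewrite powRN powR_mulrn// -exprVn.
rewrite -(powR_mulrn 2 (ltW (ell_gt0 n))) -(powR_mulrn n.+1 (powR_ge0 _ _)) E -!powRrM -pow2D.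
by congr (_ `^ _); ring.
Qed.

Lemma den_ne0 t : (1 +i* t)%C != 0 :> C /\ (1 +i* - t)%C != 0 :> C.
Proof. by rewrite !eq_complex /= !oner_eq0. Qed.

Lemma den_norm t : normc (1 +i* - t)%C = normc (1 +i* t)%C :> R.
Proof. by rewrite /= sqrrN. Qed.

Lemma den_ge1 t : 1 <= normc (1 +i* t)%C.
Proof. by have := Re_le_normc (1 +i* t)%C; rewrite /= normr1. Qed.

Lemma normc_ucirc t : normc (ucirc t) = 1.
Proof. by rewrite /ucirc normcM normcV den_norm divff// normc_eq0; have [] := den_ne0 t. Qed.

Lemma ucirc_sub t s : normc (ucirc t - ucirc s) * (normc (1 +i* t)%C * normc (1 +i* s)%C) = 2 * `|t - s|.
Proof.
have [_ t0] := den_ne0 t; have [_ s0] := den_ne0 s.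
rewrite -(den_norm t) -(den_norm s) -!normcM.
have -> : (ucirc t - ucirc s) * ((1 +i* - t)%C * (1 +i* - s)%C) =
   (1 +i* t)%C * (1 +i* - s)%C - (1 +i* s)%C * (1 +i* - t)%C.
  by rewrite /ucirc; field; rewrite t0 s0.
have -> : (1 +i* t)%C * (1 +i* - s)%C - (1 +i* s)%C * (1 +i* - t)%C = (0 +i* (2 * (t - s)))%C.
  by apply/eqP; rewrite eq_complex /=; apply/andP; split; apply/eqP; ring.
by rewrite /normc expr0n add0r sqrtr_sqr normrM ger0_norm.
Qed.

Lemma ucirc_lip t s : normc (ucirc t - ucirc s) <= 2 * `|t - s|.
Proof.
rewrite -ucirc_sub ler_peMr ?normc_ge0//.
by rewrite mulr_ege1 ?den_ge1.
Qed.

Lemma ucirc_sep t s : - 1 <= t <= 3 -> - 1 <= s <= 3 -> `|t - s| / 5 <= normc (ucirc t - ucirc s).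
Proof.
move=> ht hs.
have b (x : R) : - 1 <= x <= 3 -> normc ((1 +i* x)%C : C) ^+ 2 <= 10.
  move=> /andP[x1 x2]; rewrite normc_sqr /= expr1n.
  (* [1 + x ^ 2 <= 10] on the interval [-1, 3]. *)
  have : 0 <= (3 - x) * (x + 1) by rewrite mulr_ge0; lra.
  by nra.
have b2 : normc (1 +i* t)%C * normc (1 +i* s)%C <= 10.
  rewrite -(@ler_pXn2r _ 2) ?nnegrE ?mulr_ge0 ?normc_ge0// exprMn.
  have -> : 10 ^+ 2 = 10 * 10 :> R by rewrite expr2.
  by apply: ler_pM; rewrite ?sqr_ge0// b.
have E := ucirc_sub t s; have := ler_wpM2l (normc_ge0 (ucirc t - ucirc s)) b2.
rewrite E ler_pdivrMr//; move: `|t - s| (normc (_ - _)) => x y; lra.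
Qed.

Lemma ucirc_cover (u : C) : normc u = 1 -> 0 <= Re u -> exists2 t, - 1 <= t <= 1 & u = ucirc t.
Proof.
case: u => x y nu x0; rewrite /= in x0.
have nu2 : x ^+ 2 + y ^+ 2 = 1 by have := normc_sqr (x +i* y)%C; rewrite nu expr1n.
have x1 : 0 < 1 + x by rewrite ltr_pwDl.
have y1 : `|y| <= 1 by rewrite -nu; exact: (Im_le_normc (x +i* y)%C).
exists (y / (1 + x)).
  rewrite -ler_norml normrM normfV (ger0_norm (ltW x1)) ler_pdivrMr// mul1r.
  by apply: le_trans y1 _; rewrite lerDl.
set t := y / (1 + x); have [_ t0] := den_ne0 t.
apply: (mulIf t0); rewrite /ucirc divfK//.
apply/eqP; rewrite eq_complex /=; apply/andP; split; apply/eqP.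
  transitivity ((x + (x ^+ 2 + y ^+ 2)) / (1 + x)); first by rewrite /t; field; rewrite gt_eqF.
  by rewrite nu2 addrC divff// gt_eqF.
by rewrite /t; field; rewrite gt_eqF.
Qed.

Lemma whitney_pt_norm e n j : normc e = 1 -> normc (whitney_pt e n j) = 1 - ell n.
Proof.
move=> e1; rewrite /whitney_pt 2!normcM e1 normc_ucirc mul1r mulr1 normc_real ger0_norm//.
by have := ell_le n; lra.
Qed.

Lemma whitney_pt_lt1 e n j : normc e = 1 -> normc (whitney_pt e n j) < 1.
Proof. by move=> e1; rewrite whitney_pt_norm//; have := ell_gt0 n; lra. Qed.

(** Distances in polar coordinates, along the radius and then along the circle. *)
Lemma sub_polar e (a b : R) t s : normc e = 1 -> 0 <= b <= 1 ->
  normc (e * (a%:C%C * ucirc t) - e * (b%:C%C * ucirc s)) <= `|a - b| + 2 * `|t - s|.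
Proof.
move=> e1 /andP[b0 b1].
have -> : e * (a%:C%C * ucirc t) - e * (b%:C%C * ucirc s) =
  e * ((a - b)%:C%C * ucirc t + b%:C%C * (ucirc t - ucirc s)) by rewrite rmorphB /=; ring.
rewrite normcM e1 mul1r; apply: le_trans (normcD _ _) _.
rewrite (normcM (a - b)%:C%C) (normcM b%:C%C) !normc_real normc_ucirc mulr1 lerD2l (ger0_norm b0).
by apply: le_trans (ucirc_lip t s); rewrite ler_piMl ?normc_ge0.
Qed.

Lemma whitney_pt_parent e n j : normc e = 1 -> normc (whitney_pt e n.+1 j - whitney_pt e n j./2) <= 3 / 4 * ell n.
Proof.
move=> e1; have l0 := ell_gt0 n; have l1 := ell_le n.
have hb : 0 <= 1 - ell n <= 1 by apply/andP; split; lra.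
apply: le_trans (sub_polar _ _ _ e1 hb) _.
have -> : 1 - ell n.+1 - (1 - ell n) = ell n / 2 by rewrite [ell n]ellS; field.
have -> : circ_param n.+1 j - circ_param n j./2 = (odd j)%:R * ell n / 16.
  by rewrite /circ_param [ell n]ellS -{1}(odd_double_half j) natrD -mul2n natrM; field.
have o2 : (odd j)%:R * ell n <= ell n by rewrite ler_piMl ?(ltW l0)//; case: (odd j).
have o1 : 0 <= (odd j)%:R * ell n by rewrite mulr_ge0// ltW.
rewrite !ger0_norm; [|by rewrite divr_ge0|by rewrite divr_ge0 ?(ltW l0)].
by move: ((odd j)%:R * ell n) o1 o2 => x *; lra.
Qed.

Lemma nb_whitney_ell n : (nb_whitney n)%:R * ell n = 32.
Proof.
rewrite /nb_whitney /ell natrM natrX exprVn exprS; field.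
by rewrite expf_neq0.
Qed.

Lemma circ_param_itv n j : (j < nb_whitney n)%N -> - 1 <= circ_param n j <= 3.
Proof.
move=> hj; rewrite /circ_param; have l0 := ell_gt0 n.
have h0 : 0 <= j%:R * ell n by rewrite mulr_ge0// ltW.
have h1 : j%:R * ell n <= 32 by rewrite -(nb_whitney_ell n) ler_pM2r// ler_nat ltnW.
by move: (j%:R * ell n) h0 h1 => x *; apply/andP; split; lra.
Qed.

Lemma whitney_pt_sep e n i j : normc e = 1 -> (i < nb_whitney n)%N -> (j < nb_whitney n)%N -> i != j ->
  ell n / 80 <= normc (whitney_pt e n i - whitney_pt e n j).
Proof.
move=> e1 hi hj ij; have l0 := ell_gt0 n; have l1 := ell_le n.
have -> : whitney_pt e n i - whitney_pt e n j = e * ((1 - ell n)%:C%C * (ucirc (circ_param n i) - ucirc (circ_param n j))).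
  by rewrite /whitney_pt; ring.
rewrite 2!normcM e1 mul1r normc_real ger0_norm; last by lra.
have H := ucirc_sep (circ_param_itv hi) (circ_param_itv hj).
have D : ell n / 8 <= `|circ_param n i - circ_param n j|.
  have -> : circ_param n i - circ_param n j = (i%:R - j%:R) * (ell n / 8) by rewrite /circ_param; ring.
  rewrite normrM (ger0_norm (_ : 0 <= ell n / 8)) ?divr_ge0 ?(ltW l0)//.
  rewrite ler_peMl ?divr_ge0 ?(ltW l0)//.
  move: ij; rewrite neq_ltn => /orP[h|h].
    by rewrite distrC -natrB ?(ltnW h)// normr_nat ler1n subn_gt0.
  by rewrite -natrB ?(ltnW h)// normr_nat ler1n subn_gt0.
apply: (@le_trans _ _ (1 / 2 * (ell n / 8 / 5))); first by lra.
apply: ler_pM => //; [by rewrite !divr_ge0// ltW|lra|].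
by apply: le_trans H; rewrite ler_pM2r.
Qed.

Lemma level_exists (s : R) : 0 < s <= 1 / 2 -> exists n, ell n / 2 <= s <= ell n.
Proof.
move=> /andP[s0 s1].
have ex : exists n, ell n.+1 < s.
  have [n Hn] := geometric_small 1 s0; exists n; apply: le_lt_trans Hn; rewrite mul1r /ell.
  by apply: ler_wiXn2l; rewrite ?invr_ge0 ?invf_le1 ?ler1n// -addn2 leq_addr.
have [n Hn Hmin] := ex_minnP ex.
exists n; apply/andP; split; first by rewrite ellS mulrC mulKf// ltW.
case: n Hn Hmin => [|n] Hn Hmin; first by apply: le_trans s1 _; rewrite /ell expr1 mul1r.
by rewrite leNgt; apply/negP => /Hmin; rewrite ltnn.
Qed.

Lemma whitney_pt_cover z : 1 / 2 <= normc z < 1 -> exists (b : bool) n j, [/\ (j < nb_whitney n)%N,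
  normc (z - whitney_pt ((-1) ^+ b) n j) <= 3 / 4 * ell n & ell n / 2 <= 1 - normc z <= ell n].
Proof.
move=> /andP[z2 z1].
have [n Hn] : exists n, ell n / 2 <= 1 - normc z <= ell n.
  by apply: level_exists; apply/andP; split; lra.
have nz0 : 0 < normc z by lra.
have nzc : (normc z)%:C%C != 0 :> C by rewrite -normc_eq0 normc_real normr_eq0 gt_eqF.
pose u := z / (normc z)%:C%C.
have nu : normc u = 1 by rewrite /u normcM normcV normc_real ger0_norm ?divff ?gt_eqF// ltW.
have [b [u' nu' [Re0 uE]]] : exists b : bool, exists2 u', normc u' = 1 & 0 <= Re u' /\ u = (-1) ^+ b * u'.
  have [h|h] := leP 0 (Re u); first by exists false, u => //; rewrite expr0 mul1r.
  exists true, (- u); first by rewrite normcN.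
  split; last by rewrite expr1 mulN1r opprK.
  by case: (u) h => x y /= h; rewrite oppr_ge0 ltW.
have [t /andP[t1 t2] ut] := ucirc_cover nu' Re0.
have l0 := ell_gt0 n.
pose x := (t + 1) * 8 / ell n.
have x0 : 0 <= x by rewrite divr_ge0 ?(ltW l0)// mulr_ge0// ; lra.
have /andP[j1 j2] := truncn_itv x0; set j := Num.truncn x in j1 j2.
exists b, n, j; split => //.
  rewrite -(ltr_nat R); apply: le_lt_trans j1 _.
  rewrite /x ltr_pdivrMr// nb_whitney_ell; lra.
have zE : z = (-1) ^+ b * ((normc z)%:C%C * ucirc t).
  by rewrite -ut mulrCA -uE /u mulrC divfK.
rewrite {1}zE /whitney_pt.
have e1 : normc ((-1) ^+ b : C) = 1 by case: (b); rewrite ?expr0 ?expr1 ?normcN normc1.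
case/andP: Hn => n1 n2; have l1 := ell_le n.
have hb : 0 <= 1 - ell n <= 1 by apply/andP; split; lra.
apply: le_trans (sub_polar _ _ _ e1 hb) _.
have k1 : `|normc z - (1 - ell n)| <= ell n / 2 by rewrite ler_norml; apply/andP; split; lra.
have tE : t - circ_param n j = (x - j%:R) * (ell n / 8) by rewrite /circ_param /x; field; rewrite gt_eqF.
have k2 : `|t - circ_param n j| <= ell n / 8.
  rewrite tE normrM (ger0_norm (_ : 0 <= ell n / 8)) ?divr_ge0 ?(ltW l0)//.
  rewrite ler_piMl ?divr_ge0 ?(ltW l0)// ger0_norm ?subr_ge0//.
  by move: j2; rewrite -natr1 => j2; rewrite lerBlDl ltW.
lra.
Qed.
End Points.

(** * Growth and distortion *)

Section Gronwall.
Variable R : realType.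
Local Notation C := R[i].

Lemma is_derive_to (F G : R -> R) (t a b : R) : is_derive t 1 F a -> F = G -> a = b ->
  is_derive t 1 G b.
Proof. by move=> H <- <-. Qed.

Lemma is_derive_affine (a b t : R) : is_derive t 1 (fun t => a + t * b) b.
Proof.
apply: is_derive_eps => e e0; exists 1 => // w _.
have -> : a + (t + w) * b - (a + t * b) - b * w = 0 by ring.
by rewrite normr0 mulr_ge0// ltW.
Qed.

(** [n * exp (- w)] is nonincreasing. *)
Lemma gronwall (n dn w dw : R -> R) :
  (forall t : R, 0 <= t <= 1 -> is_derive t 1 n (dn t)) ->
  (forall t : R, 0 <= t <= 1 -> is_derive t 1 w (dw t)) ->
  (forall t : R, 0 <= t <= 1 -> dn t <= dw t * n t) ->
  n 1 <= n 0 * expR (w 1 - w 0).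
Proof.
move=> Dn Dw H.
pose N t := n t * expR (- w t).
have DN (t : R) : 0 <= t <= 1 -> is_derive t 1 N ((dn t - dw t * n t) * expR (- w t)).
  move=> t01; have := Dn _ t01; have := Dw _ t01 => Dw' Dn'.
  have De : is_derive t 1 (fun t => expR (- w t)) (- dw t * expR (- w t)).
    rewrite mulrC.
    exact: (@is_derive1_comp R expR (fun t => - w t) t _ _ (is_derive_expR _) (is_deriveN Dw')).
  by apply: (is_derive_to (is_deriveM Dn' De)) => //; rewrite /GRing.scale /=; ring.
have [c c01 E] : exists2 c, c \in `]0, 1[%R & N 1 - N 0 = ((dn c - dw c * n c) * expR (- w c)) * (1 - 0).
  apply: (@MVT R N (fun t => (dn t - dw t * n t) * expR (- w t)) 0 1 ltr01).
    by move=> x; rewrite in_itv/= => /andP[x0 x1]; apply: DN; rewrite !ltW.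
  apply: derivable_within_continuous => x; rewrite in_itv/= => x01.
  by have [] := DN _ x01.
have c01' : 0 <= c <= 1 by move: c01; rewrite in_itv/= => /andP[? ?]; rewrite !ltW.
have : N 1 <= N 0.
  rewrite -subr_le0 E subr0 mulr1 mulr_le0_ge0 ?expR_ge0// subr_le0; exact: H.
rewrite /N => h1.
rewrite -(ler_pM2r (expR_gt0 (- w 1))).
have -> : n 0 * expR (w 1 - w 0) * expR (- w 1) = n 0 * expR (- w 0).
  by rewrite -mulrA -expRD; congr (_ * expR _); ring.
exact: h1.
Qed.

Lemma is_derive_normsq (F : C -> C) (a b d : C) (t : R) : cdiff F (a + t%:C%C * b) d ->
  is_derive t 1 (fun t : R => normc (F (a + t%:C%C * b)) ^+ 2)
    (2 * Re (((F (a + t%:C%C * b))^*)%C * (d * b))).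
Proof.
move=> H.
have d1 := is_derive_line 1 H; have d2 := is_derive_line (- 'i)%C H.
have -> : (fun t : R => normc (F (a + t%:C%C * b)) ^+ 2) = (fun t : R =>
   Re (1 * F (a + t%:C%C * b)) * Re (1 * F (a + t%:C%C * b)) +
   Re ((- 'i)%C * F (a + t%:C%C * b)) * Re ((- 'i)%C * F (a + t%:C%C * b))).
  apply/funext => s; rewrite normc_sqr; case: (F _) => p q /=.
  by rewrite !oppr0 !mul0r !mul1r subr0 mulN1r opprK add0r.
apply: (is_derive_to (is_deriveD (is_deriveM d1 d1) (is_deriveM d2 d2))) => //.
rewrite /GRing.scale /=; case: (F _) => p q; case: (d * b) => u v /=.
by ring.
Qed.

End Gronwall.

Section Distortion.
Variable R : realType.
Local Notation C := R[i].
Variables (f h g dh dg d2h : C -> C) (k al : R).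
Hypothesis Dh : forall z, normc z < 1 -> cdiff h z (dh z).
Hypothesis Dg : forall z, normc z < 1 -> cdiff g z (dg z).
Hypothesis D2 : forall z, normc z < 1 -> cdiff dh z (d2h z).
Hypothesis dh0 : forall z, normc z < 1 -> 0 < normc (dh z).
Hypothesis dgk : forall z, normc z < 1 -> normc (dg z) <= k * normc (dh z).
Hypothesis k01 : 0 <= k < 1.
Hypothesis al0 : 0 < al.
(** The pre-Schwarzian bound supplied by linear invariance. *)
Hypothesis pre_schw : forall z, normc z < 1 ->
  normc ((1 - normc z ^+ 2)%:C%C * d2h z - 2 * (z^*)%C * dh z) <= 2 * al * normc (dh z).
Hypothesis fE : forall z, normc z < 1 -> f z = h z + ((g z)^*)%C.
Hypothesis f_inj : forall z w, normc z < 1 -> normc w < 1 -> f z = f w -> z = w.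
Hypothesis f00 : f 0 = 0.
Hypothesis dh00 : dh 0 = 1.

Lemma d2h_le z : normc z < 1 -> normc (d2h z) * (1 - normc z) <= (2 * al + 2) * normc (dh z).
Proof.
move=> z1; have r0 := normc_ge0 z.
have q0 : 0 <= 1 - normc z ^+ 2 by rewrite subr_ge0 ltW// expr_lt1.
apply: (@le_trans _ _ (normc (d2h z) * (1 - normc z ^+ 2))).
  rewrite ler_wpM2l ?normc_ge0// lerB// expr2 -[leRHS]mul1r ler_wpM2r// ltW//.
have -> : normc (d2h z) * (1 - normc z ^+ 2) = normc ((1 - normc z ^+ 2)%:C%C * d2h z).
  by rewrite normcM normc_real ger0_norm// mulrC.
rewrite -(subrK (2 * (z^*)%C * dh z) ((1 - normc z ^+ 2)%:C%C * d2h z)).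
apply: le_trans (normcD _ _) _; rewrite [leRHS]mulrDl; apply: lerD; first exact: pre_schw.
rewrite !normcM normc_conj normc2 ler_wpM2r ?normc_ge0//.
by rewrite -[leRHS]mulr1 ler_wpM2l// ltW.
Qed.

(** Along the radius to [z] put [n t = |h' (t z)|^2] and [s = t |z|]. The
    pre-Schwarzian bound gives [n' <= 4 |z| (s + al) / (1 - s^2) * n], and
    [2 (s + al) / (1 - s^2) <= (al + 1) / (1 - s) + al] for [0 <= s < 1]. *)
Lemma growth z : normc z < 1 ->
  normc (dh z) <= expR al * expR (- (al + 1) * ln (1 - normc z)).
Proof.
move=> z1; set r := normc z; have r0 : 0 <= r by exact: normc_ge0.
have tr1 (t : R) : 0 <= t <= 1 -> t * r < 1.
  by move=> /andP[t0 t1]; apply: le_lt_trans z1; rewrite -[leRHS]mul1r ler_wpM2r.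
have nt (t : R) : 0 <= t <= 1 -> normc (0 + t%:C%C * z) = t * r.
  by move=> /andP[t0 _]; rewrite add0r normcM normc_real ger0_norm.
pose w t := 2 * al * (t * r) - 2 * (al + 1) * ln (1 - t * r).
have Dw (t : R) : 0 <= t <= 1 -> is_derive t 1 w (2 * al * r + 2 * (al + 1) * r / (1 - t * r)).
  move=> t01; have p0 : 0 < 1 - t * r by rewrite subr_gt0 tr1.
  have l1 : is_derive t 1 (fun t : R => 1 - t * r) (- r).
    by apply: (is_derive_to (is_derive_affine 1 (- r) t)) => //; apply/funext => u; rewrite mulrN.
  have l3 : is_derive t 1 (fun t : R => ln (1 - t * r)) ((1 - t * r)^-1 * - r).
    have := is_derive1_ln p0 => l4.
    exact: (@is_derive1_comp R (@ln R) (fun t => 1 - t * r) t).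
  have l5 : is_derive t 1 (fun t : R => t * r) r.
    by apply: (is_derive_to (is_derive_affine 0 r t)) => //; apply/funext => u; rewrite add0r.
  apply: (is_derive_to (is_deriveB (is_deriveZ (2 * al) l5) (is_deriveZ (2 * (al + 1)) l3))) => //.
  by rewrite /GRing.scale/=; ring.
have key : normc (dh (0 + 1%:C%C * z)) ^+ 2 <= normc (dh (0 + 0%:C%C * z)) ^+ 2 * expR (w 1 - w 0).
  apply: (@gronwall R (fun t => normc (dh (0 + t%:C%C * z)) ^+ 2)
    (fun t => 2 * Re (((dh (0 + t%:C%C * z))^*)%C * (d2h (0 + t%:C%C * z) * z))) w _ _ Dw).
    by move=> t t01; apply: is_derive_normsq; apply: D2; rewrite nt// tr1.
  move=> t t01; set zt := 0 + t%:C%C * z; have zt1 : normc zt < 1 by rewrite nt// tr1.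
  have nz : normc zt = t * r by rewrite nt.
  have s0 : 0 <= t * r by rewrite mulr_ge0//; case/andP: t01.
  have s1 := tr1 _ t01.
  have P : (1 - (t * r) ^+ 2) * Re ((dh zt)^*%C * (d2h zt * z)) <= normc (dh zt) ^+ 2 * (2 * t * r ^+ 2 + 2 * al * r).
    have E : (1 - (t * r) ^+ 2) * Re ((dh zt)^*%C * (d2h zt * z)) = 
      Re ((dh zt)^*%C * z * ((1 - normc zt ^+ 2)%:C%C * d2h zt - 2 * (zt^*)%C * dh zt)) + normc (dh zt) ^+ 2 * (2 * t * r ^+ 2).
      rewrite -nz -Re_realM.
      have -> : (1 - normc zt ^+ 2)%:C%C * ((dh zt)^*%C * (d2h zt * z)) =
        (dh zt)^*%C * z * ((1 - normc zt ^+ 2)%:C%C * d2h zt - 2 * (zt^*)%C * dh zt) +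
        2 * ((dh zt)^*%C * dh zt) * ((zt^*)%C * z) by ring.
      rewrite ReD; congr (_ + _).
      have -> : (zt^*)%C * z = (t * r ^+ 2)%:C%C.
        by rewrite /zt add0r conjcM conjc_re -mulrA conj_mul -rmorphM.
      rewrite conj_mul -[2](rmorph_nat (real_complex R)) -!rmorphM /=; ring.
    rewrite E [leRHS]mulrDr [leRHS]addrC lerD2r.
    apply: le_trans (ler_norm _) _; apply: le_trans (Re_le_normc _) _.
    rewrite 2!normcM normc_conj -/r.
    have -> : normc (dh zt) ^+ 2 * (2 * al * r) = normc (dh zt) * r * (2 * al * normc (dh zt)) by ring.
    by rewrite ler_wpM2l ?pre_schw// mulr_ge0// normc_ge0.
  have n0 : 0 <= normc (dh zt) ^+ 2 by rewrite sqr_ge0.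
  have q0 : 0 < 1 - (t * r) ^+ 2 by rewrite subr_gt0 expr_lt1.
  have p0 : 0 < 1 - t * r by rewrite subr_gt0.
  move: P; move: (normc (dh zt) ^+ 2) (Re _) n0 => N X N0 P.
  rewrite -(ler_pM2l q0).
  have -> : (1 - (t * r) ^+ 2) * ((2 * al * r + 2 * (al + 1) * r / (1 - t * r)) * N) =
     N * (2 * al * r * (1 - (t * r) ^+ 2) + 2 * (al + 1) * r * (1 + t * r)).
    by field; rewrite gt_eqF.
  have -> : (1 - (t * r) ^+ 2) * (2 * X) = 2 * ((1 - (t * r) ^+ 2) * X) by ring.
  apply: (@le_trans _ _ (2 * (N * (2 * t * r ^+ 2 + 2 * al * r)))).
    by rewrite ler_pM2l.
  have -> : 2 * (N * (2 * t * r ^+ 2 + 2 * al * r)) = N * (2 * (2 * t * r ^+ 2 + 2 * al * r)) by ring.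
  rewrite ler_wpM2l// -subr_ge0.
  have -> : 2 * al * r * (1 - (t * r) ^+ 2) + 2 * (al + 1) * r * (1 + t * r) - 2 * (2 * t * r ^+ 2 + 2 * al * r)
    = 2 * r * ((1 - t * r) * (1 + al * (t * r))) by ring.
  apply: mulr_ge0; first exact: mulr_ge0.
  by apply: mulr_ge0; [exact: ltW|apply: addr_ge0 => //; apply: mulr_ge0 => //; exact: ltW].
move: key; rewrite mul0r add0r mul1r add0r dh00 normc1 expr1n mul1r => key.
rewrite -(@ler_pXn2r _ 2) ?nnegrE ?normc_ge0 ?mulr_ge0 ?expR_ge0//.
apply: le_trans key _.
rewrite exprMn -!expRM_natl -expRD ler_expR /w !mul0r mul1r subr0 ln1 !mulr0 subr0.
rewrite /r; have : al * r <= al * 1 by rewrite ler_wpM2l ?ltW// .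
rewrite -/r; lra.
Qed.

(** [A / (1 - |c|)] bounds [|h'' / h'|] at distance at most
    [3 / 4 * (1 - |c|)] from [c]. *)
Let A := 8 * al + 8.
Let B := expR A.
Let A8 : 8 < A. Proof. by rewrite /A ltrDr mulr_gt0. Qed.
Let B1 : 1 <= B. Proof. by rewrite -expR0 ler_expR (le_trans _ (ltW A8)). Qed.

(** Small enough for [|h' z - h' c| <= (1 - k) / 160 * |h' c|] on the disc of
    radius [dl * (1 - |c|)], and for these discs to be disjoint around the
    points of one generation. *)
Let dl := (1 - k) / (160 * A * B).
Lemma dl_gt0 : 0 < dl.
Proof.
case/andP: k01 => k0 k1.
have A0 : 0 < A by exact: lt_trans A8.
apply: divr_gt0; first by rewrite subr_gt0.
by apply: mulr_gt0 (expR_gt0 _); exact: mulr_gt0.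
Qed.

Lemma dl_le : dl <= 1 / 320.
Proof.
case/andP: k01 => k0 k1; have A0 : 0 < A by rewrite (lt_trans _ A8).
have AB : 2 <= A * B.
  by rewrite -[2]mulr1 ler_pM// (le_trans _ (ltW A8))//; lra.
rewrite /dl ler_pdivrMr ?mulr_gt0 ?expR_gt0//.
have -> : 1 / 320 * (160 * A * B) = (A * B) / 2 by field.
rewrite ler_pdivlMr//; apply: le_trans AB; lra.
Qed.

Section Local.
Variable c : C.
Hypothesis c1 : normc c < 1.
Local Notation l := (1 - normc c).
Let l0 : 0 < l. Proof. by rewrite subr_gt0. Qed.

Lemma whitney_dist z : normc (z - c) <= 3 / 4 * l -> l / 4 <= 1 - normc z.
Proof.
move=> hz; have := normc_sub_le z c; lra.
Qed.

Lemma whitney_disk z : normc (z - c) <= 3 / 4 * l -> normc z < 1.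
Proof. by move=> /whitney_dist h1; rewrite -subr_gt0 (lt_le_trans _ h1)// divr_gt0. Qed.

Lemma whitney_d2h z : normc (z - c) <= 3 / 4 * l -> normc (d2h z) <= A / l * normc (dh z).
Proof.
move=> hz; have := d2h_le (whitney_disk hz) => H.
have h1 : normc (d2h z) * (l / 4) <= (2 * al + 2) * normc (dh z).
  by apply: le_trans H; rewrite ler_wpM2l ?normc_ge0 ?whitney_dist.
have -> : A / l * normc (dh z) = (2 * al + 2) * normc (dh z) / (l / 4).
  by rewrite /A; field; rewrite gt_eqF.
by rewrite ler_pdivlMr// divr_gt0.
Qed.

Lemma whitney_dh z : normc (z - c) <= 3 / 4 * l -> normc (dh z) <= B * normc (dh c).
Proof.
move=> hz.
have seg (t : R) : 0 <= t <= 1 -> normc (c + t%:C%C * (z - c) - c) <= 3 / 4 * l.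
  by move=> t01; exact: le_trans (seg_dist _ _ t01) hz.
have := @gronwall R (fun t => normc (dh (c + t%:C%C * (z - c))) ^+ 2)
    (fun t => 2 * Re (((dh (c + t%:C%C * (z - c)))^*)%C * (d2h (c + t%:C%C * (z - c)) * (z - c))))
    (fun t => 2 * A * t) (fun=> 2 * A).
have E1 : c + 1%:C%C * (z - c) = z by rewrite mul1r; ring.
have E0 : c + 0%:C%C * (z - c) = c by rewrite mul0r addr0.
rewrite E1 E0 => G.
rewrite -(@ler_pXn2r _ 2) ?nnegrE ?normc_ge0 ?mulr_ge0 ?normc_ge0 ?expR_ge0//.
have -> : (B * normc (dh c)) ^+ 2 = normc (dh c) ^+ 2 * expR (2 * A * 1 - 2 * A * 0).
  by rewrite mulr1 mulr0 subr0 exprMn mulrC /B expRM_natl.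
apply: G => t t01.
- by apply: is_derive_normsq; apply: D2; apply: whitney_disk; exact: seg.
- by apply: (is_derive_to (is_derive_affine 0 (2 * A) t)) => //; apply/funext => u; rewrite add0r mulrC.
set zt := c + _; have szt := seg _ t01; rewrite -/zt in szt.
rewrite -mulrA ler_pM2l//.
apply: le_trans (ler_norm _) _; apply: le_trans (Re_le_normc _) _.
rewrite !normcM normc_conj.
apply: (@le_trans _ _ (normc (dh zt) * (A / l * normc (dh zt) * (3 / 4 * l)))).
  by rewrite ler_wpM2l ?normc_ge0// ler_pM ?normc_ge0// whitney_d2h.
have -> : normc (dh zt) * (A / l * normc (dh zt) * (3 / 4 * l)) = A * normc (dh zt) ^+ 2 * (3 / 4).
  by field; rewrite gt_eqF.
rewrite -[leRHS]mulr1 ler_wpM2l//; last by lra.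
by rewrite mulr_ge0 ?sqr_ge0// ltW// (lt_trans _ A8).
Qed.

Lemma whitney_f_le z : normc (z - c) <= 3 / 4 * l ->
  normc (f z - f c) <= 2 * B * normc (dh c) * normc (z - c).
Proof.
move=> hz; rewrite !fE ?whitney_disk//; last by rewrite subrr normc0 mulr_ge0 ?ltW.
have -> : h z + ((g z)^*)%C - (h c + ((g c)^*)%C) = (h z - h c) + ((g z - g c)^*)%C.
  by case: (h z) (h c) (g z) (g c) => [a b] [a' b'] [p q] [p' q']; simpc; congr (_ +i* _)%C; ring.
apply: le_trans (normcD _ _) _; rewrite normc_conj.
have bd w : normc (w - c) <= normc (z - c) -> normc (w - c) <= 3 / 4 * l by move=> /le_trans; apply.
have -> : 2 * B * normc (dh c) * normc (z - c) = B * normc (dh c) * normc (z - c) + B * normc (dh c) * normc (z - c) by ring.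
apply: lerD.
  apply: (mean_value_disc (dh := dh)) => w /bd hw; [exact: Dh (whitney_disk hw)|exact: whitney_dh].
apply: (mean_value_disc (dh := dg)) => w /bd hw; first exact: Dg (whitney_disk hw).
apply: le_trans (dgk (whitney_disk hw)) _.
case/andP: k01 => k0 k1.
by apply: le_trans (whitney_dh hw); rewrite -[leRHS]mul1r ler_wpM2r ?normc_ge0// ltW.
Qed.

(** With [ep = (1 - k) / 160] the analytic part moves by at least
    [(1 - ep) |h' c| |z - c|] and the antianalytic part by at most
    [k (1 + ep) |h' c| |z - c|]. *)
Lemma whitney_f_ge z : normc (z - c) <= dl * l ->
  (1 - k) / 2 * normc (dh c) * normc (z - c) <= normc (f z - f c).
Proof.
move=> hz; case/andP: (k01) => k0 k1.
have A0 : 0 < A by rewrite (lt_trans _ A8).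
have B0 : 0 < B by exact: expR_gt0.
have hz' : normc (z - c) <= 3 / 4 * l.
  by apply: le_trans hz _; rewrite ler_pM2r//; apply: le_trans dl_le _; lra.
have bd w : normc (w - c) <= normc (z - c) -> normc (w - c) <= 3 / 4 * l by move=> /le_trans; apply.
pose ep := (1 - k) / 160.
have hd w : normc (w - c) <= normc (z - c) -> normc (dh w - dh c) <= ep * normc (dh c).
  move=> hw.
  apply: (@le_trans _ _ (A / l * (B * normc (dh c)) * normc (w - c))).
    apply: (mean_value_disc (dh := d2h)).
      by move=> v hv; apply: D2; apply: whitney_disk; apply: bd; exact: le_trans hw.
    move=> v hv; have hv' := bd _ (le_trans hv hw); apply: le_trans (whitney_d2h hv') _.
    by rewrite ler_wpM2l ?whitney_dh// divr_ge0// ltW.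
  apply: (@le_trans _ _ (A / l * (B * normc (dh c)) * (dl * l))).
    rewrite ler_wpM2l ?(le_trans hw)// mulr_ge0 ?divr_ge0 ?mulr_ge0 ?normc_ge0// ltW//.
  rewrite /dl /ep le_eqVlt; apply/orP; left; apply/eqP; field.
  by rewrite !gt_eqF.
have ep0 : 0 <= ep by rewrite /ep divr_ge0// subr_ge0 ltW.
have H1 : normc (h z - h c - dh c * (z - c)) <= ep * normc (dh c) * normc (z - c).
  have := @mean_value_disc R (fun w => h w - dh c * w) (fun w => dh w - dh c) (ep * normc (dh c)) c z.
  have -> : h z - dh c * z - (h c - dh c * c) = h z - h c - dh c * (z - c) by ring.
  apply=> [w hw|//]; have -> : dh w - dh c = dh w - dh c * 1 by rewrite mulr1.
  by apply: cdiffB; [apply: Dh; exact: whitney_disk (bd _ hw)|apply: cdiffZ; exact: cdiff_id].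
have H2 : normc (g z - g c) <= k * (1 + ep) * normc (dh c) * normc (z - c).
  apply: (mean_value_disc (dh := dg)) => w hw; first exact: Dg (whitney_disk (bd _ hw)).
  apply: le_trans (dgk (whitney_disk (bd _ hw))) _; rewrite -!mulrA ler_wpM2l//.
  rewrite -(subrK (dh c) (dh w)) (le_trans (normcD _ _))// mulrDl mul1r addrC lerD2l.
  exact: hd.
rewrite !fE ?whitney_disk//; last by rewrite subrr normc0 mulr_ge0 ?ltW.
pose Y := (h z - h c - dh c * (z - c)) + ((g z - g c)^*)%C.
have -> : h z + ((g z)^*)%C - (h c + ((g c)^*)%C) = dh c * (z - c) + Y.
  rewrite /Y addrA [dh c * _ + _]addrC subrK.
  by case: (h z) (h c) (g z) (g c) => [a b] [a' b'] [p q] [p' q']; simpc; congr (_ +i* _)%C; ring.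
have HY : normc Y <= (ep + k * (1 + ep)) * normc (dh c) * normc (z - c).
  have -> : (ep + k * (1 + ep)) * normc (dh c) * normc (z - c) =
    ep * normc (dh c) * normc (z - c) + k * (1 + ep) * normc (dh c) * normc (z - c) by ring.
  rewrite /Y; apply: le_trans (normcD _ _) _; rewrite normc_conj; exact: lerD H1 H2.
have := normc_sub_le (dh c * (z - c)) (- Y); rewrite normcN opprK; apply: le_trans.
rewrite normcM lerBrDr.
apply: (@le_trans _ _ ((1 - k) / 2 * normc (dh c) * normc (z - c) + (ep + k * (1 + ep)) * normc (dh c) * normc (z - c))).
  by rewrite lerD2l.
rewrite -!mulrDl -[leRHS]mul1r mulrA ler_wpM2r ?normc_ge0// ler_wpM2r ?normc_ge0//.
have -> : (1 - k) / 2 + (ep + k * (1 + ep)) = (1 + k) / 2 + ep + k * ep by field.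
have ke : k * ep <= ep by rewrite -[leRHS]mul1r ler_wpM2r// ltW.
apply: (@le_trans _ _ ((1 + k) / 2 + ep + ep)); first by rewrite lerD2l.
by rewrite /ep; lra.
Qed.
End Local.

(** * Sums over the generations of the tree *)

Lemma lt_dg z : normc z < 1 -> normc (dg z) < normc (dh z).
Proof.
move=> z1; case/andP: k01 => k0 k1.
by apply: le_lt_trans (dgk z1) _; rewrite gtr_pMl ?dh0.
Qed.

Let kap := (1 - k) * dl / 8.
Lemma kap_gt0 : 0 < kap.
Proof. by case/andP: k01 => k0 k1; rewrite divr_gt0// mulr_gt0 ?subr_gt0 ?dl_gt0. Qed.

(** [covering] with the expansion factor of [whitney_f_ge]. *)
Lemma image_disc c w : normc c < 1 -> normc (w - f c) < kap * (normc (dh c) * (1 - normc c)) ->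
  exists2 z, normc (z - c) <= dl * (1 - normc c) & f z = w.
Proof.
move=> c1 hw; case/andP: (k01) => k0 k1; have l0 : 0 < 1 - normc c by rewrite subr_gt0.
have small z : normc (z - c) <= dl * (1 - normc c) -> normc (z - c) <= 3 / 4 * (1 - normc c).
  by move=> hz; apply: le_trans hz _; rewrite ler_pM2r//; apply: le_trans dl_le _; lra.
apply: (@covering _ h g dh dg f c w (dl * (1 - normc c)) ((1 - k) / 2 * normc (dh c))).
- by rewrite mulr_gt0// dl_gt0.
- by rewrite mulr_ge0 ?normc_ge0// divr_ge0// subr_ge0 ltW.
- by move=> z /small; exact: whitney_disk.
- exact: Dh.
- exact: Dg.
- exact: lt_dg.
- exact: fE.
- exact: whitney_f_ge.
have -> : (1 - k) / 2 * normc (dh c) * (dl * (1 - normc c)) / 4 = kap * (normc (dh c) * (1 - normc c)).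
  by rewrite /kap; field.
exact: hw.
Qed.

(** The preimage of 0 is 0, which is far from [c]; so 0 is not in the disc
    around [f c] that the image contains. *)
Lemma quarter_bound c : 1 / 2 <= normc c < 1 -> kap * (normc (dh c) * (1 - normc c)) <= normc (f c).
Proof.
move=> /andP[c2 c1]; rewrite leNgt; apply/negP => H.
have [|z zc fz] := @image_disc c 0 c1; first by rewrite sub0r normcN.
have l0 : 0 < 1 - normc c by rewrite subr_gt0.
have hz : normc (z - c) <= 1 / 320 * (1 - normc c) by apply: le_trans zc _; rewrite ler_pM2r// dl_le.
have z0 : z = 0.
  apply: f_inj; rewrite ?normc0 ?fz ?f00//.
  by have := normc_sub_le z c; lra.
by move: hz; rewrite z0 sub0r normcN; lra.
Qed.

Section Levels.
Variable e : C.
Hypothesis e1 : normc e = 1.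
Let F n j := normc (f (whitney_pt e n j)).
Let d n j := normc (dh (whitney_pt e n j)) * ell R n.

Lemma whitney_pt_dist n j : 1 - normc (whitney_pt e n j) = ell R n.
Proof. by rewrite whitney_pt_norm//; ring. Qed.

Lemma whitney_pt_ge_half n j : 1 / 2 <= normc (whitney_pt e n j) < 1.
Proof. by rewrite whitney_pt_lt1// andbT whitney_pt_norm//; have := @ell_le R n; lra. Qed.

Lemma quarter_bound_level n j : 0 < d n j /\ kap * d n j <= F n j.
Proof.
split; first by rewrite mulr_gt0 ?ell_gt0// dh0// whitney_pt_lt1.
by have := quarter_bound (whitney_pt_ge_half n j); rewrite whitney_pt_dist.
Qed.

Lemma parent_le n j : F n.+1 j <= F n j./2 + 2 * B * d n j./2.
Proof.
have c1 := @whitney_pt_lt1 R e n j./2 e1.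
have hzp : normc (whitney_pt e n.+1 j - whitney_pt e n j./2) <= 3 / 4 * (1 - normc (whitney_pt e n j./2)).
  by rewrite whitney_pt_dist; exact: whitney_pt_parent.
have := whitney_f_le c1 hzp.
set x := f (whitney_pt e n.+1 j); set y := f (whitney_pt e n j./2) => H.
have {}H : normc (x - y) <= 2 * B * d n j./2.
  apply: le_trans H _; rewrite /d -!mulrA ler_wpM2l// ler_wpM2l ?expR_ge0// ler_wpM2l ?normc_ge0//.
  apply: le_trans (whitney_pt_parent n j e1) _; rewrite ler_piMl ?(ltW (ell_gt0 R n))//; lra.
by have := normc_sub_le x y; rewrite /F -/x -/y => H2; move: H H2; lra.
Qed.

(** By injectivity the image discs of [image_disc] at one generation are
    disjoint. *)
Lemma level_packing n r : 0 < r ->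
  \sum_(j < nb_whitney n | F n j <= r) d n j ^+ 2 <= 16 / kap ^+ 2 * r ^+ 2.
Proof.
move=> r0; have k0 := kap_gt0.
have := @packing R (nb_whitney n) (fun j => F n j <= r) (fun j => f (whitney_pt e n j)) (fun j => kap * d n j) r r0.
move=> H; have : \sum_(j < nb_whitney n | F n j <= r) (kap * d n j) ^+ 2 <= 16 * r ^+ 2.
  apply: H.
    move=> j Fj; have [d0 dF] := quarter_bound_level n j; split => //; first by rewrite mulr_ge0// ltW.
    exact: le_trans dF Fj.
  move=> i j z _ _ hi hj; apply: val_inj; apply/eqP; apply: contraT => ij.
  have [|zi zi1 fzi] := @image_disc (whitney_pt e n i) z (whitney_pt_lt1 _ _ e1); first by rewrite whitney_pt_dist.
  have [|zj zj1 fzj] := @image_disc (whitney_pt e n j) z (whitney_pt_lt1 _ _ e1); first by rewrite whitney_pt_dist.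
  have l0 := ell_gt0 R n.
  have loc m' zz : normc (zz - whitney_pt e n m') <= dl * (1 - normc (whitney_pt e n m')) ->
      normc zz < 1 /\ normc (zz - whitney_pt e n m') <= 1 / 320 * ell R n.
    rewrite whitney_pt_dist => hz; have hz' : normc (zz - whitney_pt e n m') <= 1 / 320 * ell R n.
      by apply: le_trans hz _; rewrite ler_pM2r// dl_le.
    split => //; apply: (whitney_disk (whitney_pt_lt1 n m' e1)); rewrite whitney_pt_dist.
    by apply: le_trans hz' _; rewrite ler_pM2r//; lra.
  have [zi2 zi3] := loc _ _ zi1; have [zj2 zj3] := loc _ _ zj1.
  have zz : zi = zj by apply: f_inj => //; rewrite fzi fzj.
  have := whitney_pt_sep e1 (ltn_ord i) (ltn_ord j) ij.
  have : normc (whitney_pt e n i - whitney_pt e n j) <= normc (zi - whitney_pt e n i) + normc (zj - whitney_pt e n j).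
    rewrite zz (normcB zj (whitney_pt e n i)).
    have -> : whitney_pt e n i - whitney_pt e n j = (whitney_pt e n i - zj) + (zj - whitney_pt e n j) by ring.
    exact: normcD.
  lra.
under eq_bigr do rewrite exprMn.
rewrite -mulr_sumr mulrC -ler_pdivlMr ?exprn_gt0// => h1; apply: le_trans h1 _.
by rewrite mulrAC.
Qed.

(** [growth] at the points, with [(1 - |c|)^(- al)] written as a power
    of [2 `^ al]. *)
Lemma d_growth n j : d n j <= expR al * 2 `^ al * (2 `^ al) ^+ n.
Proof.
have := growth (@whitney_pt_lt1 R e n j e1); rewrite whitney_pt_dist => H.
have l0 := ell_gt0 R n.
apply: (@le_trans _ _ (expR al * expR (- (al + 1) * ln (ell R n)) * ell R n)).
  by rewrite ler_pM2r.
have lk : ell R n = expR (ln (ell R n)) by rewrite lnK// posrE.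
have E : expR (- (al + 1) * ln (ell R n)) * ell R n = (2 `^ al) ^+ n.+1.
  rewrite [X in _ * X = _]lk -expRD.
  have -> : - (al + 1) * ln (ell R n) + ln (ell R n) = n.+1%:R * (al * ln 2).
    by rewrite /ell lnXn// lnV ?posrE// -mulr_natl; ring.
  by rewrite expRM_natl /powR gt_eqF.
by rewrite -mulrA E exprS mulrA.
Qed.

Lemma f_le_center z : normc z <= 3 / 4 -> normc (f z) <= 2 * B.
Proof.
move=> hz; have n0 : normc (0 : C) < 1 by rewrite normc0.
have := @whitney_f_le 0 n0 z; rewrite !subr0 normc0 subr0 mulr1 => /(_ hz).
rewrite f00 subr0 dh00 normc1 mulr1 => H; apply: le_trans H _.
by rewrite ler_piMr ?mulr_ge0 ?expR_ge0//; lra.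
Qed.

Lemma level_sum (p beta : R) : 0 < p -> -1 < beta -> al * p < beta + 2 ->
  exists M, forall N, \sum_(n < N) (2 `^ (- (beta + 2))) ^+ n * \sum_(j < nb_whitney n) F n j `^ p <= M.
Proof.
move=> p0 hb hp.
have twopos : 0 < 2 :> R by [].
apply: (@tree_sum_bounded R F d nb_whitney kap (2 * B) (16 / kap ^+ 2) (expR al * 2 `^ al) (2 * B) (2 `^ al)).
- exact: kap_gt0.
- by rewrite mulr_ge0// expR_ge0.
- by rewrite divr_ge0// sqr_ge0.
- by rewrite mulr_ge0 ?powR_ge0 ?expR_ge0.
- rewrite -[ltRHS]invrK -powRN invf_gt1 ?powR_gt0//.
  by apply: pow2_lt1; rewrite oppr_lt0.
- exact: powR_gt0.
- rewrite -{1}[2]powRr1// -pow2D.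
  by apply: pow2_lt1; lra.
- by [].
- by rewrite -powRrM -pow2D; apply: pow2_lt1; lra.
- by move=> n; rewrite /nb_whitney expnS; ring.
- by move=> n j _; exact: quarter_bound_level.
- by move=> n j _; exact: parent_le.
- by move=> n r; exact: level_packing.
- by move=> n j _; exact: d_growth.
- move=> j _; apply: f_le_center; rewrite whitney_pt_norm// /ell expr1; lra.
Qed.

Lemma cell_le n j z : normc (z - whitney_pt e n j) <= 3 / 4 * ell R n ->
  normc (f z) <= (1 + 2 * B / kap) * F n j.
Proof.
move=> hz; have c1 := @whitney_pt_lt1 R e n j e1; have k0 := kap_gt0.
have := @whitney_f_le _ c1 z; rewrite whitney_pt_dist => /(_ hz) H.
have {}H : normc (f z - f (whitney_pt e n j)) <= 2 * B * d n j.
  apply: le_trans H _; rewrite /d -!mulrA ler_wpM2l// ler_wpM2l ?expR_ge0// ler_wpM2l ?normc_ge0//.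
  apply: le_trans hz _; rewrite ler_piMl ?(ltW (ell_gt0 R n))//; lra.
have [_ dF] := quarter_bound_level n j.
have H2 : 2 * B * d n j <= 2 * B / kap * F n j.
  have -> : 2 * B * d n j = 2 * B / kap * (kap * d n j) by field; rewrite gt_eqF.
  by rewrite ler_wpM2l// divr_ge0 ?(ltW k0)// mulr_ge0// expR_ge0.
rewrite mulrDl mul1r -lerBlDl; apply: le_trans (normc_sub_le _ _) _.
exact: le_trans H H2.
Qed.
End Levels.

(** On the square of half side [ell n] around a point of generation [n] the
    integrand is [O(|f c|^p * ell n ^ beta)], and the square has area
    [4 * ell n ^ 2]: the sum over all points is the one of [level_sum]. *)
Lemma bergman_integral_finite (p beta : R) : 0 < p -> -1 < beta -> al * p < beta + 2 ->
  (bergman_integral p beta f < +oo)%E.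
Proof.
move=> p0 hb hp.
have sg1 (b : bool) : normc ((-1) ^+ b : C) = 1 by case: b; rewrite ?expr0 ?expr1 ?normcN normc1.
have [M0 HM0] := level_sum (sg1 false) p0 hb hp.
have [M1 HM1] := level_sum (sg1 true) p0 hb hp.
have pi0 : 0 < pi :> R by exact: pi_gt0.
have b10 : 0 < beta + 1 by lra.
pose W := (beta + 1) / pi * 2 `^ `|beta|.
have W0 : 0 <= W by rewrite mulr_ge0 ?powR_ge0// divr_ge0// ltW.
pose Q := (1 + 2 * B / kap) `^ p * W.
have L0 : 0 <= 1 + 2 * B / kap.
  by rewrite addr_ge0// divr_ge0 ?(ltW kap_gt0)// mulr_ge0// expR_ge0.
have Q0 : 0 <= Q by rewrite mulr_ge0 ?powR_ge0.
pose bb : R := 2 `^ (- (beta + 2)).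
have bb0 : 0 <= bb by exact: powR_ge0.
pose I (n : nat) : finType := (bool * 'I_(nb_whitney n))%type.
pose cen n (i : I n) : C := whitney_pt ((-1) ^+ i.1) n i.2.
pose a n (i : I n) := Q * normc (f (cen n i)) `^ p * ell R n `^ beta.
rewrite /bergman_integral.
set FF := (X in integral _ _ X).
have bnd z (l G : R) : 0 < l -> normc z < 1 -> l / 2 <= 1 - normc z -> 1 - normc z <= l -> normc (f z) <= G ->
  normc (f z) `^ p * ((beta + 1) * (1 - normc z ^+ 2) `^ beta / pi) <= G `^ p * (W * l `^ beta).
  move=> l0 z1 l1 l2 fG; have G0 : 0 <= G by exact: le_trans (normc_ge0 _) fG.
  have nz := normc_ge0 z.
  apply: ler_pM; rewrite ?powR_ge0//.
  - by rewrite divr_ge0 ?(ltW pi0)// mulr_ge0 ?powR_ge0// ltW.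
  - by apply: ge0_ler_powR; rewrite ?nnegrE ?normc_ge0// ltW.
  have -> : (beta + 1) * (1 - normc z ^+ 2) `^ beta / pi = (beta + 1) / pi * (1 - normc z ^+ 2) `^ beta by ring.
  rewrite /W -[leRHS]mulrA ler_wpM2l ?divr_ge0 ?(ltW pi0) ?(ltW b10)//.
  have E : 1 - normc z ^+ 2 = (1 - normc z) * (1 + normc z) by ring.
  apply: weight_le => //; rewrite E; apply/andP; split.
    by apply: le_trans l1 _; rewrite ler_peMr ?subr_ge0 ?(ltW z1)// lerDl.
  rewrite mulrC; apply: ler_pM => //; rewrite ?subr_ge0 ?addr_ge0 ?(ltW z1)//; lra.
pose mm n (i : I n) : R := 4 * ell R n ^+ 2.
apply: le_lt_trans (@integral_cover R _ _ _ _ FF (open_square (0 : C) 1) ((2 * B) `^ p * (W * 1 `^ beta)) (4 * 1 ^+ 2) I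
   (fun n i => open_square (cen n i) (ell R n)) a mm (4 * Q * bb * (M0 + M1)) _ _ _ _ _ _ _ _ _) _.
- by move=> w _; rewrite lee_fin mulr_ge0 ?powR_ge0// divr_ge0 ?(ltW pi0)// mulr_ge0 ?powR_ge0// ltW.
- exact: measurable_open_square.
- by rewrite mulr_ge0 ?powR_ge0// mulr_ge0 ?powR_ge0.
- exact: mu_open_square.
- by move=> n i; exact: measurable_open_square.
- by move=> n i; rewrite /a mulr_ge0 ?powR_ge0// mulr_ge0 ?powR_ge0.
- by move=> n i; apply: mu_open_square; exact: ltW (ell_gt0 R n).
- move=> [x y] /= hz; rewrite /unit_disk /= in hz; set z := (x +i* y)%C in hz.
  have [zh|zh] := leP (1 / 2) (normc z).
    right; have [|b [n [j [jn zc /andP[l1 l2]]]]] := @whitney_pt_cover R z; first by rewrite zh.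
    pose i : I n := (b, Ordinal jn); exists n, i; split.
      have l0 := ell_gt0 R n.
      have lt34 : 3 / 4 * ell R n < ell R n by lra.
      apply/open_squareP => /=; split; apply: le_lt_trans lt34; apply: le_trans zc.
        by have := Re_le_normc (z - cen n i); rewrite ReB.
      by have := Im_le_normc (z - cen n i); rewrite ImB.
    rewrite /FF lee_fin -/z.
    have zF := cell_le (sg1 b) zc.
    apply: le_trans (bnd z (ell R n) _ (ell_gt0 R n) hz l1 l2 zF) _.
    rewrite powRM ?normc_ge0// /a /Q /cen /=.
    by rewrite le_eqVlt; apply/orP; left; apply/eqP; ring.
  left; split.
    apply/open_squareP => /=; rewrite !subr0; split; apply: le_lt_trans hz.
      exact: (Re_le_normc z).
    exact: (Im_le_normc z).
  rewrite /FF lee_fin -/z; apply: bnd => //; [by lra|by have := normc_ge0 z; lra|].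
  by apply: f_le_center; lra.
- move=> N.
  have E n : \sum_(i : I n) a n i * mm n i = 4 * Q * bb * (bb ^+ n * \sum_(j < nb_whitney n) normc (f (whitney_pt ((-1) ^+ false) n j)) `^ p)
     + 4 * Q * bb * (bb ^+ n * \sum_(j < nb_whitney n) normc (f (whitney_pt ((-1) ^+ true) n j)) `^ p).
    have lE : ell R n `^ beta * ell R n ^+ 2 = bb ^+ n.+1 by exact: ell_weight.
    transitivity (\sum_(b : bool) \sum_(j < nb_whitney n) 4 * Q * bb * (bb ^+ n * normc (f (whitney_pt ((-1) ^+ b) n j)) `^ p)).
      rewrite pair_big /=; apply: eq_bigr => -[b j] _; rewrite /a /mm /cen /=.
      transitivity (4 * Q * (ell R n `^ beta * ell R n ^+ 2) * normc (f (whitney_pt ((-1) ^+ b) n j)) `^ p); first by ring.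
      by rewrite lE exprS; ring.
    rewrite big_bool /= addrC; congr (_ + _); by rewrite -!mulr_sumr.
  under eq_bigr do rewrite E.
  rewrite big_split /= -!mulr_sumr -mulrDr ler_wpM2l//; first by rewrite mulr_ge0// mulr_ge0.
  by apply: lerD; [exact: HM0|exact: HM1].
- by rewrite ltry.
Qed.
End Distortion.

(** * Membership in the weighted Bergman space *)

Theorem theorem3 (R : realType) (K beta : R) (hK : 1 <= K) (hbeta : -1 < beta)
    (p : R) (hp0 : 0 < p) (hp : (p%:E < (beta + 2)%:E / alphaK K)%E) :
  SHK K `<=` bergman p beta.
Proof.
move=> f [h [g rep]]; split; first by case: rep => -[cr _ _] _; exists h, g.
have [al [al0 alK alp]] : exists al : R, [/\ 0 < al, (alphaK K <= al%:E)%E & al * p < beta + 2].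
  (* The class is not empty as it contains [f], so the supremum is not [-oo]. *)
  have A0 : (0 <= alphaK K)%E.
    apply: (@le_trans _ _ (normc (derive1n 2 (h : Cplx R -> Cplx R) 0 / 2))%:E).
      by rewrite lee_fin normc_ge0.
    by apply: ereal_sup_ubound; exists f, h, g.
  have b2 : 0 < beta + 2 by lra.
  move: hp A0; case: (alphaK K) => [x| |] //=.
  - rewrite lee_fin => + x0.
    have [->|xn0] := eqVneq x 0.
      (* Any positive bound that satisfies the last inequality covers a supremum equal to 0. *)
      move=> _; exists ((beta + 2) / p / 2); split; rewrite ?lee_fin ?divr_ge0 ?divr_gt0 ?(ltW b2) ?(ltW hp0)//.
      have -> : (beta + 2) / p / 2 * p = (beta + 2) / 2 by field; rewrite gt_eqF.
      lra.
    have xp : 0 < x by rewrite lt_def xn0.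
    rewrite inver (negbTE xn0) -EFinM lte_fin ltr_pdivlMr// => H.
    by exists x; split; rewrite ?lee_fin// mulrC.
  - by rewrite invey mule0 lte_fin ltNge ltW.
have [h0 g0 dh0] := rep_00 rep.
have z0 : normc (0 : R[i]) < 1 by rewrite normc0.
apply: (@bergman_integral_finite R f h g (derive1 (h : Cplx R -> Cplx R)) (derive1 (g : Cplx R -> Cplx R))
  (derive1 (derive1 (h : Cplx R -> Cplx R))) ((K - 1) / (K + 1)) al) => //.
- by move=> z z1; exact: analytic_cdiff (rep_h rep) z1.
- by move=> z z1; exact: analytic_cdiff (rep_g rep) z1.
- by move=> z z1; exact: analytic_cdiff2 (rep_h rep) z1.
- by move=> z z1; exact: (rep_dh0 rep).
- by move=> z z1; exact: (rep_dg rep).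
- exact: rep_k.
- by move=> z z1; apply: (pre_schwarzian_le rep).
- by move=> z z1; exact: (rep_f rep).
- by move=> z w z1 w1; exact: (rep_inj rep).
- by rewrite (rep_f rep z0) h0 g0; apply/eqP; rewrite eq_complex /= oppr0 addr0 eqxx.
Qed.
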